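(* Let $\mathbf{k}$ be a discrete field. (i) Let $(A,\mu,\lambda,\eta)$ be a unital coFrobenius bialgebra with copairing $c$ such that the induced map $\vec c:A^\vee\to A$ is a topological isomorphism. Then $$\varepsilon=(-1)^{|\mu||\lambda|+|\lambda|+|\mu|}\,\eta^\vee\,\vec c^{\,-1}$$ makes $(A,\mu,\lambda,\eta,\varepsilon)$ a biunital coFrobenius bialgebra. (ii) Let $(A,\mu,\lambda,\varepsilon)$ be a counital coFrobenius bialgebra with pairing $p$ such that the induced map $\vec p:A\to A^\vee$ is a topological isomorphism. Then $$\eta=(-1)^{|p|}\,\vec p^{\,-1}(\varepsilon^\vee)$$ makes $(A,\mu,\lambda,\eta,\varepsilon)$ a biunital coFrobenius bialgebra.
   Context: **Tate vector spaces.** $\mathbf{k}$ is a field with the discrete topology. A linearly topologized vector space is a $\mathbf{k}$-vector space with a Hausdorff translation-invariant topology having a neighbourhood basis of $0$ consisting of open linear subspaces; morphisms are continuous linear maps. Its completion is $\widehat A=\varprojlim_U A/U$ ($U$ ranging over open linear subspaces, each $A/U$ discrete, limit topologized inside the product); $A$ is complete if $A\to\widehat A$ is an isomorphism. $A$ is linearly compact if it is complete and $\dim A/U<\infty$ for every open linear subspace $U$; $A$ is Tate if it is complete and has an open linearly compact subspace. The dual $A^\vee=\mathrm{Hom}(A,\mathbf{k})$ (continuous linear maps) has neighbourhood basis of $0$ given by the annihilators $L^\perp$, $L\subset A$ linearly compact. On the algebraic tensor product $A\otimes B$: a linear subspace $Q$ is open in the $*$ topology iff (i) $U\otimes V\subset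 Q$ for some open linear $U\subset A,V\subset B$, (ii) for each $a\in A$ there is an open linear $V\subset B$ with $a\otimes V\subset Q$, (iii) for each $b\in B$ there is an open linear $U\subset A$ with $U\otimes b\subset Q$; it is open in the $!$ topology iff $U\otimes B+A\otimes V\subset Q$ for some open linear $U,V$. Completions: $A\hat\otimes^*B$, $A\hat\otimes^!B$. **Graded version.** A graded Tate vector space is $A=\bigoplus_{i\in\mathbb{Z}}A_i$ with each $A_i$ Tate; a homogeneous map of degree $k$ is a collection of continuous linear maps $A_i\to B_{i+k}$, and all maps and elements considered are homogeneous, with degree denoted $|\cdot|$. $A^\vee=\bigoplus_i A^\vee_i$, $A_i^\vee=\mathrm{Hom}(A_{-i},\mathbf{k})$. $(A\otimes^*B)_k=\bigoplus_{i+j=k}A_i\hat\otimes^*B_j$ and $(A\otimes^!B)_k=\prod_{i+j=k}A_i\hat\otimes^!B_j$. Both are commutative and associative up to canonical isomorphism, and the identity induces canonical continuous maps $A\otimes^*B\to A\otimes^!B$ and $A\otimes^*(B\otimes^!C)\to(A\otimes^*B)\otimes^!C$, which are inserted tacitly in compositions. **Signs.** $1$ is the identity map; $(\varphi\otimes\psi)(a\otimes b)=(-1)^{|\psi||a|}\varphi(a)\otimes\psi(b)$; $\tau(a\otimes b)=(-1)^{|a||b|}b\otimes a$; elements are viewed as maps from $\mathbf{k}$. A product is a map $\mu:A\otimes^*A\to A$; it is associative if $\mu(\mu\otimes1)=(-1)^{|\mu|}\mu(1\otimes\mu)$; $\eta\in A$ is a unit if $(-1)^{|\mu|}\mu(\eta\otimes1)=1=\mu(1\otimes\eta)$.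 A coproduct is a map $\lambda:A\to A\otimes^!A$; it is coassociative if $(\lambda\otimes1)\lambda=(-1)^{|\lambda|}(1\otimes\lambda)\lambda$; $\varepsilon:A\to\mathbf{k}$ is a counit if $(\varepsilon\otimes1)\lambda=1=(-1)^{|\lambda|}(1\otimes\varepsilon)\lambda$. The dual of $\varphi:A\to B$ is $\varphi^\vee:B^\vee\to A^\vee$, $\langle\varphi^\vee g,a\rangle=(-1)^{|g||\varphi|}\langle g,\varphi(a)\rangle$; thus $\eta^\vee:A^\vee\to\mathbf{k}$ is $\eta^\vee(f)=(-1)^{|f||\eta|}f(\eta)$, and $\varepsilon^\vee:\mathbf{k}\to A^\vee$ is the element $\varepsilon\in A^\vee$. **Unital coFrobenius bialgebra** $(A,\mu,\lambda,\eta)$: a graded Tate vector space $A$ with an associative product $\mu$ with unit $\eta$ and a coassociative coproduct $\lambda$ such that, with copairing $c=(-1)^{|\lambda||\mu|+|\mu|}\lambda\eta\in A\otimes^!A$, one has $\lambda=(1\otimes\mu)(c\otimes1)=(-1)^{|\mu|}(\mu\otimes1)(1\otimes c)$ and $\tau c=(-1)^{|\lambda|}c$. **Counital coFrobenius bialgebra** $(A,\mu,\lambda,\varepsilon)$: a graded Tate vector space $A$ with an associative product $\mu$ and a coassociative coproduct $\lambda$ with counit $\varepsilon\in A^\vee$ such that, with pairing $p=(-1)^{|\lambda|}\varepsilon\mu:A\otimes^*A\to\mathbf{k}$, one has $\mu=(-1)^{|\mu||\lambda|+|\lambda|}(p\otimes1)(1\otimes\lambda)=(-1)^{|\mu||\lambda|}(1\otimes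 p)(\lambda\otimes1)$ and $p\tau=(-1)^{|\mu|}p$. **Biunital coFrobenius bialgebra** $(A,\mu,\lambda,\eta,\varepsilon)$: a graded Tate vector space with an associative product $\mu$ with unit $\eta$ and a coassociative coproduct $\lambda$ with counit $\varepsilon$ such that all the relations for $c$ and $p$ listed in the two previous definitions hold. **The maps $\vec p,\vec c$.** $\vec p(a)(b)=p(a\otimes b)$; $\vec c(f)=(-1)^{|f||c|}(f\otimes1)c$. *)

(* Defs.v *)
From HB Require Import structures.
From mathcomp Require Import all_boot all_order all_algebra.
From mathcomp Require Import generic_quotient.
From mathcomp Require Import all_classical topology.

Set Implicit Arguments.
Unset Strict Implicit.
Unset Printing Implicit Defensive.

Import GRing.Theory.
Local Open Scope classical_set_scope.
Local Open Scope ring_scope.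
Local Open Scope quotient_scope.

Section Subspace.
Variables (k : fieldType) (V : lmodType k).

Record subspace := Subspace {
  subspace_set :> V -> Prop;
  subspace0 : subspace_set 0;
  subspaceL : forall a x y,
    subspace_set x -> subspace_set y -> subspace_set (a *: x + y) }.

Implicit Types L M : subspace.

Lemma subspaceD L x y : L x -> L y -> L (x + y).
Proof. by move=> Lx Ly; rewrite -[x]scale1r; exact: subspaceL. Qed.

Lemma subspaceZ L a x : L x -> L (a *: x).
Proof. by move=> Lx; rewrite -[_ *: _]addr0; apply: subspaceL => //; exact: subspace0. Qed.

Lemma subspaceN L x : L x -> L (- x).
Proof. by rewrite -scaleN1r; exact: subspaceZ. Qed.

Lemma subspaceB L x y : L x -> L y -> L (x - y).
Proof. by move=> Lx Ly; apply: subspaceD => //; exact: subspaceN. Qed.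

Program Definition subspaceI L M : subspace := @Subspace (L `&` M) _ _.
Next Obligation. by move=> L M; split; exact: subspace0. Qed.
Next Obligation.
by move=> L M a x y [Lx Mx] [Ly My]; split; exact: subspaceL.
Qed.

Program Definition span (X : set V) : subspace :=
  @Subspace [set x | forall L, X `<=` L -> L x] _ _.
Next Obligation. by move=> X L _; exact: subspace0. Qed.
Next Obligation.
by move=> X a x y Xx Xy L XL; apply: subspaceL; [exact: Xx|exact: Xy].
Qed.

Lemma subspace_eq L M : (L : set V) = M -> L = M.
Proof.
by case: L M => [L L0 LL] [M M0 ML] /= E; subst M; congr Subspace; exact: Prop_irrelevance.
Qed.

Section Sub.
Variable L : subspace.

Definition in_sub : pred V := fun x => `[< L x >].

Lemma in_sub_closed : submod_closed in_sub.
Proof.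
split; first exact/asboolP/subspace0.
by move=> a x y /asboolP Lx /asboolP Ly; exact/asboolP/subspaceL.
Qed.

HB.instance Definition _ := GRing.isSubmodClosed.Build k V in_sub in_sub_closed.

Definition sub_of := {x : V | in_sub x}.
HB.instance Definition _ := [isSub of sub_of for sval].
HB.instance Definition _ := [Choice of sub_of by <:].
HB.instance Definition _ := [SubChoice_isSubLmodule of sub_of by <:].

Definition mksub (x : V) (Lx : L x) : sub_of := exist _ x (asboolT Lx).

Lemma sub_ofP (x : sub_of) : L (val x).
Proof. by apply/asboolP; exact: (valP x). Qed.

Definition eqmod : rel V := fun x y => in_sub (x - y).

Lemma eqmod_equiv : equiv_class_of eqmod.
Proof.
split=> [x|x y|y x z]; rewrite /eqmod /in_sub.
- by rewrite subrr; exact/asboolP/subspace0.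
- by apply/idP/idP => /asboolP h; apply/asboolP; rewrite -opprB; exact: subspaceN.
- move=> /asboolP h1 /asboolP h2; apply/asboolP.
  by rewrite -[x](subrK y) -addrA; exact: subspaceD.
Qed.
Canonical eqmod_equiv_rel := EquivRelPack eqmod_equiv.
Canonical eqmod_encModRel := defaultEncModRel eqmod.

Definition quo := {eq_quot eqmod}.
HB.instance Definition _ : EqQuotient V eqmod quo := EqQuotient.on quo.
HB.instance Definition _ := Choice.on quo.

Definition cls (x : V) : quo := \pi_quo x.

Lemma eq_clsP x y : cls x = cls y <-> L (x - y).
Proof.
by split=> [/eqmodP/asboolP|h]; last by apply/eqmodP/asboolP.
Qed.

Lemma clsK (q : quo) : cls (repr q) = q.
Proof. exact: reprK. Qed.

Lemma clsW (P : quo -> Prop) : (forall x, P (cls x)) -> forall q, P q.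
Proof. by move=> h q; rewrite -[q]reprK; exact: h. Qed.

Definition quo_add (p q : quo) := cls (repr p + repr q).
Definition quo_opp (p : quo) := cls (- repr p).
Definition quo_scale a (p : quo) := cls (a *: repr p).

Lemma reprB x : L (repr (cls x) - x).
Proof. by apply/eq_clsP; rewrite /cls reprK. Qed.

Lemma quo_addE x y : quo_add (cls x) (cls y) = cls (x + y).
Proof. by apply/eq_clsP; rewrite opprD addrACA; apply: subspaceD; exact: reprB. Qed.
Lemma quo_oppE x : quo_opp (cls x) = cls (- x).
Proof. by apply/eq_clsP; rewrite -opprD; apply: subspaceN; exact: reprB. Qed.
Lemma quo_scaleE a x : quo_scale a (cls x) = cls (a *: x).
Proof. by apply/eq_clsP; rewrite -scalerBr; apply: subspaceZ; exact: reprB. Qed.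

Fact quo_addA : associative quo_add.
Proof.
by elim/clsW=> x; elim/clsW=> y; elim/clsW=> z; rewrite !quo_addE addrA.
Qed.
Fact quo_addC : commutative quo_add.
Proof. by elim/clsW=> x; elim/clsW=> y; rewrite !quo_addE addrC. Qed.
Fact quo_add0 : left_id (cls 0) quo_add.
Proof. by elim/clsW=> x; rewrite quo_addE add0r. Qed.
Fact quo_addN : left_inverse (cls 0) quo_opp quo_add.
Proof. by elim/clsW=> x; rewrite quo_oppE quo_addE addNr. Qed.

HB.instance Definition _ :=
  GRing.isZmodule.Build quo quo_addA quo_addC quo_add0 quo_addN.

Fact quo_scaleA a b v : quo_scale a (quo_scale b v) = quo_scale (a * b) v.
Proof. by elim/clsW: v => x; rewrite !quo_scaleE scalerA. Qed.
Fact quo_scale1 : left_id 1 quo_scale.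
Proof. by elim/clsW=> x; rewrite quo_scaleE scale1r. Qed.
Fact quo_scaleDr : right_distributive quo_scale +%R.
Proof.
move=> a; elim/clsW=> x; elim/clsW=> y.
by rewrite /GRing.add /= quo_addE !quo_scaleE quo_addE scalerDr.
Qed.
Fact quo_scaleDl v : {morph quo_scale^~ v : a b / a + b}.
Proof.
move=> a b; elim/clsW: v => x.
by rewrite [RHS]/GRing.add /= !quo_scaleE quo_addE scalerDl.
Qed.

HB.instance Definition _ :=
  GRing.Zmodule_isLmodule.Build k quo quo_scaleA quo_scale1 quo_scaleDr quo_scaleDl.

Lemma cls_linear : linear cls.
Proof. by move=> a x y; rewrite -quo_addE -quo_scaleE. Qed.

Lemma clsZ a x : cls (a *: x) = a *: cls x.
Proof. exact/esym/quo_scaleE. Qed.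

Lemma clsD x y : cls (x + y) = cls x + cls y.
Proof. exact/esym/quo_addE. Qed.

End Sub.
End Subspace.

HB.mixin Record isLinTop (k : fieldType) V of GRing.Lmodule k V & Topological V := {
  lt_translation : forall (a : V) (W : set V), open W -> open [set a + x | x in W];
  lt_hausdorff : hausdorff_space V;
  lt_basis : forall W : set V, nbhs (0 : V) W ->
    exists U : subspace V, open U /\ U `<=` W }.

#[short(type="linTopType")]
HB.structure Definition LinTop (k : fieldType) :=
  {V of isLinTop k V & GRing.Lmodule k V & Topological V}.

(** A family of linear subspaces that is a neighbourhood basis of [0] for a
    (possibly non-Hausdorff) linear topology. *)
Record linbase (k : fieldType) (V : lmodType k) := LinBase {
  linbase_set :> subspace V -> Prop;
  linbase_neq0 : exists U, linbase_set U;
  linbase_dir : forall U1 U2, linbase_set U1 -> linbase_set U2 ->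
    exists U, [/\ linbase_set U, U `<=` U1 & U `<=` U2] }.

HB.factory Record Lmodule_isLinTop (k : fieldType) V of GRing.Lmodule k V := {
  lb : linbase V;
  lb_separated : forall x : V, (forall U, lb U -> U x) -> x = 0 }.

HB.builders Context k V of Lmodule_isLinTop k V.

Definition lb_nbhs (x : V) : set_system V :=
  [set W | exists U : subspace V, lb U /\ forall u, U u -> W (x + u)].

HB.instance Definition _ := hasNbhs.Build V lb_nbhs.

Fact lb_nbhs_filter (x : V) : ProperFilter (nbhs x).
Proof.
apply: Build_ProperFilter_ex.
  by move=> W [U [_ UW]]; exists (x + 0); apply: UW; exact: subspace0.
split.
- by have [U bU] := linbase_neq0 lb; exists U.
- move=> W1 W2 [U1 [b1 h1]] [U2 [b2 h2]].
  have [U [bU s1 s2]] := linbase_dir b1 b2.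
  by exists U; split=> // u Uu; split; [apply/h1/s1|apply/h2/s2].
- by move=> W1 W2 s12 [U [bU h]]; exists U; split=> // u /h/s12.
Qed.

Fact lb_nbhs_singleton (x : V) (W : set V) : nbhs x W -> W x.
Proof. by move=> [U [_ h]]; rewrite -[x]addr0; apply: h; exact: subspace0. Qed.

Fact lb_nbhs_nbhs (x : V) (W : set V) : nbhs x W -> nbhs x (nbhs^~ W).
Proof.
move=> [U [bU h]]; exists U; split=> // u Uu; exists U; split=> // v Uv.
by rewrite -addrA; apply: h; exact: subspaceD.
Qed.

HB.instance Definition _ := Nbhs_isNbhsTopological.Build V
  lb_nbhs_filter lb_nbhs_singleton lb_nbhs_nbhs.

Fact lb_open (U : subspace V) : lb U -> open (U : set V).
Proof.
by move=> bU; rewrite openE => x Ux; exists U; split=> // u; exact: subspaceD.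
Qed.

Fact lb_translation (a : V) (W : set V) : open W -> open [set a + x | x in W].
Proof.
rewrite !openE => oW _ [x Wx <-]; have [U [bU h]] := oW _ Wx.
by exists U; split=> // u /h Wxu; exists (x + u); rewrite ?addrA.
Qed.

Fact lb_hausdorff : hausdorff_space V.
Proof.
move=> x y xy; apply/eqP; rewrite -subr_eq0; apply/eqP/lb_separated => U bU.
have nU (z : V) : nbhs z [set (z + u : V) | u in (U : set V)] by exists U; split=> // u Uu; exists u.
have [_ [[u Uu <-] [v Uv e]]] := xy _ _ (nU x) (nU y).
have -> : x - y = v - u by rewrite -[x](addrK u) -e addrAC [y + v]addrC addrK.
exact: subspaceB.
Qed.

Fact lb_basis (W : set V) : nbhs (0 : V) W ->
  exists U : subspace V, open U /\ U `<=` W.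
Proof.
move=> [U [bU h]]; exists U; split; first exact: lb_open.
by move=> u /h; rewrite add0r.
Qed.

HB.instance Definition _ :=
  isLinTop.Build k V lb_translation lb_hausdorff lb_basis.

HB.end.

Definition subspaceT (k : fieldType) (V : lmodType k) : subspace V :=
  @Subspace _ _ setT I (fun _ _ _ _ _ => I).

Program Definition subspace00 (k : fieldType) (V : lmodType k) : subspace V :=
  @Subspace _ _ [set 0] _ _.
Next Obligation. by []. Qed.
Next Obligation. by move=> k V a x y -> ->; rewrite scaler0 addr0. Qed.

Section LinTopTheory.
Variables (k : fieldType) (V : linTopType k).

Lemma nbhs_linP (x : V) (W : set V) :
  nbhs x W <-> exists U : subspace V, open U /\ forall u, U u -> W (x + u).
Proof.
split=> [|[U [oU UW]]].
  rewrite nbhsE => -[B [oB Bx] BW].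
  have oB' := lt_translation (- x) _ oB.
  have : nbhs (0 : V) [set - x + y | y in B].
    by apply: open_nbhs_nbhs; split=> //; exists x => //; rewrite addNr.
  move=> /(lt_basis _)[U [oU UB]]; exists U; split=> // u /UB[y By <-].
  by apply: BW; rewrite addrA subrr add0r.
rewrite nbhsE; exists [set x + u | u in (U : set V)]; last by move=> _ [u /UW ? <-].
by split; [exact: lt_translation|exists 0; [exact: subspace0|rewrite addr0]].
Qed.

Lemma open_subspaceP (U : subspace V) :
  (exists U' : subspace V, open U' /\ U' `<=` U) -> open U.
Proof.
move=> [U' [oU' s]]; rewrite openE => x Ux; apply/nbhs_linP.
by exists U'; split=> // u /s; exact: subspaceD.
Qed.

Lemma open_subspaceI (U U' : subspace V) :
  open U -> open U' -> open (subspaceI U U').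
Proof. exact: openI. Qed.

Lemma open_separated (x : V) : (forall U : subspace V, open U -> U x) -> x = 0.
Proof.
move=> h; apply: (lt_hausdorff) => A B /nbhs_linP[U [oU UA]] /nbhs_linP[U' [oU' UB]].
exists 0; split; first by rewrite -(subrr x); apply: UA; apply: subspaceN; exact: h.
by rewrite -[0]addr0; apply: UB; exact: subspace0.
Qed.

Program Definition open_linbase : linbase V :=
  @LinBase _ _ [set U : subspace V | open U] _ _.
Next Obligation. by exists (subspaceT V); exact: openT. Qed.
Next Obligation.
move=> U U' oU oU'; exists (subspaceI U U'); split=> [|x []|x []] //.
exact: open_subspaceI.
Qed.

End LinTopTheory.

Lemma linear_continuousP (k : fieldType) (V W : linTopType k) (f : V -> W) :
  linear f ->
  (continuous f <-> forall U : subspace W, open U ->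
     exists U' : subspace V, open U' /\ forall x, U' x -> U (f x)).
Proof.
move=> fL; have f0 : f 0 = 0.
  by have := fL (-1) 0 0; rewrite scaler0 addr0 scaleN1r addNr.
have fD x y : f (x + y) = f x + f y by have := fL 1 x y; rewrite !scale1r.
split=> [fc U oU|h x B].
  have /fc : nbhs (f 0) U.
    by apply: open_nbhs_nbhs; split=> //; rewrite f0; exact: subspace0.
  by move=> /nbhs_linP[U' [oU' h]]; exists U'; split=> // x /h; rewrite /= add0r.
move=> /nbhs_linP[U [oU UB]]; have [U' [oU' U'U]] := h _ oU.
apply/nbhs_linP; exists U'; split=> // u /U'U /UB.
by rewrite /= fD.
Qed.

Definition discr (V : Type) := V.

Section Discrete.
Variables (k : fieldType) (V : lmodType k).
HB.instance Definition _ := GRing.Lmodule.on (discr V).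

Program Definition discr_linbase : linbase (discr V) :=
  @LinBase _ _ [set subspace00 (discr V)] _ _.
Next Obligation. by exists (subspace00 (discr V)). Qed.
Next Obligation. by move=> U U' -> ->; exists (subspace00 (discr V)); split. Qed.

Fact discr_separated (x : discr V) : (forall U, discr_linbase U -> U x) -> x = 0.
Proof. by move=> h; exact: (h _ erefl). Qed.

HB.instance Definition _ :=
  Lmodule_isLinTop.Build k (discr V) discr_separated.
End Discrete.

Section SubTop.
Variables (k : fieldType) (V : linTopType k) (L : subspace V).

Program Definition sub_preim (U : subspace V) : subspace (sub_of L) :=
  @Subspace _ _ [set x | U (val x)] _ _.
Next Obligation. by move=> U; exact: subspace0. Qed.
Next Obligation. by move=> U a x y; exact: subspaceL. Qed.

Program Definition sub_linbase : linbase (sub_of L) :=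
  @LinBase _ _ [set K | exists2 U : subspace V, open U & K = sub_preim U] _ _.
Next Obligation. by exists (sub_preim (subspaceT V)), (subspaceT V) => //; exact: openT. Qed.
Next Obligation.
move=> _ _ [U oU ->] [U' oU' ->]; exists (sub_preim (subspaceI U U')).
split=> [|x []|x []] //; exists (subspaceI U U') => //; exact: open_subspaceI.
Qed.

Fact sub_separated (x : sub_of L) : (forall U, sub_linbase U -> U x) -> x = 0.
Proof.
move=> h; apply/val_inj/open_separated => U oU.
by have := h (sub_preim U); apply; exists U.
Qed.

HB.instance Definition _ := Lmodule_isLinTop.Build k (sub_of L) sub_separated.
End SubTop.

Definition prodv (k : fieldType) (I : Type) (V : I -> lmodType k) := forall i, V i.

Section ProdLmod.
Variables (k : fieldType) (I : Type) (V : I -> lmodType k).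
Local Notation P := (prodv V).

HB.instance Definition _ := Choice.copy P (forall i, V i).

Definition prodv_add (x y : P) : P := fun i => x i + y i.
Definition prodv_opp (x : P) : P := fun i => - x i.
Definition prodv_zero : P := fun i => 0.
Definition prodv_scale a (x : P) : P := fun i => a *: x i.

Fact prodv_addA : associative prodv_add.
Proof. by move=> x y z; apply: functional_extensionality_dep => i; exact: addrA. Qed.
Fact prodv_addC : commutative prodv_add.
Proof. by move=> x y; apply: functional_extensionality_dep => i; exact: addrC. Qed.
Fact prodv_add0 : left_id prodv_zero prodv_add.
Proof. by move=> x; apply: functional_extensionality_dep => i; exact: add0r. Qed.
Fact prodv_addN : left_inverse prodv_zero prodv_opp prodv_add.
Proof. by move=> x; apply: functional_extensionality_dep => i; exact: addNr. Qed.

HB.instance Definition _ :=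
  GRing.isZmodule.Build P prodv_addA prodv_addC prodv_add0 prodv_addN.

Fact prodv_scaleA a b x : prodv_scale a (prodv_scale b x) = prodv_scale (a * b) x.
Proof. by apply: functional_extensionality_dep => i; exact: scalerA. Qed.
Fact prodv_scale1 : left_id 1 prodv_scale.
Proof. by move=> x; apply: functional_extensionality_dep => i; exact: scale1r. Qed.
Fact prodv_scaleDr : right_distributive prodv_scale +%R.
Proof. by move=> a x y; apply: functional_extensionality_dep => i; exact: scalerDr. Qed.
Fact prodv_scaleDl x : {morph prodv_scale^~ x : a b / a + b}.
Proof. by move=> a b; apply: functional_extensionality_dep => i; exact: scalerDl. Qed.

HB.instance Definition _ := GRing.Zmodule_isLmodule.Build k P
  prodv_scaleA prodv_scale1 prodv_scaleDr prodv_scaleDl.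

Program Definition prodv_box (F : set I) (U : forall i, subspace (V i)) : subspace P :=
  @Subspace _ _ [set x | forall i, F i -> U i (x i)] _ _.
Next Obligation. by move=> F U i _; exact: subspace0. Qed.
Next Obligation.
by move=> F U a x y h1 h2 i Fi; apply: subspaceL; [exact: h1|exact: h2].
Qed.

Program Definition finsupp : subspace P :=
  @Subspace _ _ [set x | finite_set [set i | x i != 0]] _ _.
Next Obligation.
by apply: (sub_finite_set _ (finite_set0 I)) => i /=; rewrite eqxx.
Qed.
Next Obligation.
move=> a x y fx fy; have : finite_set ([set i | x i != 0] `|` [set i | y i != 0]).
  by rewrite finite_setU.
apply: sub_finite_set => i /= nz.
have [x0|] := eqVneq (x i) 0; last by left.
have [y0|] := eqVneq (y i) 0; last by right.
by case/eqP: nz; rewrite /GRing.add /GRing.scale /= /prodv_add /prodv_scale x0 y0 scaler0 addr0.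
Qed.

Definition dsumv := sub_of finsupp.
HB.instance Definition _ := GRing.Lmodule.on dsumv.

End ProdLmod.

Section Inj.
Variables (k : fieldType) (I : eqType) (V : I -> lmodType k).

Definition prodv_inj (i : I) (x : V i) : prodv V := dfwith (fun j => 0 : V j) i x.

Fact dsumv_inj_subproof (i : I) (x : V i) : finsupp V (prodv_inj x).
Proof.
apply: (sub_finite_set _ (finite_set1 i)) => j /=.
by rewrite /prodv_inj; have [e _|ij] := eqVneq i j; [exact/esym|rewrite dfwithout ?eqxx].
Qed.

Definition dsumv_inj (i : I) (x : V i) : dsumv V := mksub (dsumv_inj_subproof x).

End Inj.

Section ProdTop.
Variables (k : fieldType) (I : Type) (V : I -> linTopType k).

Definition gprod := prodv V.
HB.instance Definition _ := GRing.Lmodule.on gprod.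

Program Definition gprod_linbase : linbase gprod :=
  @LinBase _ _ [set K | exists F, exists U : forall i, subspace (V i),
    [/\ finite_set F, forall i, open (U i) & K = prodv_box F U]] _ _.
Next Obligation.
exists (prodv_box set0 (fun i => subspaceT (V i))).
by exists set0, (fun i => subspaceT (V i)); split=> // i; exact: openT.
Qed.
Next Obligation.
move=> _ _ [F [U [fF oU ->]]] [F' [U' [fF' oU' ->]]].
exists (prodv_box (F `|` F') (fun i => subspaceI (U i) (U' i))); split.
- exists (F `|` F'), (fun i => subspaceI (U i) (U' i)).
  split=> [|i|//]; [by rewrite finite_setU|exact: open_subspaceI].
- by move=> x h i Fi; apply: (h i _).1; left.
- by move=> x h i Fi; apply: (h i _).2; right.
Qed.

Fact gprod_separated (x : gprod) : (forall U, gprod_linbase U -> U x) -> x = 0.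
Proof.
move=> h; apply: functional_extensionality_dep => i; apply: open_separated => U oU.
pose W j : subspace (V j) := if pselect (i = j) is left e then ecast j (subspace (V j)) e U else subspaceT (V j).
have Wi : W i = U.
  by rewrite /W; case: pselect => // e; rewrite (Prop_irrelevance e erefl).
have oW j : open (W j).
  by rewrite /W; case: pselect => [e|_]; [case: _ / e|exact: openT].
rewrite -Wi; apply: (h (prodv_box [set i] W)) => //.
by exists [set i], W; split.
Qed.

HB.instance Definition _ := Lmodule_isLinTop.Build k gprod gprod_separated.

End ProdTop.

(** The direct sum, with the finest linear topology for which the inclusions of
    the summands are continuous: a linear subspace is open iff its intersection
    with each summand is, i.e. iff it contains a direct sum of open subspaces. *)
Section SumTop.
Variables (k : fieldType) (I : Type) (V : I -> linTopType k).

Definition gsum := dsumv V.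
HB.instance Definition _ := GRing.Lmodule.on gsum.

Program Definition gsum_box (U : forall i, subspace (V i)) : subspace gsum :=
  @Subspace _ _ [set x | forall i, U i (val (x : dsumv V) i)] _ _.
Next Obligation. by move=> U i; exact: subspace0. Qed.
Next Obligation. by move=> U a x y h1 h2 i; exact: subspaceL. Qed.

Program Definition gsum_linbase : linbase gsum :=
  @LinBase _ _ [set K | exists2 U : forall i, subspace (V i),
    forall i, open (U i) & K = gsum_box U] _ _.
Next Obligation.
exists (gsum_box (fun i => subspaceT (V i))), (fun i => subspaceT (V i)) => // i.
exact: openT.
Qed.
Next Obligation.
move=> _ _ [U oU ->] [U' oU' ->].
exists (gsum_box (fun i => subspaceI (U i) (U' i))); split.
- by exists (fun i => subspaceI (U i) (U' i)) => // i; exact: open_subspaceI.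
- by move=> x h i; exact: (h i).1.
- by move=> x h i; exact: (h i).2.
Qed.

Fact gsum_separated (x : gsum) : (forall U, gsum_linbase U -> U x) -> x = 0.
Proof.
move=> h; apply: val_inj; apply: functional_extensionality_dep => i.
apply: open_separated => U oU.
pose W j : subspace (V j) := if pselect (i = j) is left e then ecast j (subspace (V j)) e U else subspaceT (V j).
have Wi : W i = U.
  by rewrite /W; case: pselect => // e; rewrite (Prop_irrelevance e erefl).
have oW j : open (W j).
  by rewrite /W; case: pselect => [e|_]; [case: _ / e|exact: openT].
by rewrite -Wi; apply: (h (gsum_box W)); exists W.
Qed.

HB.instance Definition _ := Lmodule_isLinTop.Build k gsum gsum_separated.

End SumTop.

(** The completion [lim_U V / U] of a vector space for the linear topology with
    basis [B]; a basis of neighbourhoods of [0] is given by the kernels of the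
    projections to the discrete spaces [V / U]. *)
Section Completion.
Variables (k : fieldType) (V : lmodType k) (B : linbase V).

Definition linbase_ix := {U : subspace V | B U}.
Definition ix_sub (U : linbase_ix) : subspace V := sval U.

Program Definition compatible : subspace (prodv (fun U : linbase_ix => quo (ix_sub U))) :=
  @Subspace _ _ [set x | forall U U' : linbase_ix, ix_sub U `<=` ix_sub U' ->
    forall v, x U = cls _ v -> x U' = cls _ v] _ _.
Next Obligation.
move=> U U' s v /eqmodP/asboolP h; apply/eqmodP/asboolP; exact: s.
Qed.
Next Obligation.
move=> a x y hx hy U U' s v.
have Ex := esym (clsK (x U)); have Ey := esym (clsK (y U)).
have E W : (a *: x + y) W = a *: x W + y W by [].
rewrite !E {1}Ex {1}Ey (hx _ _ s _ Ex) (hy _ _ s _ Ey) -!cls_linear => /eq_clsP h.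
by apply/eq_clsP; exact: s.
Qed.

Definition completion := sub_of compatible.
HB.instance Definition _ := GRing.Lmodule.on completion.

Definition compl_pr (U : linbase_ix) (x : completion) : quo (ix_sub U) := sval x U.

Program Definition compl_ker (U : linbase_ix) : subspace completion :=
  @Subspace _ _ [set x | compl_pr U x = 0] _ _.
Next Obligation. by []. Qed.
Next Obligation.
move=> U a x y hx hy; rewrite /compl_pr /= /GRing.add /GRing.scale /=.
rewrite /prodv_add /prodv_scale.
by move: hx hy; rewrite /compl_pr => -> ->; rewrite scaler0 addr0.
Qed.

Program Definition compl_linbase : linbase completion :=
  @LinBase _ _ [set K | exists U, K = compl_ker U] _ _.
Next Obligation.
by have [U bU] := linbase_neq0 B; exists (compl_ker (exist _ U bU)), (exist _ U bU).
Qed.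
Next Obligation.
move=> _ _ [[U bU] ->] [[U' bU'] ->].
have [W [bW s s']] := linbase_dir bU bU'.
exists (compl_ker (exist _ W bW)); split; first by exists (exist _ W bW).
  by move=> x /=; exact: (sub_ofP x) (exist _ W bW) (exist _ U bU) s 0.
by move=> x /=; exact: (sub_ofP x) (exist _ W bW) (exist _ U' bU') s' 0.
Qed.

Fact compl_separated (x : completion) : (forall U, compl_linbase U -> U x) -> x = 0.
Proof.
move=> h; apply: val_inj; apply: functional_extensionality_dep => U.
by apply: (h (compl_ker U)); exists U.
Qed.

HB.instance Definition _ := Lmodule_isLinTop.Build k completion compl_separated.

Fact to_compl_subproof (v : V) : compatible (fun U => cls (ix_sub U) v).
Proof. by move=> U U' s w /eq_clsP h; apply/eq_clsP; exact: s. Qed.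

Definition to_compl (v : V) : completion := mksub (@to_compl_subproof v).

End Completion.

Section Tate.
Variables (k : fieldType) (V : linTopType k).

Definition complete :=
  exists g : completion (open_linbase V) -> V,
    [/\ cancel (to_compl (open_linbase V)) g, cancel g (to_compl (open_linbase V)),
        continuous (to_compl (open_linbase V)) & continuous g].

Definition fin_codim (U : subspace V) :=
  exists (n : nat) (v : 'I_n -> quo U),
    forall x : quo U, exists c : 'I_n -> k, x = \sum_(i < n) c i *: v i.

Definition linearly_compact :=
  complete /\ forall U : subspace V, open U -> fin_codim U.

End Tate.

Arguments complete {k} V.
Arguments linearly_compact {k} V.

Definition lincompact_sub (k : fieldType) (V : linTopType k) (L : subspace V) :=
  linearly_compact (sub_of L : linTopType k).

Definition tate (k : fieldType) (V : linTopType k) :=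
  complete V /\ exists L : subspace V, open L /\ lincompact_sub L.

Section Hom.
Variables (k : fieldType) (V W : linTopType k).

Program Definition clinear : subspace (prodv (fun _ : V => W)) :=
  @Subspace _ _ [set f : V -> W | linear f /\ continuous f] _ _.
Next Obligation.
split=> [a x y|x]; first by rewrite scaler0 addr0.
exact: cvg_cst.
Qed.
Next Obligation.
move=> a f g [fL fc] [gL gc].
have L : linear (a *: f + g : prodv (fun _ : V => W)).
  have E z : (a *: f + g : prodv (fun _ : V => W)) z = a *: f z + g z by [].
  move=> b x y; rewrite !E.
  by rewrite fL gL !scalerDr !scalerA addrACA [a * b]mulrC.
split=> //; apply/linear_continuousP => // U oU.
have [U1 [o1 h1]] := (linear_continuousP fL).1 fc U oU.
have [U2 [o2 h2]] := (linear_continuousP gL).1 gc U oU.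
exists (subspaceI U1 U2); split; first exact: open_subspaceI.
by move=> x [/h1 ? /h2 ?]; exact: subspaceL.
Qed.

Definition hom := sub_of clinear.
HB.instance Definition _ := GRing.Lmodule.on hom.

Definition hom_fun (f : hom) : V -> W := sval f.
Coercion hom_fun : hom >-> Funclass.

Lemma hom_linear (f : hom) : linear f.
Proof. exact: (sub_ofP f).1. Qed.

Lemma hom_continuous (f : hom) : continuous f.
Proof. exact: (sub_ofP f).2. Qed.

Definition mkhom (f : V -> W) (fL : linear f) (fc : continuous f) : hom :=
  @mksub _ _ clinear f (conj fL fc).

Lemma homP (f g : hom) : f =1 g -> f = g.
Proof. by move=> h; apply: val_inj; exact: functional_extensionality_dep. Qed.

End Hom.

Section HomCat.
Variable k : fieldType.

Definition hom_id (V : linTopType k) : hom V V :=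
  @mkhom _ V V id (fun _ _ _ => erefl) (fun x => cvg_id).

Fact hom_comp_linear (V W X : linTopType k) (g : hom W X) (f : hom V W) :
  linear (fun x => g (f x)).
Proof. by move=> a x y; rewrite !hom_linear. Qed.

Fact hom_comp_continuous (V W X : linTopType k) (g : hom W X) (f : hom V W) :
  continuous (fun x => g (f x)).
Proof.
by move=> x; apply: continuous_comp; exact: hom_continuous.
Qed.

Definition hom_comp (V W X : linTopType k) (g : hom W X) (f : hom V W) : hom V X :=
  @mkhom _ V X _ (@hom_comp_linear _ _ _ g f) (@hom_comp_continuous _ _ _ g f).

End HomCat.

Section LineCompact.
Variables (k : fieldType) (V : linTopType k) (a : V).

Program Definition line : subspace V := @Subspace _ _ [set c *: a | c in setT] _ _.
Next Obligation. by exists 0; rewrite // scale0r. Qed.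
Next Obligation.
by move=> c _ _ [x _ <-] [y _ <-]; exists (c * x + y) => //; rewrite scalerDl scalerA.
Qed.

Lemma line_open0 : exists U : subspace (sub_of line : linTopType k),
  open U /\ forall x, U x -> x = 0.
Proof.
have [a0|/eqP na] := pselect (a = 0).
  exists (subspaceT _); split; first exact: openT.
  move=> x _; apply: val_inj; have [c _ <-] := sub_ofP x.
  by rewrite a0 scaler0.
have [U [oU Ua]] : exists U : subspace V, open U /\ ~ U a.
  apply: contrapT => h; case/eqP: na; apply: open_separated => U oU.
  by apply: contrapT => Ua; apply: h; exists U.
exists (sub_preim line U); split.
  rewrite openE => x Ux; exists (sub_preim line U); split; first by exists U.
  by move=> u; exact: subspaceD.
move=> x /= Ux; apply: val_inj => /=; have [c _ e] := sub_ofP x.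
have [c0|c0] := eqVneq c 0; first by rewrite -e c0 scale0r.
case: Ua; have -> : a = c^-1 *: val x by rewrite -e scalerA mulVf // scale1r.
exact: subspaceZ.
Qed.

Lemma line_compact : lincompact_sub line.
Proof.
have [U0 [oU0 U00]] := line_open0.
set W : linTopType k := sub_of line in U0 oU0 U00 *.
split; last first.
  move=> U _; exists 1%N.
  have la : line a by exists 1; rewrite // scale1r.
  exists (fun=> cls U (mksub la)); elim/clsW => x.
  have [c _ e] := sub_ofP x; exists (fun=> c).
  by rewrite big_ord1 -clsZ; congr cls; apply: val_inj; rewrite /= -e.
pose i0 : linbase_ix (open_linbase W) := exist _ U0 oU0.
pose g (x : completion (open_linbase W)) : W := repr (compl_pr i0 x).
have gK : cancel (to_compl (open_linbase W)) g.
  move=> x; apply/eqP; rewrite -subr_eq0; apply/eqP/U00; exact: reprB.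
have Kg : cancel g (to_compl (open_linbase W)).
  move=> x; apply: val_inj; apply: functional_extensionality_dep => U /=.
  apply/esym; apply: (sub_ofP x i0 U); last exact: esym (clsK _).
  by move=> u /U00 ->; exact: subspace0.
exists g; split=> //.
- have L : linear (to_compl (open_linbase W)).
    move=> c x y; apply: val_inj; apply: functional_extensionality_dep => U.
    exact: cls_linear.
  apply/linear_continuousP => // U _; exists U0; split=> // x /U00 ->.
  have -> : to_compl (open_linbase W) 0 = 0.
    by apply: val_inj; apply: functional_extensionality_dep => U'.
  exact: subspace0.
- move=> x A gA; exists (compl_ker i0); split; first by exists i0.
  move=> u /= u0; have -> : g (x + u) = g x; last exact: nbhs_singleton.
  rewrite /g; congr repr.
  have -> : compl_pr i0 (x + u) = compl_pr i0 x + compl_pr i0 u by [].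
  by rewrite u0 addr0.
Qed.

End LineCompact.

Definition groundF (k : fieldType) : linTopType k := discr k^o.

Section Dual.
Variables (k : fieldType) (V : linTopType k).

Definition dual := hom V (groundF k).
HB.instance Definition _ := GRing.Lmodule.on dual.

Program Definition annihilator (L : subspace V) : subspace dual :=
  @Subspace _ _ [set f : hom V (groundF k) | forall x, L x -> f x = 0] _ _.
Next Obligation. by []. Qed.
Next Obligation.
move=> L a f g hf hg x Lx; have -> : hom_fun (a *: f + g) x = a *: hom_fun f x + hom_fun g x by [].
by rewrite hf // hg // scaler0 addr0.
Qed.

Program Definition annihilators n (L : 'I_n -> subspace V) : subspace dual :=
  @Subspace _ _ [set f | forall i, annihilator (L i) f] _ _.
Next Obligation. by move=> n L i; exact: subspace0. Qed.
Next Obligation. by move=> n L a f g hf hg i; exact: subspaceL. Qed.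

(** The paper's basis of neighbourhoods of [0] consists of the annihilators of
    linearly compact subspaces.  Allowing finite intersections of them changes
    nothing, because a finite sum of linearly compact subspaces is linearly
    compact, and makes the family visibly filtered. *)
Program Definition dual_linbase : linbase dual :=
  @LinBase _ _ [set K | exists n, exists L : 'I_n -> subspace V,
    (forall i, lincompact_sub (L i)) /\ K = annihilators L] _ _.
Next Obligation.
pose L (i : 'I_0) : subspace V := subspaceT V.
by exists (annihilators L), 0%N, L; split=> // -[].
Qed.
Next Obligation.
move=> _ _ [n [L [cL ->]]] [n' [L' [cL' ->]]].
pose M (i : 'I_(n + n')) := match fintype.split i with inl j => L j | inr j => L' j end.
exists (annihilators M); split.
- by exists (n + n')%N, M; split=> // i; rewrite /M; case: fintype.split.
- by move=> f h i; have := h (lshift n' i); rewrite /M (unsplitK (inl i)).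
- by move=> f h i; have := h (rshift n i); rewrite /M (unsplitK (inr i)).
Qed.

Fact dual_separated (f : dual) : (forall U, dual_linbase U -> U f) -> f = 0.
Proof.
move=> h; apply: homP => a.
have /(_ ord0 a) : annihilators (fun _ : 'I_1 => line a) f.
  by apply: h; exists 1%N, (fun=> line a); split=> // _; exact: line_compact.
by apply; exists 1; rewrite // scale1r.
Qed.

HB.instance Definition _ := Lmodule_isLinTop.Build k dual dual_separated.

End Dual.

Section Tensor.
Variables (k : fieldType) (V W : lmodType k).

Definition freeVW := dsumv (fun _ : V * W => k^o).
Definition gen (v : V) (w : W) : freeVW := @dsumv_inj _ _ (fun _ => k^o) (v, w) 1.

Definition tensor_rel : set freeVW :=
  [set gen (p.1.1 *: p.1.2 + p.2.1) p.2.2 - p.1.1 *: gen p.1.2 p.2.2 - gen p.2.1 p.2.2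
     | p in [set: (k * V) * (V * W)] ] `|`
  [set gen p.2.2 (p.1.1 *: p.1.2 + p.2.1) - p.1.1 *: gen p.2.2 p.1.2 - gen p.2.2 p.2.1
     | p in [set: (k * W) * (W * V)] ].

Definition tensor := quo (span tensor_rel).
HB.instance Definition _ := GRing.Lmodule.on tensor.

Definition tens (v : V) (w : W) : tensor := cls (span tensor_rel) (gen v w).

End Tensor.

Section TensorTop.
Variables (k : fieldType) (V W : linTopType k).

(** [U (x) U' `<=` Q] is tested on the pure tensors, which span [U (x) U']. *)
Definition star_open (Q : subspace (tensor V W)) : Prop :=
  [/\ exists (U : subspace V) (U' : subspace W),
        [/\ open U, open U' & forall u w, U u -> U' w -> Q (tens u w)],
      forall v : V, exists U' : subspace W, open U' /\ forall w, U' w -> Q (tens v w) &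
      forall w : W, exists U : subspace V, open U /\ forall v, U v -> Q (tens v w)].

Definition shriek_open (Q : subspace (tensor V W)) : Prop :=
  exists (U : subspace V) (U' : subspace W),
    [/\ open U, open U', forall u w, U u -> Q (tens u w) &
        forall v w, U' w -> Q (tens v w)].

Program Definition star_linbase : linbase (tensor V W) := @LinBase _ _ star_open _ _.
Next Obligation.
exists (subspaceT _); split.
- by exists (subspaceT V), (subspaceT W); split=> //; exact: openT.
- by move=> v; exists (subspaceT W); split=> //; exact: openT.
- by move=> v; exists (subspaceT V); split=> //; exact: openT.
Qed.
Next Obligation.
move=> Q Q' [[U [U' [oU oU' h]]] h1 h2] [[Z [Z' [oZ oZ' t]]] t1 t2].
exists (subspaceI Q Q'); split; [|by move=> x []|by move=> x []]; split.
- exists (subspaceI U Z), (subspaceI U' Z').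
  split; [exact: open_subspaceI|exact: open_subspaceI|].
  by move=> u w [Uu Zu] [Uw Zw]; split; [exact: h|exact: t].
- move=> v; have [X [oX hX]] := h1 v; have [Y [oY hY]] := t1 v.
  exists (subspaceI X Y); split; first exact: open_subspaceI.
  by move=> w [Xw Yw]; split; [exact: hX|exact: hY].
- move=> w; have [X [oX hX]] := h2 w; have [Y [oY hY]] := t2 w.
  exists (subspaceI X Y); split; first exact: open_subspaceI.
  by move=> v [Xw Yw]; split; [exact: hX|exact: hY].
Qed.

Program Definition shriek_linbase : linbase (tensor V W) := @LinBase _ _ shriek_open _ _.
Next Obligation.
exists (subspaceT _), (subspaceT V), (subspaceT W).
by split=> //; exact: openT.
Qed.
Next Obligation.
move=> Q Q' [U [U' [oU oU' h h']]] [Z [Z' [oZ oZ' t t']]].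
exists (subspaceI Q Q'); split; [|by move=> x []|by move=> x []].
exists (subspaceI U Z), (subspaceI U' Z').
split; [exact: open_subspaceI|exact: open_subspaceI| |].
- by move=> u w [Uu Zu]; split; [exact: h|exact: t].
- by move=> u w [Uu Zu]; split; [exact: h'|exact: t'].
Qed.

End TensorTop.

Variant tensor_kind := Star | Shriek.

Definition tensor_linbase (k : fieldType) (s : tensor_kind) (V W : linTopType k) :
    linbase (tensor V W) :=
  match s with Star => star_linbase V W | Shriek => shriek_linbase V W end.

Definition ctensor (k : fieldType) (s : tensor_kind) (V W : linTopType k) : linTopType k :=
  completion (tensor_linbase s V W).

Definition ctens (k : fieldType) (s : tensor_kind) (V W : linTopType k)
    (v : V) (w : W) : ctensor s V W := to_compl (tensor_linbase s V W) (tens v w).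

Section Graded.
Variable k : fieldType.

Definition gspace := int -> linTopType k.

Definition graded_tate (A : gspace) := forall i, tate (A i).

(** Homogeneous maps of degree [d].  Indexing the components by a target degree
    [j] with [i + d = j] avoids casts between propositionally equal degrees. *)
Definition ghom (d : int) (A B : gspace) := forall i j : int, i + d = j -> hom (A i) (B j).

(** Equality of homogeneous maps includes equality of their degrees. *)
Definition ghom_eq d e (A B : gspace) (f : ghom d A B) (g : ghom e A B) :=
  d = e /\ forall i j (p : i + d = j) (q : i + e = j) (x : A i), f i j p x = g i j q x.

Definition gid (A : gspace) : ghom 0 A A :=
  fun i j p => ecast j (hom (A i) (A j)) (etrans (esym (addr0 i)) p) (hom_id (A i)).

Fact gcomp_deg (i d e j : int) : i + (d + e) = j -> i + d + e = j.
Proof. by rewrite addrA. Qed.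

Definition gcomp d e (A B C : gspace) (g : ghom e B C) (f : ghom d A B) : ghom (d + e) A C :=
  fun i j p => hom_comp (g (i + d) j (gcomp_deg p)) (f i (i + d) erefl).

Definition gscale d (A B : gspace) (c : k) (f : ghom d A B) : ghom d A B :=
  fun i j p => c *: f i j p.

(** Only used for properties [P] that hold of exactly one map. *)
Definition the_ghom d (A B : gspace) (P : ghom d A B -> Prop) : ghom d A B :=
  if pselect (exists f, P f) is left h then sval (cid h) else fun i j p => 0.

Lemma the_ghomP d (A B : gspace) (P : ghom d A B -> Prop) :
  (exists f, P f) -> P (the_ghom P).
Proof. by move=> h; rewrite /the_ghom; case: pselect => // h'; exact: svalP. Qed.

Definition sgn (n : int) : k := (-1) ^ n.

(** The ground field, concentrated in degree [0]: row vectors of length [1] in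
    degree [0] and of length [0] otherwise. *)
Definition ground : gspace := fun n => discr 'rV[k]_(n == 0).
Definition scal (n : int) (c : k) : ground n := (const_mx c : 'rV[k]_(n == 0)).
Definition ground1 : ground 0 := scal 0 1.

Definition bideg (n : int) := {ij : int * int | ij.1 + ij.2 == n}.
Definition bidegP (i j : int) : bideg (i + j) := exist _ (i, j) (eqxx (i + j)).

(** No further completion is needed: direct sums and products of complete
    spaces are complete. *)
Definition gtensor (s : tensor_kind) (A B : gspace) : gspace := fun n =>
  match s with
  | Star => gsum (fun ij : bideg n => ctensor Star (A (sval ij).1) (B (sval ij).2))
  | Shriek => gprod (fun ij : bideg n => ctensor Shriek (A (sval ij).1) (B (sval ij).2))
  end.

Definition gtens (s : tensor_kind) (A B : gspace) (i j : int) (a : A i) (b : B j) :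
    gtensor s A B (i + j) :=
  match s return gtensor s A B (i + j) with
  | Star => @dsumv_inj k (bideg (i + j))
      (fun ij => ctensor Star (A (sval ij).1) (B (sval ij).2)) (bidegP i j) (ctens Star a b)
  | Shriek => @prodv_inj k (bideg (i + j))
      (fun ij => ctensor Shriek (A (sval ij).1) (B (sval ij).2)) (bidegP i j) (ctens Shriek a b)
  end.

(** The tensor products of maps, the symmetry, and the canonical maps between
    iterated tensor products are described by their values on tensors of
    homogeneous elements.  Sums of such tensors are dense in each component of a
    graded tensor product and all spaces are Hausdorff, so there is at most one
    such continuous map.  It exists when the spaces are complete; for the
    associativity of the * tensor product one also needs them to be Tate, which
    is the case wherever it is used. *)

Section Maps.
Variable s : tensor_kind.
Implicit Types A B C : gspace.

Definition gtmap d e A A' B B' (f : ghom d A A') (g : ghom e B B') :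
    ghom (d + e) (gtensor s A B) (gtensor s A' B') :=
  the_ghom (fun h => forall i j (a : A i) (b : B j)
      (p : i + j + (d + e) = (i + d) + (j + e)),
    h _ _ p (gtens s a b) = sgn (e * i) *: gtens s (f i _ erefl a) (g j _ erefl b)).

Definition gswap A B : ghom 0 (gtensor s A B) (gtensor s B A) :=
  the_ghom (fun h => forall i j (a : A i) (b : B j) (p : i + j + 0 = j + i),
    h _ _ p (gtens s a b) = sgn (i * j) *: gtens s b a).

Definition gassoc A B C :
    ghom 0 (gtensor s (gtensor s A B) C) (gtensor s A (gtensor s B C)) :=
  the_ghom (fun h => forall i j l (a : A i) (b : B j) (c : C l)
      (p : i + j + l + 0 = i + (j + l)),
    h _ _ p (gtens s (gtens s a b) c) = gtens s a (gtens s b c)).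

Definition unitl A : ghom 0 (gtensor s ground A) A :=
  the_ghom (fun h => forall i (a : A i) (p : 0 + i + 0 = i),
    h _ _ p (gtens s ground1 a) = a).

Definition unitr A : ghom 0 (gtensor s A ground) A :=
  the_ghom (fun h => forall i (a : A i) (p : i + 0 + 0 = i),
    h _ _ p (gtens s a ground1) = a).

Definition unitl_inv A : ghom 0 A (gtensor s ground A) :=
  the_ghom (fun h => forall i (a : A i) (p : i + 0 = 0 + i), h _ _ p a = gtens s ground1 a).

Definition unitr_inv A : ghom 0 A (gtensor s A ground) :=
  the_ghom (fun h => forall i (a : A i) (p : i + 0 = i + 0), h _ _ p a = gtens s a ground1).

End Maps.

(** [A (x)^* (B (x)^! C) -> (A (x)^* B) (x)^! C] and its mirror image
    [(A (x)^! B) (x)^* C -> A (x)^! (B (x)^* C)]. *)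

Definition mixl (A B C : gspace) :
    ghom 0 (gtensor Star A (gtensor Shriek B C)) (gtensor Shriek (gtensor Star A B) C) :=
  the_ghom (fun h => forall i j l (a : A i) (b : B j) (c : C l)
      (p : i + (j + l) + 0 = i + j + l),
    h _ _ p (gtens Star a (gtens Shriek b c)) = gtens Shriek (gtens Star a b) c).

Definition mixr (A B C : gspace) :
    ghom 0 (gtensor Star (gtensor Shriek A B) C) (gtensor Shriek A (gtensor Star B C)) :=
  the_ghom (fun h => forall i j l (a : A i) (b : B j) (c : C l)
      (p : i + j + l + 0 = i + (j + l)),
    h _ _ p (gtens Star (gtens Shriek a b) c) = gtens Shriek a (gtens Star b c)).

Definition gdual (A : gspace) : gspace := fun i => dual (A (- i)).

(** An element [f] of degree [n] of the graded dual, viewed as a map to the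
    ground field. *)
Definition dual_map n (A : gspace) (f : gdual A n) : ghom n A ground :=
  the_ghom (fun h => forall (a : A (- n)) (p : - n + n = 0),
    h _ _ p a = scal 0 (hom_fun f a)).

(** [<u^v, f> = (-1)^(|f||u|) f(u)] for an element [u : k -> A]. *)
Definition elt_dual d (A : gspace) (u : ghom d ground A) : ghom d (gdual A) ground :=
  the_ghom (fun h => forall n (f : gdual A n) (p : n + d = 0) (q : 0 + d = - n),
    h _ _ p f = scal 0 (sgn (n * d) * hom_fun f (u _ _ q ground1))).

(** A map [e : A -> k], viewed as an element [k -> A^v] of the graded dual. *)
Definition form_dual d (A : gspace) (e : ghom d A ground) : ghom d ground (gdual A) :=
  the_ghom (fun h => forall n (a : A (- n)) (p : 0 + d = n) (q : - n + d = 0),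
    scal 0 (hom_fun (h _ _ p ground1 : dual (A (- n))) a) = e _ _ q a).

Definition vec_p d (A : gspace) (p : ghom d (gtensor Star A A) ground) : ghom d A (gdual A) :=
  the_ghom (fun h => forall i n (a : A i) (b : A (- n)) (q : i + d = n) (r : i + - n + d = 0),
    scal 0 (hom_fun (h _ _ q a : dual (A (- n))) b) = p _ _ r (gtens Star a b)).

Definition vec_c d (A : gspace) (c : ghom d ground (gtensor Shriek A A)) : ghom d (gdual A) A :=
  the_ghom (fun h => forall n j (f : gdual A n) (q : n + d = j)
      (r : 0 + (d + (n + 0) + 0) = j),
    h _ _ q f = sgn (n * d) *:
      (gcomp (unitl Shriek A) (gcomp (gtmap Shriek (dual_map f) (gid A)) c)) _ _ r ground1).

Definition ginverse d (A B : gspace) (f : ghom d A B) (g : ghom (- d) B A) :=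
  ghom_eq (gcomp g f) (gid A) /\ ghom_eq (gcomp f g) (gid B).

Definition top_iso d (A B : gspace) (f : ghom d A B) := exists g, ginverse f g.

Definition ginv d (A B : gspace) (f : ghom d A B) : ghom (- d) B A :=
  the_ghom (ginverse f).

Section Bialgebra.

Local Notation "f ≡ g" := (ghom_eq f g) (at level 70).
Local Notation "c • f" := (gscale c f) (at level 40).
Local Notation "g ∘ f" := (gcomp g f) (at level 45, left associativity).
Local Notation "f ⊗* g" := (gtmap Star f g) (at level 40).
Local Notation "f ⊗! g" := (gtmap Shriek f g) (at level 40).

Variables (A : gspace) (dm dl du de : int).
Variables (mu : ghom dm (gtensor Star A A) A) (la : ghom dl A (gtensor Shriek A A)).
Variables (eta : ghom du ground A) (eps : ghom de A ground).

Local Notation id := (gid A).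

Definition associative_product : Prop :=
  mu ∘ (mu ⊗* id) ≡ sgn dm • (mu ∘ (id ⊗* mu) ∘ gassoc Star A A A).

Definition is_unit : Prop :=
  sgn dm • (mu ∘ (eta ⊗* id) ∘ unitl_inv Star A) ≡ id /\
  mu ∘ (id ⊗* eta) ∘ unitr_inv Star A ≡ id.

Definition coassociative_coproduct : Prop :=
  gassoc Shriek A A A ∘ (la ⊗! id) ∘ la ≡ sgn dl • ((id ⊗! la) ∘ la).

Definition is_counit : Prop :=
  unitl Shriek A ∘ (eps ⊗! id) ∘ la ≡ id /\
  sgn dl • (unitr Shriek A ∘ (id ⊗! eps) ∘ la) ≡ id.

(** The degree [dm] of the product is an explicit argument of [copairing], and
    the degree [dl] of the coproduct one of [pairing]. *)
Definition copairing : ghom (du + dl) ground (gtensor Shriek A A) :=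
  sgn (dl * dm + dm) • (la ∘ eta).

Definition pairing : ghom (dm + de) (gtensor Star A A) ground :=
  sgn dl • (eps ∘ mu).

Definition copairing_relations : Prop :=
  let c := copairing in
  [/\ la ≡ (id ⊗! mu) ∘ mixr A A A ∘ (c ⊗* id) ∘ unitl_inv Star A,
      la ≡ sgn dm • ((mu ⊗! id) ∘ mixl A A A ∘ (id ⊗* c) ∘ unitr_inv Star A) &
      gswap Shriek A A ∘ c ≡ sgn dl • c].

Definition pairing_relations : Prop :=
  let p := pairing in
  [/\ mu ≡ sgn (dm * dl + dl) •
        (unitl Shriek A ∘ (p ⊗! id) ∘ mixl A A A ∘ (id ⊗* la)),
      mu ≡ sgn (dm * dl) •
        (unitr Shriek A ∘ (id ⊗! p) ∘ mixr A A A ∘ (la ⊗* id)) &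
      p ∘ gswap Star A A ≡ sgn dm • p].

Record unital_coFrobenius : Prop := {
  uc_tate : graded_tate A;
  uc_assoc : associative_product;
  uc_unit : is_unit;
  uc_coassoc : coassociative_coproduct;
  uc_copairing : copairing_relations }.

Record counital_coFrobenius : Prop := {
  cc_tate : graded_tate A;
  cc_assoc : associative_product;
  cc_coassoc : coassociative_coproduct;
  cc_counit : is_counit;
  cc_pairing : pairing_relations }.

Record biunital_coFrobenius : Prop := {
  bc_tate : graded_tate A;
  bc_assoc : associative_product;
  bc_unit : is_unit;
  bc_coassoc : coassociative_coproduct;
  bc_counit : is_counit;
  bc_copairing : copairing_relations;
  bc_pairing : pairing_relations }.

End Bialgebra.
End Graded.

(* Main.v *)
From mathcomp Require Import all_boot all_order all_algebra.
From mathcomp Require Import finmap all_classical topology.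
From mathcomp Require Import zify.
Require Import Defs.

(** Write [L f t = (f (x) 1) t] and [R f t = (1 (x) f) t] for the slices of a
    tensor [t] of [A (x)^! A] by a functional [f] on [A]. Up to signs:

    From a unit to two. The two formulas for [la] in terms of the copairing [c] say
    [L f (la a) = mu (L f c, a)] and [R f (la a) = mu (a, R f c)], and the symmetry
    of [c] makes [L f c] and [R f c] agree with [vec_c f]. The definition of [eps]
    reads [eps (L f c) = f eta]; since [eps (L f c) = f (R eps c)] and functionals
    separate points, [R eps c = eta], and slicing [la] by [eps] gives the counit
    relations. Applying [eps] to the two formulas gives [p (vec_c f, a) = f a] and
    [p (a, vec_c f) = f a], which is the symmetry of [p]. Finally, pairing with
    [b = vec_c f] is slicing by [f], so [(p (x) 1) (b (x) la a) = L f (la a) =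
    mu (b, a)], and likewise on the other side: these are the pairing relations.

    From a counit to two. With [f_x = p (x, -)] the pairing relations say
    [mu (x, b) = L f_x (la b)] and [mu (b, x) = R f_x (la b)]. As [f_eta = eps], the
    unit relations are the counit relations. Slicing [c = la eta] by [f_x] on either
    side then gives [x]; hence the slices by [f_x] of the two sides of each
    copairing relation agree. Every functional is some [f_x], and slices by
    functionals separate the points of [A (x)^! A] ([slice_left_separates], resting
    on [tensor_sum_separated]), so the copairing relations hold.

    The structural maps are described by their values on pure tensors, so they
    have to be shown to exist. This is the universal property of the completed
    tensor products ([ctensor_lift]); the maps that compare the two tensor products
    need in addition that a completed tensor is algebraic up to a small one
    ([mixed_lift]).

    Every identity between maps out of a tensor product is checked on pure tensors,
    whose sums are dense ([app_ext]). Homogeneous elements of all degrees are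
    gathered in the type [elt A], on which homogeneous maps act without casts
    between degrees; what remains on pure tensors is an identity between signs,
    decided by the parities of the degrees ([sign_cases]). *)

Set Implicit Arguments.
Unset Strict Implicit.
Unset Printing Implicit Defensive.

Import GRing.Theory.
Local Open Scope classical_set_scope.
Local Open Scope ring_scope.

(** * Linear algebra *)

Section LinearAlgebra.
Variable k : fieldType.

Section LinearFacts.
Variables (V W : lmodType k) (f : V -> W).
Hypothesis fL : linear f.

Lemma linD x y : f (x + y) = f x + f y.
Proof. by have := fL 1 x y; rewrite !scale1r. Qed.

Lemma lin0 : f 0 = 0.
Proof. by apply: (addrI (f 0)); rewrite -linD !addr0. Qed.

Lemma linZ a x : f (a *: x) = a *: f x.
Proof. by have := fL a x 0; rewrite lin0 !addr0. Qed.

Lemma linB x y : f (x - y) = f x - f y.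
Proof. by rewrite linD -scaleN1r linZ scaleN1r. Qed.

Program Definition preim_sub (U : subspace W) : subspace V :=
  @Subspace _ _ [set x | U (f x)] _ _.
Next Obligation. by move=> U; rewrite /= lin0; exact: subspace0. Qed.
Next Obligation. by move=> U a x y Ux Uy; rewrite /= fL; exact: subspaceL. Qed.

End LinearFacts.

Lemma subspace_sum (V : lmodType k) (L : subspace V) (I : Type) (r : seq I)
    (F : I -> V) : (forall i, L (F i)) -> L (\sum_(i <- r) F i).
Proof.
move=> LF; elim/big_ind: _ => //; first exact: subspace0.
exact: subspaceD.
Qed.

Section DirectSum.
Variables (I : choiceType) (V : I -> lmodType k).

Let supp (x : dsumv V) : {fset I} := fset_set [set i | val x i != 0].

Let supp_sum (X : zmodType) (h : forall i, V i -> X) (x : dsumv V) (S : {fset I}) :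
  (forall i, h i 0 = 0) -> (supp x `<=` S)%fset ->
  \sum_(i <- supp x) h i (val x i) = \sum_(i <- S) h i (val x i).
Proof.
move=> h0 sS; apply/big_fset_incl => // i _; rewrite in_fset_set; last exact: sub_ofP x.
by rewrite notin_setE /= => /negP; rewrite negbK => /eqP ->.
Qed.

Lemma dsumv_valD (x y : dsumv V) i : val (x + y) i = val x i + val y i.
Proof. by []. Qed.

Lemma dsumv_valZ a (x : dsumv V) i : val (a *: x) i = a *: val x i.
Proof. by []. Qed.

Lemma dsumv_ind (L : subspace (dsumv V)) :
  (forall i (x : V i), L (dsumv_inj x)) -> forall x, L x.
Proof.
move=> Linj x.
have -> : x = \sum_(i <- supp x) dsumv_inj (val x i).
  apply: val_inj; apply: functional_extensionality_dep => j.
  rewrite (big_morph (fun y : dsumv V => val y j) (fun y z => erefl) erefl).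
  case: (boolP (j \in supp x)) => jS.
    rewrite (big_fsetD1 j) //= big_seq big1 ?addr0; last first.
      by move=> i; rewrite in_fsetD1 => /andP[ij _]; rewrite /prodv_inj dfwithout.
    by rewrite /prodv_inj dfwithin.
  move: (jS); rewrite in_fset_set; last exact: sub_ofP x.
  rewrite notin_setE /= => /negP; rewrite negbK => /eqP ->.
  rewrite big_seq big1 // => i iS; rewrite /prodv_inj dfwithout //.
  by apply: contraNneq jS => <-.
exact: subspace_sum.
Qed.

(** The last clause is what makes the universal map out of a topological direct
    sum continuous. *)
Lemma dsumv_lift (X : lmodType k) (h : forall i, V i -> X) :
  (forall i, linear (h i)) ->
  exists H : dsumv V -> X, [/\ linear H, forall i x, H (dsumv_inj x) = h i x &
    forall (L : subspace X) x, (forall i, L (h i (val x i))) -> L (H x)].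
Proof.
move=> hL; have h0 i := lin0 (hL i).
pose H (x : dsumv V) := \sum_(i <- supp x) h i (val x i).
exists H; split.
- move=> a x y; rewrite /H.
  pose z := a *: x + y; pose S := (supp z `|` (supp x `|` supp y))%fset.
  have s1 : (supp z `<=` S)%fset by rewrite fsubsetUl.
  have s2 : (supp x `<=` S)%fset.
    by rewrite /S fsetUCA fsubsetUl.
  have s3 : (supp y `<=` S)%fset.
    by rewrite /S fsetUA fsubsetUr.
  rewrite -/z (supp_sum h0 s1) (supp_sum h0 s2) (supp_sum h0 s3) /z scaler_sumr -big_split.
  by apply: eq_bigr => i _; rewrite dsumv_valD dsumv_valZ hL.
- move=> i x; rewrite /H.
  have s : (supp (dsumv_inj x) `<=` [fset i])%fset.
    apply/fsubsetP => j; rewrite in_fset_set; last exact: sub_ofP (dsumv_inj x).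
    rewrite inE /= in_fset1 => nz; rewrite eq_sym; apply: contraNT nz => ij.
    by rewrite /prodv_inj dfwithout.
  by rewrite (supp_sum h0 s) big_seq_fset1 /= /prodv_inj dfwithin.
- by move=> L x Lx; exact: subspace_sum.
Qed.

End DirectSum.

Section TensorProduct.
Variables V W : lmodType k.

Definition bilin (X : lmodType k) (b : V -> W -> X) :=
  (forall w, linear (b^~ w)) /\ (forall v, linear (b v)).

Lemma tens_bilin : bilin (@tens k V W).
Proof.
split=> [w a v v'|v a w w']; rewrite /tens -clsZ -clsD; apply/eq_clsP => L sL;
  rewrite opprD addrA; apply: sL.
- by left; exists ((a, v), (v', w)).
- by right; exists ((a, w), (w', v)).
Qed.

Let dsumv_inj_gen v w (c : k) :
  @dsumv_inj k _ (fun _ : V * W => k^o) (v, w) c =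
  c *: (gen v w : dsumv (fun _ : V * W => k^o)).
Proof.
apply: val_inj; apply: functional_extensionality_dep => j /=.
rewrite /GRing.scale /= /prodv_scale /prodv_inj.
have [<-|ij] := eqVneq (v, w) j; first by rewrite !dfwithin; apply/esym/mulr1.
by rewrite !dfwithout // scaler0.
Qed.

Lemma tens_ind (L : subspace (tensor V W)) :
  (forall v w, L (tens v w)) -> forall t, L t.
Proof.
move=> Lt; elim/clsW => x.
have cL : linear (cls (span (@tensor_rel k V W))) by exact: cls_linear.
apply: (dsumv_ind (L := preim_sub cL L)) => -[v w] c /=.
by rewrite dsumv_inj_gen clsZ; apply: subspaceZ; exact: Lt.
Qed.

Lemma tensor_sum (t : tensor V W) :
  exists s : seq (V * W), t = \sum_(p <- s) tens p.1 p.2.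
Proof.
have L0 : exists s : seq (V * W), 0 = \sum_(p <- s) tens p.1 p.2.
  by exists [::]; rewrite big_nil.
have LL a x y : (exists s : seq (V * W), x = \sum_(p <- s) tens p.1 p.2) ->
    (exists s : seq (V * W), y = \sum_(p <- s) tens p.1 p.2) ->
    exists s : seq (V * W), a *: x + y = \sum_(p <- s) tens p.1 p.2.
  move=> [s ->] [s' ->]; exists ([seq (a *: p.1, p.2) | p <- s] ++ s').
  rewrite big_cat big_map scaler_sumr; congr (_ + _); apply: eq_bigr => p _.
  by rewrite (linZ (tens_bilin.1 _)).
apply: (tens_ind (L := Subspace L0 LL)) => v w.
by exists [:: (v, w)]; rewrite big_seq1.
Qed.

Lemma tens_lift (X : lmodType k) (b : V -> W -> X) : bilin b ->
  exists B : tensor V W -> X, linear B /\ forall v w, B (tens v w) = b v w.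
Proof.
move=> [bl br].
pose h (p : V * W) (c : k^o) : X := c *: b p.1 p.2.
have hL p : linear (h p).
  by move=> a x y; rewrite /h scalerDl scalerA.
have [H [HL Hinj _]] := dsumv_lift hL.
have Hgen v w : H (gen v w) = b v w by rewrite Hinj /h scale1r.
have Hrel x : span (@tensor_rel k V W) x -> H x = 0.
  move=> sx; apply: (sx (preim_sub HL (subspace00 X))) => _ [[p _ <-]|[p _ <-]] /=.
  - by rewrite !(linB HL) (linZ HL) !Hgen bl -addrA -opprD subrr.
  - by rewrite !(linB HL) (linZ HL) !Hgen br -addrA -opprD subrr.
have Hcls x : H (repr (cls (span (@tensor_rel k V W)) x)) = H x.
  by apply/eqP; rewrite -subr_eq0 -(linB HL); apply/eqP/Hrel; exact: reprB.
exists (fun t => H (repr t)); split; last by move=> v w; rewrite Hcls Hgen.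
move=> a; elim/clsW => x; elim/clsW => y.
by rewrite -cls_linear !Hcls HL.
Qed.

End TensorProduct.

End LinearAlgebra.

Section Functionals.
Variables (k : fieldType) (V : lmodType k).

Program Definition add_line (M : subspace V) (y : V) : subspace V :=
  @Subspace _ _ [set z | exists c, M (z - c *: y)] _ _.
Next Obligation. by move=> M y; exists 0; rewrite scale0r subr0; exact: subspace0. Qed.
Next Obligation.
move=> M y a z z' [c Mc] [c' Mc']; exists (a * c + c').
by rewrite scalerDl -scalerA opprD addrACA -scalerBr; exact: subspaceL.
Qed.

(** Zorn's lemma, on the subspaces seen as sets. *)
Lemma maximal_avoiding (L : subspace V) (x : V) : ~ L x ->
  exists M : subspace V, [/\ L `<=` M, ~ M x &
    forall N : subspace V, M `<=` N -> ~ N x -> N `<=` M].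
Proof.
move=> Lx.
pose good (M : subspace V) := L `<=` M /\ ~ M x.
(* The empty set is admitted as well, being the union of the empty chain. *)
pose P (A : set V) := A = set0 \/ exists2 M : subspace V, A = M & good M.
have chainP (F : set (set V)) : F `<=` P -> total_on F subset -> P (\bigcup_(X in F) X).
  move=> FP Ftot.
  have [[A0 FA0 [M0 A0M [LM0 M0x]]]|noM] :=
    pselect (exists2 A, F A & exists2 M : subspace V, A = M & good M); last first.
    left; rewrite -subset0 => y [A FA Ay]; have [A0|AM] := FP _ FA; last first.
      by apply: noM; exists A.
    by rewrite A0 in Ay.
  right; have u0 : (\bigcup_(X in F) X) 0.
    by exists A0 => //; rewrite A0M; exact: subspace0.
  have uL a y z : (\bigcup_(X in F) X) y -> (\bigcup_(X in F) X) z ->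
      (\bigcup_(X in F) X) (a *: y + z).
    have step A B : F A -> F B -> A `<=` B -> A y -> B z ->
        (\bigcup_(X in F) X) (a *: y + z).
      move=> FA FB AB Ay Bz; exists B => //.
      have [B0|[M BM _]] := FP _ FB; first by rewrite B0 in Bz.
      by move/AB: Ay Bz; rewrite BM; exact: subspaceL.
    move=> [A FA Ay] [B FB Bz]; have [AB|BA] := Ftot _ _ FA FB; first exact: step FA FB AB Ay Bz.
    exists A => //; have [A0'|[M AM _]] := FP _ FA; first by rewrite A0' in Ay.
    by move/BA: Bz Ay; rewrite AM => *; exact: subspaceL.
  exists (Subspace u0 uL) => //; split=> [y Ly|/= [A FA Ax]].
    by exists A0 => //; rewrite A0M; exact: LM0.
  have [A0'|[M AM [_ Mx]]] := FP _ FA; first by rewrite A0' in Ax.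
  by apply: Mx; rewrite -AM.
have [A [PA maxA]] := Zorn_bigcup chainP.
case: PA => [A0|[M AM [LM Mx]]].
  case: (maxA L); last by right; exists L => //; split.
  by rewrite A0; split=> [y []|/(_ 0 (subspace0 L))].
exists M; split=> // N MN Nx; apply: contrapT => nNM.
by apply: (maxA N); [rewrite AM; split|right; exists N => //; split=> // y /LM/MN].
Qed.

(** A maximal subspace containing [L] but not [x] is a hyperplane complementary
    to the line through [x]; the functional is the coordinate along that line. *)
Lemma separating_functional (L : subspace V) (x : V) : ~ L x ->
  exists phi : V -> k, [/\ linear (phi : V -> k^o), forall y, L y -> phi y = 0 & phi x = 1].
Proof.
move=> /maximal_avoiding[M [LM Mx maxM]].
have coord y : exists a, M (y - a *: x).
  have [My|nMy] := pselect (M y); first by exists 0; rewrite scale0r subr0.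
  have [c Mc] : add_line M y x.
    apply: contrapT => nx; apply: nMy.
    apply: (maxM (add_line M y)) => [z Mz||] //; last first.
      by exists 1; rewrite scale1r subrr; exact: subspace0.
    by exists 0; rewrite scale0r subr0.
  have c0 : c != 0.
    by apply/eqP => c0; apply: Mx; move: Mc; rewrite c0 scale0r subr0.
  exists c^-1; have -> : y - c^-1 *: x = - (c^-1 *: (x - c *: y)).
    by rewrite scalerBr scalerA mulVf // scale1r opprB.
  by apply/subspaceN/subspaceZ.
have uniq_coord y a b : M (y - a *: x) -> M (y - b *: x) -> a = b.
  move=> Ma Mb; apply/eqP; rewrite -subr_eq0; apply/eqP.
  have := subspaceB Mb Ma; rewrite opprB addrC addrA subrK -scalerBl => Mab.
  have [//|/eqP nz] := pselect (a - b = 0); case: Mx.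
  by have := subspaceZ (a - b)^-1 Mab; rewrite scalerA mulVf // scale1r.
pose phi y := sval (cid (coord y)).
have phiP y : M (y - phi y *: x) by rewrite /phi; case: cid.
exists phi; split=> [a y z|y Ly|].
- apply: (uniq_coord (a *: y + z)) => //.
  by rewrite scalerDl -scalerA opprD addrACA -scalerBr; exact: subspaceL.
- by apply: (uniq_coord y) => //; rewrite scale0r subr0; exact: LM.
- by apply: (uniq_coord x) => //; rewrite scale1r subrr; exact: subspace0.
Qed.

(** A shortest expression of the tensor modulo the subspace of tensors that vanish
    modulo [U] and [U'] has first factors independent modulo [U], so functionals
    that kill [U] read off its second factors. *)
Lemma tensor_sum_separated (W : lmodType k) (U : subspace V) (U' : subspace W)
    (Q : subspace (tensor V W)) :
  (forall u w, U u -> Q (tens u w)) -> (forall v w, U' w -> Q (tens v w)) ->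
  forall s : seq (V * W),
    (forall phi : V -> k, linear (phi : V -> k^o) -> (forall u, U u -> phi u = 0) ->
       U' (\sum_(p <- s) phi p.1 *: p.2)) ->
    Q (\sum_(p <- s) tens p.1 p.2).
Proof.
move=> QU QU' s; have [n] := ubnP (size s); elim: n s => // n IHn [|[v w] s] /=.
  by move=> _ _; rewrite big_nil; exact: subspace0.
rewrite ltnS => sn hs.
have [tl tr] := @tens_bilin k V W.
have [[u [c [Uu vE]]]|nv] := pselect (exists u (c : nat -> k), U u /\
    v = u + \sum_(i < size s) c i *: (nth (0, 0) s i).1).
- (* [v] is redundant: distribute [w] over the other terms. *)
  pose s' := [seq ((nth (0, 0) s i).1, (nth (0, 0) s i).2 + c i *: w) | i <- iota 0 (size s)].
  have sumE (X : zmodType) (F : V * W -> X) :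
      \sum_(p <- s) F p = \sum_(i < size s) F (nth (0, 0) s i).
    by rewrite (big_nth (0, 0)) big_mkord.
  have sumE' (X : zmodType) (F : V * W -> X) : \sum_(p <- s') F p =
      \sum_(i < size s) F ((nth (0, 0) s i).1, (nth (0, 0) s i).2 + c i *: w).
    by rewrite big_map -{1}[size s]subn0 big_mkord.
  have -> : \sum_(p <- (v, w) :: s) tens p.1 p.2 =
      tens u w + \sum_(p <- s') tens p.1 p.2.
    rewrite big_cons /= vE (linD (tl w)) -addrA; congr (_ + _).
    rewrite sumE sumE' /=.
    have -> : tens (\sum_(i < size s) c i *: (nth (0, 0) s i).1) w =
        \sum_(i < size s) tens (nth (0, 0) s i).1 (c i *: w).
      rewrite (big_morph (fun x => tens x w) (linD (tl w)) (lin0 (tl w))).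
      by apply: eq_bigr => i _; rewrite (linZ (tl w)) (linZ (tr _)).
    by rewrite -big_split; apply: eq_bigr => i _; rewrite addrC (linD (tr _)).
  apply: subspaceD; first exact: QU.
  apply: IHn => [|phi phiL phiU]; first by rewrite size_map size_iota.
  suff <- : \sum_(p <- (v, w) :: s) phi p.1 *: p.2 = \sum_(p <- s') phi p.1 *: p.2 by exact: hs.
  rewrite big_cons sumE sumE' /= vE (linD phiL) phiU // add0r.
  rewrite (big_morph (phi : V -> k^o) (linD phiL) (lin0 phiL)) scaler_suml -big_split.
  apply: eq_bigr => i _; rewrite (linZ phiL) /= scalerDr scalerA addrC; congr (_ + _ *: _).
  exact: mulrC.
- (* Otherwise some functional equal to 1 at [v] kills the other terms. *)
  have sp0 : exists u (c : nat -> k), U u /\ 0 = u + \sum_(i < size s) c i *: (nth (0, 0) s i).1.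
    exists 0, (fun=> 0); split; first exact: subspace0.
    by rewrite add0r big1 // => i _; rewrite scale0r.
  have spL a x y :
      (exists u (c : nat -> k), U u /\ x = u + \sum_(i < size s) c i *: (nth (0, 0) s i).1) ->
      (exists u (c : nat -> k), U u /\ y = u + \sum_(i < size s) c i *: (nth (0, 0) s i).1) ->
      exists u (c : nat -> k), U u /\ a *: x + y = u + \sum_(i < size s) c i *: (nth (0, 0) s i).1.
    move=> [u [c [Uu ->]]] [u' [c' [Uu' ->]]]; exists (a *: u + u'), (fun i => a * c i + c' i).
    split; first exact: subspaceL.
    rewrite scalerDr addrACA scaler_sumr -big_split; congr (_ + _).
    by apply: eq_bigr => i _; rewrite scalerDl scalerA.
  have [phi [phiL phi0 phi1]] := separating_functional (L := Subspace sp0 spL) nv.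
  have phiU u : U u -> phi u = 0.
    move=> Uu; apply: phi0; exists u, (fun=> 0); split=> //.
    by rewrite big1 ?addr0 // => i _; rewrite scale0r.
  have phis p : p \in s -> phi p.1 = 0.
    move=> ps; apply: phi0; exists 0, (fun i => (i == index p s :> nat)%:R).
    split; first exact: subspace0.
    have is_ : (index p s < size s)%N by rewrite index_mem.
    rewrite add0r (bigD1 (Ordinal is_)) //= eqxx scale1r nth_index // big1 ?addr0 // => i.
    by rewrite -val_eqE /= => /negPf ->; rewrite scale0r.
  have U'w : U' w.
    have := hs _ phiL phiU; rewrite big_cons /= phi1 scale1r big_seq big1 ?addr0 //.
    by move=> p /phis ->; rewrite scale0r.
  rewrite big_cons /=; apply: subspaceD; first exact: QU'.
  apply: IHn => // psi psiL psiU; have := hs _ psiL psiU; rewrite big_cons /= => h.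
  rewrite -[X in U' X](addKr (psi v *: w)) addrC.
  by apply: subspaceB => //; exact: subspaceZ.
Qed.

End Functionals.

(** * Complete spaces and completed tensor products *)

Section LinearTopology.
Variable k : fieldType.
Implicit Types V W X : linTopType k.

Definition mk_hom V W (f : V -> W) (fL : linear f)
    (fc : forall U : subspace W, open U ->
       exists U' : subspace V, open U' /\ forall x, U' x -> U (f x)) : hom V W :=
  mkhom fL ((linear_continuousP fL).2 fc).

Lemma hom_open V W (f : hom V W) (U : subspace W) : open U ->
  exists U' : subspace V, open U' /\ forall x, U' x -> U (f x).
Proof. exact: (linear_continuousP (hom_linear f)).1 (@hom_continuous _ _ _ f) U. Qed.

Lemma hom_eq_dense V X (h h' : hom V X) (x : V) :
  (forall U : subspace V, open U -> exists2 y, U (x - y) & h y = h' y) -> h x = h' x.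
Proof.
move=> dense; apply/eqP; rewrite -subr_eq0; apply/eqP/open_separated => U oU.
have [U1 [oU1 hU]] := hom_open h oU; have [U2 [oU2 hU']] := hom_open h' oU.
have [y [y1 y2] e] := dense _ (open_subspaceI oU1 oU2).
have -> : h x - h' x = h (x - y) - h' (x - y).
  by rewrite !(linB (hom_linear _)) e opprB addrA subrK.
by apply: subspaceB; [exact: hU|exact: hU'].
Qed.

Section Completion.
Variables (V : lmodType k) (B : linbase V).

Lemma to_compl_linear : linear (to_compl B).
Proof.
move=> a x y; apply: val_inj; apply: functional_extensionality_dep => U.
exact: cls_linear.
Qed.

Lemma compl_kerE (Q : linbase_ix B) v :
  compl_ker Q (to_compl B v) <-> ix_sub Q v.
Proof. by rewrite -[X in ix_sub Q X]subr0; exact: (eq_clsP (ix_sub Q) v 0). Qed.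

Lemma compl_kerP (Q : linbase_ix B) x v :
  compl_pr Q x = cls _ v <-> compl_ker Q (x - to_compl B v).
Proof.
change (compl_pr Q x = cls _ v <-> compl_pr Q x - cls _ v = 0).
by split=> [->|/eqP]; [exact: subrr|rewrite subr_eq0 => /eqP].
Qed.

Lemma open_compl_ker (Q : linbase_ix B) : open (compl_ker Q : set (completion B)).
Proof.
rewrite openE => x Kx; exists (compl_ker Q); split; first by exists Q.
by move=> u; exact: subspaceD.
Qed.

Lemma open_complP (U : subspace (completion B)) : open U ->
  exists Q : linbase_ix B, compl_ker Q `<=` U.
Proof.
move=> oU; have : nbhs (0 : completion B) U.
  by apply: open_nbhs_nbhs; split=> //; exact: subspace0.
by move=> [_ [[Q ->] h]]; exists Q => x /h; rewrite add0r.
Qed.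

(** A completed vector is a vector of the original space up to any given
    neighbourhood of [0]; most arguments on completions go through this. *)
Lemma compl_approx (Q : linbase_ix B) x : exists v, compl_ker Q (x - to_compl B v).
Proof. by exists (repr (compl_pr Q x)); apply: (compl_kerP Q x _).1; rewrite clsK. Qed.

Lemma compl_ker_sub (Q Q' : linbase_ix B) :
  ix_sub Q `<=` ix_sub Q' -> compl_ker Q `<=` compl_ker Q'.
Proof. by move=> s x; exact: (sub_ofP x) Q Q' s 0. Qed.

Lemma compl_ext X (h h' : hom (completion B) X) :
  (forall v, h (to_compl B v) = h' (to_compl B v)) -> h =1 h'.
Proof.
move=> e x; apply: hom_eq_dense => U /open_complP[Q QU].
by have [v xv] := compl_approx Q x; exists (to_compl B v) => //; exact: QU.
Qed.

End Completion.

Arguments to_compl_linear {V B}.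

(** The half of completeness that extension of maps uses; separation is built
    into the spaces. *)
Definition converging V := forall z : completion (open_linbase V),
  exists y, to_compl (open_linbase V) y = z.

Lemma complete_converging V : complete V -> converging V.
Proof. by move=> [g [_ Kg _ _]] z; exists (g z). Qed.

(** The limit takes as its class modulo [Q] the class of an approximation up to the
    kernel of the projection to the quotient by [Q]. *)
Lemma completion_converging (V : lmodType k) (B : linbase V) :
  converging (completion B).
Proof.
move=> z; pose K (Q : linbase_ix B) : linbase_ix (open_linbase (completion B)) :=
  exist _ (compl_ker Q) (open_compl_ker (Q := Q)).
pose x Q := repr (compl_pr (K Q) z).
have zE Q (U : linbase_ix (open_linbase (completion B))) :
    compl_ker Q `<=` ix_sub U -> compl_pr U z = cls _ (x Q).
  by move=> QU; apply: (sub_ofP z (K Q) U QU); exact: esym (clsK _).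
have yP : compatible B (fun Q => compl_pr Q (x Q)).
  move=> Q Q' QQ' v yv; have KK := compl_ker_sub QQ'.
  have xv := sub_ofP (x Q) _ _ QQ' _ yv.
  rewrite -xv; apply/eqP; rewrite -subr_eq0; apply/eqP.
  by have /eq_clsP := etrans (esym (zE Q' (K Q') (fun=> id))) (zE Q (K Q') KK).
exists (mksub yP); apply: val_inj; apply: functional_extensionality_dep => U.
have [Q QU] := open_complP (svalP U).
rewrite [RHS](zE Q U QU); apply/eq_clsP/QU.
exact: subrr.
Qed.

Section Extension.
Variables (V : lmodType k) (B : linbase V) (X : linTopType k) (f : V -> X).
Hypotheses (Xc : converging X) (fL : linear f).
Hypothesis fc : forall U : subspace X, open U ->
  exists2 Q : linbase_ix B, True & forall v, ix_sub Q v -> U (f v).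

(** The value of the extension at [x] is the limit of [f v] for [v] close to [x]. *)
Let is_limit (x : completion B) (y : X) :=
  forall (U : subspace X) (Q : linbase_ix B) v, open U ->
    (forall v, ix_sub Q v -> U (f v)) -> compl_ker Q (x - to_compl B v) -> U (y - f v).

Let limit_uniq x y y' : is_limit x y -> is_limit x y' -> y = y'.
Proof.
move=> l l'; apply/eqP; rewrite -subr_eq0; apply/eqP/open_separated => U oU.
have [Q _ QU] := fc oU; have [v xv] := compl_approx Q x.
have -> : y - y' = (y - f v) - (y' - f v) by rewrite opprB addrA subrK.
by apply: subspaceB; [exact: l QU xv|exact: l' QU xv].
Qed.

Let limit_same (U : subspace X) (Q Q' : linbase_ix B) (x : completion B) v v' :
  (forall v, ix_sub Q v -> U (f v)) -> (forall v, ix_sub Q' v -> U (f v)) ->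
  compl_ker Q (x - to_compl B v) -> compl_ker Q' (x - to_compl B v') -> U (f v - f v').
Proof.
move=> QU Q'U xv xv'; have [Q0 [bQ0 s s']] := linbase_dir (svalP Q) (svalP Q').
have [w xw] := compl_approx (exist _ Q0 bQ0) x.
have -> : f v - f v' = f (w - v') - f (w - v).
  by rewrite !(linB fL) opprB [RHS]addrC addrA subrK.
have close (Q1 : linbase_ix B) u : Q0 `<=` ix_sub Q1 ->
    compl_ker Q1 (x - to_compl B u) -> ix_sub Q1 (w - u).
  move=> s1 xu; apply/compl_kerE; rewrite (linB to_compl_linear).
  have -> : to_compl B w - to_compl B u = (x - to_compl B u) - (x - to_compl B w).
    by rewrite opprB [RHS]addrC addrA subrK.
  by apply: subspaceB => //; exact: (compl_ker_sub (Q := exist _ Q0 bQ0)) xw.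
by apply: subspaceB; [apply: Q'U; exact: close|apply: QU; exact: close].
Qed.

Let limit_exists x : exists y, is_limit x y.
Proof.
have r0 (U : linbase_ix (open_linbase X)) : exists p : linbase_ix B * V,
    (forall v, ix_sub p.1 v -> ix_sub U (f v)) /\ compl_ker p.1 (x - to_compl B p.2).
  have [Q _ QU] := fc (svalP U); have [v xv] := compl_approx Q x.
  by exists (Q, v).
pose r U := sval (cid (r0 U)).
have rP U : (forall v, ix_sub (r U).1 v -> ix_sub U (f v)) /\
    compl_ker (r U).1 (x - to_compl B (r U).2) by rewrite /r; case: cid.
have zP : compatible (open_linbase X) (fun U => cls _ (f (r U).2)).
  move=> U U' UU' v /eq_clsP Uv; apply/eq_clsP.
  rewrite -[f _](subrK (f (r U).2)) -addrA; apply: subspaceD; last exact: UU'.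
  apply: limit_same (rP U').1 _ (rP U').2 (rP U).2 => u ru.
  by apply: UU'; exact: (rP U).1.
have [y yz] := Xc (mksub zP); exists y => U Q v oU QU xv.
pose U0 : linbase_ix (open_linbase X) := exist _ U oU.
rewrite -[y](subrK (f (r U0).2)) -addrA; apply: subspaceD.
  by apply/eq_clsP; have := congr1 (fun z => sval z U0) yz.
exact: limit_same (rP U0).1 QU (rP U0).2 xv.
Qed.

Lemma compl_lift : exists h : hom (completion B) X,
  forall v, h (to_compl B v) = f v.
Proof.
pose h x := sval (cid (limit_exists x)).
have hP x : is_limit x (h x) by rewrite /h; case: cid.
have hL : linear h.
  move=> a x x'; apply: limit_uniq (hP _) _ => U Q v oU QU xv.
  have [w xw] := compl_approx Q x; have [w' xw'] := compl_approx Q x'.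
  have -> : a *: h x + h x' - f v =
      (a *: (h x - f w) + (h x' - f w')) + f (a *: w + w' - v).
    by rewrite (linB fL) fL [in RHS]scalerBr [X in _ = X + _]addrACA -opprD addrA subrK.
  apply: subspaceD; first by apply: subspaceL; exact: hP QU _.
  apply: QU; apply/compl_kerE; rewrite (linB to_compl_linear) to_compl_linear.
  have -> : a *: to_compl B w + to_compl B w' - to_compl B v =
      (a *: x + x' - to_compl B v) - (a *: (x - to_compl B w) + (x' - to_compl B w')).
    by rewrite scalerBr [X in _ = _ - X]addrACA -opprD opprB [RHS]addrC addrA subrK.
  by apply: subspaceB => //; exact: subspaceL.
have hc (U : subspace X) : open U ->
    exists U' : subspace (completion B), open U' /\ forall x, U' x -> U (h x).
  move=> oU; have [Q _ QU] := fc oU; exists (compl_ker Q); split; first exact: open_compl_ker.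
  move=> x Kx; rewrite -[h x]subr0 -(lin0 fL); apply: hP QU _ => //.
  by rewrite (lin0 to_compl_linear) subr0.
exists (mk_hom hL hc) => v; apply: limit_uniq (hP _) _ => U Q w oU QU.
by rewrite -(linB to_compl_linear) => /compl_kerE/QU; rewrite (linB fL).
Qed.

End Extension.

(** For [b] bilinear with values in [X], openness of the preimages under the map that
    [b] induces on the algebraic tensor product. *)
Definition bicont s V W X (b : V -> W -> X) : Prop :=
  forall U : subspace X, open U ->
  match s with
  | Star =>
    [/\ exists (U1 : subspace V) (U2 : subspace W),
          [/\ open U1, open U2 & forall u w, U1 u -> U2 w -> U (b u w)],
        forall v, exists U2 : subspace W, open U2 /\ forall w, U2 w -> U (b v w) &
        forall w, exists U1 : subspace V, open U1 /\ forall v, U1 v -> U (b v w)]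
  | Shriek =>
    exists (U1 : subspace V) (U2 : subspace W),
    [/\ open U1, open U2, forall u w, U1 u -> U (b u w) & forall v w, U2 w -> U (b v w)]
  end.

Lemma bicontr s V W X (b : V -> W -> X) (v : V) (U : subspace X) :
  bicont s b -> open U -> exists U2 : subspace W, open U2 /\ forall w, U2 w -> U (b v w).
Proof.
move=> bc oU; case: s bc => /(_ U oU); first by move=> [_ h _]; exact: h.
by move=> [U1 [U2 [_ o2 _ h]]]; exists U2; split=> // w; exact: h.
Qed.

Lemma bicontl s V W X (b : V -> W -> X) (w : W) (U : subspace X) :
  bicont s b -> open U -> exists U1 : subspace V, open U1 /\ forall v, U1 v -> U (b v w).
Proof.
move=> bc oU; case: s bc => /(_ U oU); first by move=> [_ _ h]; exact: h.
by move=> [U1 [U2 [o1 _ h _]]]; exists U1; split=> // v; exact: h.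
Qed.

Lemma bicont_comp s V V' W W' X X' (b : V' -> W' -> X) (f : hom V V') (g : hom W W')
    (h : hom X X') : bicont s b -> bicont s (fun v w => h (b (f v) (g w))).
Proof.
move=> bc U oU; have [U0 [oU0 hU]] := hom_open h oU.
case: s bc => /(_ U0 oU0).
- move=> [[U1 [U2 [o1 o2 b12]]] br bl]; split.
  + have [V1 [oV1 fV]] := hom_open f o1; have [V2 [oV2 gV]] := hom_open g o2.
    by exists V1, V2; split=> // u w /fV fu /gV gw; apply: hU; exact: b12.
  + move=> v; have [Z [oZ bZ]] := br (f v); have [Z' [oZ' gZ]] := hom_open g oZ.
    by exists Z'; split=> // w /gZ/bZ/hU.
  + move=> w; have [Z [oZ bZ]] := bl (g w); have [Z' [oZ' fZ]] := hom_open f oZ.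
    by exists Z'; split=> // v /fZ/bZ/hU.
- move=> [U1 [U2 [o1 o2 b1 b2]]].
  have [V1 [oV1 fV]] := hom_open f o1; have [V2 [oV2 gV]] := hom_open g o2.
  exists V1, V2; split=> // [u w /fV fu|v w /gV gw]; apply: hU; [exact: b1|exact: b2].
Qed.

Section CompletedTensor.
Variables (s : tensor_kind) (V W : linTopType k).

Lemma ctens_bilin : bilin (@ctens k s V W).
Proof.
have [tl tr] := @tens_bilin k V W.
by split=> [w|v] a x y; rewrite /ctens -to_compl_linear ?tl ?tr.
Qed.

Lemma ctens_bicont : bicont s (@ctens k s V W).
Proof.
rewrite /ctens => U /open_complP[[Q bQ] QU].
have h v w : Q (tens v w) -> U (to_compl (tensor_linbase s V W) (tens v w)).
  by move=> Qt; apply/QU/(compl_kerE (exist _ Q bQ)).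
clear QU; case: s U h bQ => /= U h.
- move=> [[U1 [U2 [o1 o2 b12]]] br bl]; split.
  + by exists U1, U2; split=> // u w Uu Uw; apply/h/b12.
  + by move=> v; have [Z [oZ bZ]] := br v; exists Z; split=> // w /bZ/h.
  + by move=> w; have [Z [oZ bZ]] := bl w; exists Z; split=> // v /bZ/h.
- move=> [U1 [U2 [o1 o2 b1 b2]]].
  by exists U1, U2; split=> // [u w Uu|v w Uw]; apply: h; [exact: b1|exact: b2].
Qed.

Lemma ctensor_ext X (h h' : hom (ctensor s V W) X) :
  (forall v w, h (ctens s v w) = h' (ctens s v w)) -> h =1 h'.
Proof.
move=> e; apply: compl_ext => t; apply/eqP; rewrite -subr_eq0; apply/eqP.
pose d v := h (to_compl (tensor_linbase s V W) v) - h' (to_compl (tensor_linbase s V W) v).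
have dL : linear d.
  move=> a x y; rewrite /d !to_compl_linear !hom_linear scalerBr opprD.
  by rewrite -!addrA; congr (_ + _); rewrite addrCA.
apply: (tens_ind (L := preim_sub dL (subspace00 X))) => v w /=.
by rewrite /d; apply/eqP; rewrite subr_eq0; apply/eqP/e.
Qed.

(** The universal property behind the maps out of tensor products; it extends to the
    completion because the target has limits. *)
Lemma ctensor_lift X (b : V -> W -> X) : converging X -> bilin b -> bicont s b ->
  exists h : hom (ctensor s V W) X, forall v w, h (ctens s v w) = b v w.
Proof.
move=> Xc bb bc; have [B [BL BE]] := tens_lift bb.
have Bc (U : subspace X) : open U -> exists2 Q : linbase_ix (tensor_linbase s V W), True &
    forall v, ix_sub Q v -> U (B v).
  move=> oU; have Q : tensor_linbase s V W (preim_sub BL U).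
    have := bc U oU; clear -BE; case: s => /=.
    - move=> [[U1 [U2 [o1 o2 b12]]] br bl]; split.
      + by exists U1, U2; split=> // u w Uu Uw; rewrite /= BE; exact: b12.
      + by move=> v; have [Z [oZ bZ]] := br v; exists Z; split=> // w /bZ; rewrite /= BE.
      + by move=> w; have [Z [oZ bZ]] := bl w; exists Z; split=> // v /bZ; rewrite /= BE.
    - move=> [U1 [U2 [o1 o2 b1 b2]]].
      by exists U1, U2; split=> // [u w Uu|v w Uw]; rewrite /= BE; [exact: b1|exact: b2].
  by exists (exist _ _ Q).
have [h hE] := compl_lift Xc BL Bc.
by exists h => v w; rewrite hE BE.
Qed.

Lemma ctensor_converging : converging (ctensor s V W).
Proof. exact: completion_converging. Qed.

End CompletedTensor.
End LinearTopology.

Arguments to_compl_linear {k V B}.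

Section TensorMaps.
Variable k : fieldType.
Implicit Types V W X C Y : linTopType k.

Lemma homD V W (f g : hom V W) x : (f + g : hom V W) x = f x + g x.
Proof. by []. Qed.

Lemma homZ V W a (f : hom V W) x : (a *: f : hom V W) x = a *: f x.
Proof. by []. Qed.

Lemma bicont_swap s V W X (b : V -> W -> X) :
  bicont s b -> bicont s (fun w v => b v w).
Proof.
move=> bc U oU; have := bc U oU; case: s {bc} => /=.
- move=> [[U1 [U2 [o1 o2 h]]] h1 h2]; split=> //.
  by exists U2, U1; split=> // *; exact: h.
- by move=> [U1 [U2 [o1 o2 h1 h2]]]; exists U2, U1; split=> // *; auto.
Qed.

Section Functoriality.
Variable s : tensor_kind.

Fact ctmap_subproof V V' W W' (f : hom V V') (g : hom W W') :
  exists h : hom (ctensor s V W) (ctensor s V' W'),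
    forall v w, h (ctens s v w) = ctens s (f v) (g w).
Proof.
have [tl tr] := @ctens_bilin k s V' W'.
apply: ctensor_lift; first exact: ctensor_converging.
- by split=> [w|v] a x y; rewrite hom_linear ?tl ?tr.
- exact: (bicont_comp f g (hom_id _) (@ctens_bicont k s V' W')).
Qed.

Definition ctmap V V' W W' (f : hom V V') (g : hom W W') :=
  sval (cid (ctmap_subproof f g)).

Lemma ctmapE V V' W W' (f : hom V V') (g : hom W W') v w :
  ctmap f g (ctens s v w) = ctens s (f v) (g w).
Proof. by rewrite /ctmap; case: cid. Qed.

Fact ctswap_subproof V W :
  exists h : hom (ctensor s V W) (ctensor s W V),
    forall v w, h (ctens s v w) = ctens s w v.
Proof.
have [tl tr] := @ctens_bilin k s W V.
apply: (ctensor_lift (b := fun v w => ctens s w v)); first exact: ctensor_converging.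
- by split=> [w|v] a x y; rewrite ?tl ?tr.
- exact/bicont_swap/ctens_bicont.
Qed.

Definition ctswap V W := sval (cid (ctswap_subproof V W)).

Lemma ctswapE V W v w : ctswap V W (ctens s v w) = ctens s w v.
Proof. by rewrite /ctswap; case: cid. Qed.

End Functoriality.

Section ShriekNeighbourhoods.
Variables (V W : linTopType k) (U1 : subspace V) (U2 : subspace W).
Hypotheses (o1 : open U1) (o2 : open U2).

Let gens : set (tensor V W) :=
  [set tens p.1 p.2 | p in [set p : V * W | U1 p.1 \/ U2 p.2]].

Let gens_l u w : U1 u -> span gens (tens u w).
Proof. by move=> Uu L; apply; exists (u, w) => //; left. Qed.

Let gens_r v w : U2 w -> span gens (tens v w).
Proof. by move=> Uw L; apply; exists (v, w) => //; right. Qed.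

Fact shriek_nbhd_subproof : shriek_linbase V W (span gens).
Proof.
by exists U1, U2; split.
Qed.

Definition shriek_nbhd : linbase_ix (shriek_linbase V W) := exist _ _ shriek_nbhd_subproof.

Lemma shriek_nbhd_l u w : U1 u -> ix_sub shriek_nbhd (tens u w).
Proof. exact: gens_l. Qed.

Lemma shriek_nbhd_r v w : U2 w -> ix_sub shriek_nbhd (tens v w).
Proof. exact: gens_r. Qed.

Lemma shriek_nbhd_sub (Q : subspace (tensor V W)) :
  (forall u w, U1 u -> Q (tens u w)) -> (forall v w, U2 w -> Q (tens v w)) ->
  ix_sub shriek_nbhd `<=` Q.
Proof. by move=> h1 h2 t; apply=> _ [[v w] /= [Uv|Uw] <-]; [exact: h1|exact: h2]. Qed.

(** A condition on pure tensors passes to the closure, for a closed target: open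
    subspaces are closed. *)
Lemma shriek_nbhd_hom X (h : hom (ctensor Shriek V W) X) (U : subspace X) : open U ->
  (forall u w, U1 u -> U (h (ctens Shriek u w))) ->
  (forall v w, U2 w -> U (h (ctens Shriek v w))) ->
  forall t, compl_ker shriek_nbhd t -> U (h t).
Proof.
move=> oU h1 h2 t Kt; have [Z [/open_complP[Q QZ] hZ]] := hom_open h oU.
have [Q' [bQ' s s']] := linbase_dir (svalP Q) (svalP shriek_nbhd).
pose Q0 : linbase_ix (shriek_linbase V W) := exist _ Q' bQ'.
have [v tv] := compl_approx Q0 t.
rewrite -[t](subrK (to_compl _ v)) (linD (hom_linear h)); apply: subspaceD.
  by apply/hZ/QZ; exact: (compl_ker_sub (Q := Q0)) tv.
have Kv : ix_sub shriek_nbhd v.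
  apply/compl_kerE; rewrite -[to_compl _ v](subKr t).
  by apply: subspaceB Kt _; exact: (compl_ker_sub (Q := Q0)) tv.
have hL : linear (fun v => h (to_compl (shriek_linbase V W) v)).
  by move=> a x y; rewrite to_compl_linear hom_linear.
by apply: (shriek_nbhd_sub (Q := preim_sub hL U)) Kv.
Qed.

End ShriekNeighbourhoods.

(** Partial application of a *-continuous bilinear map inside the second factor of
    a ! tensor product: for fixed [c] the map [t |-> (1 (x) sigma(-, c)) t] exists
    by functoriality, and the resulting bilinear map is *-continuous because a
    completed tensor is algebraic up to a neighbourhood of [0]. *)
Lemma mixed_lift V W C (Y : linTopType k) (sigma : W -> C -> Y) :
  bilin sigma -> bicont Star sigma ->
  exists h : hom (ctensor Star (ctensor Shriek V W) C) (ctensor Shriek V Y),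
    forall v w c, h (ctens Star (ctens Shriek v w) c) = ctens Shriek v (sigma w c).
Proof.
move=> [sl sr] sc.
have [tl tr] := @ctens_bilin k Shriek V Y.
pose rho c : hom W Y := mk_hom (sl c) (fun U oU => bicontl c sc oU).
pose Phi c := ctmap Shriek (hom_id V) (rho c).
have PhiE c v w : Phi c (ctens Shriek v w) = ctens Shriek v (sigma w c).
  by rewrite /Phi ctmapE.
have Phib : bilin (fun t c => Phi c t).
  split=> [c|t a c c']; first exact: hom_linear.
  rewrite -homZ -homD; apply: ctensor_ext => v w.
  by rewrite homD homZ !PhiE sr tr.
have Phic : bicont Star (fun t c => Phi c t).
  move=> U oU; have [U1 [U2 [o1 o2 h1 h2]]] := @ctens_bicont k Shriek V Y U oU.
  have [[W1 [C1 [oW1 oC1 h12]]] hw hc] := sc U2 o2.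
  have near0 t c : compl_ker (shriek_nbhd o1 oW1) t -> C1 c -> U (Phi c t).
    move=> Kt Cc; apply: shriek_nbhd_hom oU _ _ _ Kt => [u w Uu|v w Ww]; rewrite PhiE.
      exact: h1.
    by apply: h2; exact: h12.
  split.
  - by exists (compl_ker (shriek_nbhd o1 oW1)), C1; split=> //; exact: open_compl_ker.
  - move=> t; have [v tv] := compl_approx (shriek_nbhd o1 oW1) t.
    have alg0 : exists C' : subspace C, open C' /\
        forall c, C' c -> U (Phi c (to_compl (shriek_linbase V W) 0)).
      exists C1; split=> // c _; rewrite (lin0 to_compl_linear) (lin0 (hom_linear _)).
      exact: subspace0.
    have algL a x y :
        (exists C' : subspace C, open C' /\
           forall c, C' c -> U (Phi c (to_compl (shriek_linbase V W) x))) ->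
        (exists C' : subspace C, open C' /\
           forall c, C' c -> U (Phi c (to_compl (shriek_linbase V W) y))) ->
        exists C' : subspace C, open C' /\
           forall c, C' c -> U (Phi c (to_compl (shriek_linbase V W) (a *: x + y))).
      move=> [D [oD hD]] [D' [oD' hD']]; exists (subspaceI D D').
      split=> [|c [/hD Ux /hD' Uy]]; first exact: open_subspaceI.
      by rewrite to_compl_linear hom_linear; exact: subspaceL.
    have [D [oD hD]] : Subspace alg0 algL v.
      apply: tens_ind => x w; have [D [oD hD]] := hw w.
      by exists D; split=> // c /hD Uc; rewrite [X in U X]PhiE; exact: h2.
    exists (subspaceI D C1); split=> [|c [Dc Cc]]; first exact: open_subspaceI.
    rewrite -[t](subrK (to_compl _ v)) (linD (hom_linear _)); apply: subspaceD.
      exact: near0.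
    exact: hD.
  - by move=> c; exact: hom_open.
have [h hE] := ctensor_lift (@ctensor_converging k Shriek V Y) Phib Phic.
by exists h => v w c; rewrite hE PhiE.
Qed.

(** Modulo a basic neighbourhood the tensor is algebraic, and its slices determine it
    by [tensor_sum_separated]: the functionals used there vanish on an open subspace,
    hence are continuous. *)
Lemma ctensor_separated V W (t : ctensor Shriek V W) :
  (forall f : hom V (groundF k), exists h : hom (ctensor Shriek V W) W,
     (forall v w, h (ctens Shriek v w) = (f v : k) *: w) /\ h t = 0) ->
  t = 0.
Proof.
move=> ht; apply: open_separated => U /open_complP[[Q [U1 [U2 [o1 o2 h1 h2]]]] QU].
apply: QU; have QQ := shriek_nbhd_sub h1 h2.
apply: (compl_ker_sub (Q := shriek_nbhd o1 o2)) => //.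
have [v tv] := compl_approx (shriek_nbhd o1 o2) t.
rewrite -[t](subrK (to_compl _ v)); apply: subspaceD => //; apply/compl_kerE.
have [r vE] := tensor_sum v; rewrite vE; apply: (tensor_sum_separated (U := U1) (U' := U2)).
- by move=> u w; exact: shriek_nbhd_l.
- by move=> u w; exact: shriek_nbhd_r.
move=> phi phiL phiU.
have phic (Z : subspace (groundF k)) : open Z ->
    exists U' : subspace V, open U' /\ forall x, U' x -> Z (phi x).
  by move=> _; exists U1; split=> // x /phiU ->; exact: subspace0.
have [h [hE h0]] := ht (@mk_hom k V (groundF k) phi phiL phic).
have <- : h (to_compl _ v) = \sum_(p <- r) phi p.1 *: p.2.
  rewrite vE (big_morph _ (linD to_compl_linear) (lin0 to_compl_linear)).
  rewrite (big_morph _ (linD (hom_linear h)) (lin0 (hom_linear h))).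
  by apply: eq_bigr => p _; rewrite [LHS]hE.
rewrite -[to_compl _ v](subKr t) (linB (hom_linear h)) h0 sub0r; apply: subspaceN.
apply: shriek_nbhd_hom tv => // [u w Uu|x w Uw]; rewrite hE; last exact: subspaceZ.
by rewrite [X in X *: _]phiU // scale0r; exact: subspace0.
Qed.


Lemma functionals_separate V (x y : V) :
  (forall f : hom V (groundF k), f x = f y) -> x = y.
Proof.
move=> e; apply/eqP; rewrite -subr_eq0; apply/eqP/open_separated => U oU.
apply: contrapT => /separating_functional[phi [phiL phiU phi1]].
have phic (Z : subspace (groundF k)) : open Z ->
    exists U' : subspace V, open U' /\ forall x, U' x -> Z (phi x).
  by move=> _; exists U; split=> // z /phiU ->; exact: subspace0.
have exy : phi x = phi y := e (@mk_hom k V (groundF k) phi phiL phic).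
move: phi1; rewrite [LHS](linB phiL) exy [LHS]subrr => /esym/eqP.
by rewrite oner_eq0.
Qed.

End TensorMaps.

(** * Topological sums and products *)

Section SumsProducts.
Variable k : fieldType.
Implicit Type X : linTopType k.

Section Index.
Variables (I : choiceType) (V : I -> linTopType k).

Let only (i : I) (U : subspace (V i)) : forall j, subspace (V j) :=
  dfwith (fun j => subspaceT (V j)) i U.

Let open_only (i : I) (U : subspace (V i)) j : open U -> open (only U j).
Proof.
move=> oU; rewrite /only; have [<-|ij] := eqVneq i j; first by rewrite dfwithin.
by rewrite dfwithout //; exact: openT.
Qed.

Lemma gprod_box_open (F : set I) (U : forall i, subspace (V i)) :
  finite_set F -> (forall i, open (U i)) -> open (prodv_box F U : set (gprod V)).
Proof.
move=> fF oU; rewrite openE => x Ux; exists (prodv_box F U).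
by split=> [|u]; [exists F, U|exact: subspaceD].
Qed.

Lemma open_gprodP (U : subspace (gprod V)) : open U ->
  exists (s : seq I) (W : forall i, subspace (V i)),
    (forall i, open (W i)) /\ forall x : gprod V, (forall i, i \in s -> W i (x i)) -> U x.
Proof.
move=> oU; have : nbhs (0 : gprod V) U.
  by apply: open_nbhs_nbhs; split=> //; exact: subspace0.
move=> [_ [[F [W [/finite_seqP[s ->] oW ->]] h]]]; exists s, W; split=> // x xW.
by rewrite -[x]add0r; exact: h.
Qed.

Lemma gsum_box_open (U : forall i, subspace (V i)) :
  (forall i, open (U i)) -> open (gsum_box U : set (gsum V)).
Proof.
move=> oU; rewrite openE => x Ux; exists (gsum_box U).
by split=> [|u]; [exists U|exact: subspaceD].
Qed.

Lemma open_gsumP (U : subspace (gsum V)) : open U ->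
  exists W : forall i, subspace (V i),
    (forall i, open (W i)) /\ forall x : gsum V, (forall i, W i (val (x : dsumv V) i)) -> U x.
Proof.
move=> oU; have : nbhs (0 : gsum V) U.
  by apply: open_nbhs_nbhs; split=> //; exact: subspace0.
by move=> [_ [[W oW ->] h]]; exists W; split=> // x xW; rewrite -[x]add0r; exact: h.
Qed.

Lemma prodv_inj_linear i : linear (@prodv_inj k I V i).
Proof.
move=> a x y; apply: functional_extensionality_dep => j.
rewrite /prodv_inj /GRing.add /GRing.scale /= /prodv_add /prodv_scale.
have [<-|ij] := eqVneq i j; first by rewrite !dfwithin.
by rewrite !dfwithout // scaler0 addr0.
Qed.

Lemma dsumv_inj_linear i : linear (@dsumv_inj k I V i).
Proof. by move=> a x y; apply: val_inj; exact: prodv_inj_linear. Qed.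

Fact gsum_inj_cont i (U : subspace (gsum V)) : open U ->
  exists U' : subspace (V i), open U' /\ forall x, U' x -> U (@dsumv_inj k I V i x).
Proof.
move=> /open_gsumP[W [oW WU]]; exists (W i); split=> // x Wx; apply: WU => j /=.
rewrite /prodv_inj; have [<-|ij] := eqVneq i j; first by rewrite dfwithin.
by rewrite dfwithout //; exact: subspace0.
Qed.

Definition gsum_inj i : hom (V i) (gsum V) :=
  @mk_hom k (V i) (gsum V) _ (@dsumv_inj_linear i) (@gsum_inj_cont i).

Fact gprod_inj_cont i (U : subspace (gprod V)) : open U ->
  exists U' : subspace (V i), open U' /\ forall x, U' x -> U (@prodv_inj k I V i x).
Proof.
move=> /open_gprodP[s [W [oW WU]]]; exists (W i); split=> // x Wx; apply: WU => j _ /=.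
rewrite /prodv_inj; have [<-|ij] := eqVneq i j; first by rewrite dfwithin.
by rewrite dfwithout //; exact: subspace0.
Qed.

Definition gprod_inj i : hom (V i) (gprod V) :=
  @mk_hom k (V i) (gprod V) _ (@prodv_inj_linear i) (@gprod_inj_cont i).

Fact gsum_pr_linear i : linear (fun x : gsum V => val (x : dsumv V) i).
Proof. by []. Qed.

Fact gsum_pr_cont i (U : subspace (V i)) : open U ->
  exists U' : subspace (gsum V), open U' /\ forall x, U' x -> U (val (x : dsumv V) i).
Proof.
move=> oU; exists (gsum_box (only U)); split; first by apply: gsum_box_open => j; exact: open_only.
by move=> x /(_ i); rewrite /only dfwithin.
Qed.

Definition gsum_pr i : hom (gsum V) (V i) :=
  @mk_hom k (gsum V) (V i) _ (@gsum_pr_linear i) (@gsum_pr_cont i).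

Fact gprod_pr_linear i : linear (fun x : gprod V => x i).
Proof. by []. Qed.

Fact gprod_pr_cont i (U : subspace (V i)) : open U ->
  exists U' : subspace (gprod V), open U' /\ forall x, U' x -> U (x i).
Proof.
move=> oU; exists (prodv_box [set i] (only U)); split.
  by apply: gprod_box_open => // j; exact: open_only.
by move=> x /(_ i erefl); rewrite /only dfwithin.
Qed.

Definition gprod_pr i : hom (gprod V) (V i) :=
  @mk_hom k (gprod V) (V i) _ (@gprod_pr_linear i) (@gprod_pr_cont i).

Lemma gsum_lift X (h : forall i, hom (V i) X) :
  exists H : hom (gsum V) X, forall i x, H (@dsumv_inj k I V i x) = h i x.
Proof.
have [H [HL HE HU]] := dsumv_lift (fun i => hom_linear (h i)).
have Hc (U : subspace X) : open U ->
    exists U' : subspace (gsum V), open U' /\ forall x, U' x -> U (H x).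
  move=> oU; have W i := cid (hom_open (h i) oU).
  exists (gsum_box (fun i => sval (W i))); split.
    by apply: gsum_box_open => i; case: (W i) => ? [].
  by move=> x xW; apply: HU => i; move: (xW i); case: (W i) => ? [_ hW] /hW.
by exists (@mk_hom k (gsum V) X H HL Hc).
Qed.

Lemma gsum_ext X (h h' : hom (gsum V) X) :
  (forall i x, h (@dsumv_inj k I V i x) = h' (@dsumv_inj k I V i x)) -> h =1 h'.
Proof.
move=> e x; have dL : linear (fun x => h x - h' x).
  by move=> a y z; rewrite !hom_linear scalerBr opprD addrACA.
apply/eqP; rewrite -subr_eq0; apply/eqP.
apply: (dsumv_ind (L := preim_sub dL (subspace00 X))) => i y /=.
by apply/eqP; rewrite subr_eq0; apply/eqP; exact: e.
Qed.

Lemma gprod_ext X (h h' : hom (gprod V) X) :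
  (forall i x, h (@prodv_inj k I V i x) = h' (@prodv_inj k I V i x)) -> h =1 h'.
Proof.
move=> e x; apply: hom_eq_dense => U /open_gprodP[s [W [_ WU]]].
exists (\sum_(i <- undup s) @prodv_inj k I V i (x i) : gprod V).
  apply: WU => i si.
  have -> : (x - \sum_(i <- undup s) @prodv_inj k I V i (x i) : gprod V) i = 0.
    have -> (y : gprod V) : (x - y) i = x i - y i by [].
    have evD : {morph (fun y : gprod V => y i) : y z / y + z} by [].
    rewrite (big_morph _ evD (erefl : (0 : gprod V) i = 0)).
    rewrite (big_rem i) ?mem_undup //= big_seq big1 => [|j].
      by rewrite /prodv_inj dfwithin addr0 subrr.
    by rewrite rem_filter ?undup_uniq // mem_filter => /andP[/= ij _]; rewrite /prodv_inj dfwithout.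
  exact: subspace0.
rewrite (big_morph _ (linD (hom_linear h)) (lin0 (hom_linear h))).
rewrite (big_morph _ (linD (hom_linear h')) (lin0 (hom_linear h'))).
by apply: eq_bigr => i _; exact: e.
Qed.

Lemma gprod_tuple X (h : forall i, hom X (V i)) :
  exists H : hom X (gprod V), forall x i, H x i = h i x.
Proof.
have HL : linear (fun x => (fun i => h i x) : gprod V).
  by move=> a x y; apply: functional_extensionality_dep => i; exact: hom_linear.
have Hc (U : subspace (gprod V)) : open U ->
    exists U' : subspace X, open U' /\ forall x, U' x -> U (fun i => h i x).
  move=> /open_gprodP[s [W [oW WU]]].
  have [U' [oU' h']] : exists U' : subspace X,
      open U' /\ forall x i, i \in s -> U' x -> W i (h i x).
    elim: s {WU} => [|i s [U' [oU' h']]].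
      by exists (subspaceT X); split=> //; exact: openT.
    have [Z [oZ hZ]] := hom_open (h i) (oW i).
    exists (subspaceI Z U'); split=> [|x j]; first exact: open_subspaceI.
    by rewrite inE => /orP[/eqP -> [/hZ]|js [_]] //; exact: h'.
  by exists U'; split=> // x U'x; apply: WU => i si; exact: h'.
by exists (mk_hom HL Hc).
Qed.

End Index.

Section Reindex.
Variables (I J : choiceType) (V : I -> linTopType k) (W : J -> linTopType k).
Variables (r : J -> I) (h : forall j, hom (V (r j)) (W j)).

Lemma gprod_map : exists H : hom (gprod V) (gprod W), forall x j, H x j = h j (x (r j)).
Proof.
have [H HE] := gprod_tuple (fun j => hom_comp (h j) (gprod_pr V (r j))).
by exists H => x j; rewrite HE.
Qed.

(** Injectivity of the reindexing keeps supports finite, and makes every component of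
    the source subject to at most one openness condition. *)
Lemma gsum_map : injective r -> exists H : hom (gsum V) (gsum W),
  forall x j, val (H x : dsumv W) j = h j (val (x : dsumv V) (r j)).
Proof.
move=> r_inj.
have fin (x : dsumv V) : finsupp W (fun j => h j (val x (r j))).
  have : finite_set (r @^-1` [set i | val x i != 0]).
    by apply: finite_preimage; [move=> ? ? _ _; exact: r_inj|exact: sub_ofP x].
  apply: sub_finite_set => j /=; apply: contraNneq => ->.
  by rewrite (lin0 (hom_linear _)).
have HL : linear (fun x : gsum V => mksub (fin x) : gsum W).
  by move=> a x y; apply: val_inj; apply: functional_extensionality_dep => j; exact: hom_linear.
have Hc (U : subspace (gsum W)) : open U ->
    exists U' : subspace (gsum V), open U' /\ forall x, U' x -> U (mksub (fin x)).
  move=> /open_gsumP[Z [oZ ZU]].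
  have Z' j := cid (hom_open (h j) (oZ j)).
  pose U' i : subspace (V i) :=
    if pselect (exists j, r j = i) is left e then
      ecast i (subspace (V i)) (proj2_sig (cid e)) (sval (Z' (sval (cid e))))
    else subspaceT (V i).
  have U'r j : U' (r j) = sval (Z' j).
    rewrite /U'; case: pselect => [e|[]]; last by exists j.
    case: (cid e) => j' /= p; have E := r_inj _ _ p; subst j'.
    by rewrite (Prop_irrelevance p erefl).
  exists (gsum_box U'); split.
    apply: gsum_box_open => i; rewrite /U'; case: pselect => [e|_]; last exact: openT.
    by case: (cid e) => j /= p; case: _ / p; case: (Z' j) => ? [].
  move=> x xU; apply: ZU => j /=; have := xU (r j); rewrite U'r.
  by case: (Z' j) => Y [oY hY] xY; exact: (hY _ xY).
by exists (mk_hom HL Hc).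
Qed.

End Reindex.
End SumsProducts.

(** * Homogeneous elements *)

Section Homogeneous.
Variable k : fieldType.
Implicit Types A B C : gspace k.

(** Homogeneous elements of all degrees form one type, on which homogeneous maps
    act by plain composable functions; equations between homogeneous maps then
    need no casts between propositionally equal degrees. *)
Definition elt A := {i : int & A i}.

Definition el A (i : int) (x : A i) : elt A := existT (fun i => A i) i x.

Local Notation deg X := (projT1 X).

(* These operations are locked because comparing composites of structural maps up
   to conversion would unfold the constructions of the tensor products. *)
Definition tsc A : k -> elt A -> elt A := locked (fun c (X : elt A) => el (c *: projT2 X)).

Definition app d A B : ghom d A B -> elt A -> elt B :=
  locked (fun (f : ghom d A B) X => el (f (deg X) (deg X + d) erefl (projT2 X))).

Definition ten s A B : elt A -> elt B -> elt (gtensor s A B) :=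
  locked (fun (X : elt A) (Y : elt B) => el (gtens s (projT2 X) (projT2 Y))).

Lemma tsc_el A c i (x : A i) : tsc c (el x) = el (c *: x).
Proof. by rewrite /tsc -lock. Qed.

Lemma ten_el s A B i j (a : A i) (b : B j) : ten s (el a) (el b) = el (gtens s a b).
Proof. by rewrite /ten -lock. Qed.

Lemma el_inj A i (x y : A i) : el x = el y -> x = y.
Proof.
move=> e; have := projT2_eq e; move: (projT1_eq e) => /= p.
by rewrite (Prop_irrelevance p erefl).
Qed.

Definition degree_hom A i j : hom (A i) (A j) :=
  match i =P j with
  | ReflectT e => ecast j (hom (A i) (A j)) e (hom_id (A i))
  | ReflectF _ => 0
  end.

Lemma degree_hom_id A i : degree_hom A i i = hom_id (A i).
Proof. by rewrite /degree_hom; case: eqP => // e; rewrite (Prop_irrelevance e erefl). Qed.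

Lemma degree_hom0 A i j : i <> j -> degree_hom A i j = 0.
Proof. by rewrite /degree_hom; case: eqP. Qed.

(** Defined for every [n], so that the components of a pure tensor have one formula
    in all bidegrees, see [component_gtens]. *)
Definition part A n (X : elt A) : A n := degree_hom A (deg X) n (projT2 X).

Lemma part_el A i (x : A i) : part i (el x) = x.
Proof. by rewrite /part degree_hom_id. Qed.

Lemma el_part A n (X : elt A) : deg X = n -> el (part n X) = X.
Proof. by case: X => i x /= <-; rewrite part_el. Qed.

Lemma part0 A n (X : elt A) : deg X <> n -> part n X = 0.
Proof. by move=> ne; rewrite /part degree_hom0. Qed.

Lemma part_degree A i j (X : elt A) : i = j -> degree_hom A i j (part i X) = part j X.
Proof. by move=> <-; rewrite degree_hom_id. Qed.

Lemma elt_eq A n (X Y : elt A) : deg X = n -> deg Y = n -> part n X = part n Y -> X = Y.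
Proof. by move=> eX eY e; rewrite -(el_part eX) e el_part. Qed.

Lemma app_el d A B (f : ghom d A B) i j (p : i + d = j) (x : A i) :
  app f (el x) = el (f i j p x).
Proof. by rewrite /app -lock; case: _ / p. Qed.

Lemma deg_app d A B (f : ghom d A B) X : deg (app f X) = deg X + d.
Proof. by rewrite /app -lock. Qed.

Lemma deg_tsc A c (X : elt A) : deg (tsc c X) = deg X.
Proof. by rewrite /tsc -lock. Qed.

Lemma deg_ten s A B (X : elt A) (Y : elt B) : deg (ten s X Y) = deg X + deg Y.
Proof. by rewrite /ten -lock. Qed.

Lemma part_app d A B (f : ghom d A B) i j (p : i + d = j) (X : elt A) :
  part j (app f X) = f i j p (part i X).
Proof.
have [e|ne] := eqVneq (deg X) i; last first.
  rewrite !part0 ?(lin0 (hom_linear _)) //; first exact/eqP.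
  by rewrite deg_app => e; case/eqP: ne; apply: (addIr d); rewrite p.
by rewrite -{1}(el_part e) (app_el f p) part_el.
Qed.

(** The equality of degrees is implied, by looking at the degree of the image of
    [0]. *)
Lemma ghom_eqP d e A B (f : ghom d A B) (g : ghom e A B) :
  ghom_eq f g <-> forall X, app f X = app g X.
Proof.
split=> [[de fg] [i x]|fg].
  by subst e; rewrite -/(el x) !(app_el _ erefl); apply: congr1 (fg _ _ _ _ _).
have de : d = e.
  have := congr1 (fun X => deg X) (fg (el (0 : A 0))).
  by rewrite !deg_app; exact: addrI.
by split=> // i j p q x; apply: el_inj; rewrite -!app_el.
Qed.

Lemma app_gcomp d e A B C (g : ghom e B C) (f : ghom d A B) X :
  app (gcomp g f) X = app g (app f X).
Proof.
case: X => i x; rewrite -/(el x) (app_el f erefl) (app_el _ erefl).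
by rewrite (app_el g (gcomp_deg erefl)).
Qed.

Lemma app_gscale d A B c (f : ghom d A B) X : app (gscale c f) X = tsc c (app f X).
Proof. by case: X => i x; rewrite -/(el x) !(app_el _ erefl) tsc_el. Qed.

Lemma app_gid A X : app (gid A) X = X.
Proof.
case: X => i x; rewrite -/(el x) (app_el _ (addr0 i)) /gid; congr el.
by rewrite (Prop_irrelevance (etrans _ _) erefl).
Qed.

Lemma app_tsc d A B c (f : ghom d A B) X : app f (tsc c X) = tsc c (app f X).
Proof.
case: X => i x; rewrite -/(el x) (app_el f erefl) !tsc_el (app_el f erefl).
by rewrite (linZ (hom_linear _)).
Qed.

Lemma tscA A a b (X : elt A) : tsc a (tsc b X) = tsc (a * b) X.
Proof. by case: X => i x; rewrite -/(el x) !tsc_el scalerA. Qed.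

Lemma tsc1 A (X : elt A) : tsc 1 X = X.
Proof. by case: X => i x; rewrite -/(el x) tsc_el scale1r. Qed.

Lemma tsc0 A (X Y : elt A) : deg X = deg Y -> tsc 0 X = tsc 0 Y.
Proof.
case: X Y => [i x] [j y] /= e; case: _ / e y => y.
by rewrite -/(el x) -/(el y) !tsc_el !scale0r.
Qed.

Lemma part_tsc A n c (X : elt A) : part n (tsc c X) = c *: part n X.
Proof. by rewrite /tsc -lock; exact: (linZ (hom_linear _)). Qed.

End Homogeneous.

Notation deg X := (projT1 X).

(** * Graded tensor products *)

Section GradedTensor.
Variable k : fieldType.
Implicit Types A B C : gspace k.

Lemma gtens_bilin s A B i j : bilin (@gtens k s A B i j).
Proof.
split=> [b|a] c x y; case: s; rewrite /gtens ?((ctens_bilin _ _ _).1 b) ?((ctens_bilin _ _ _).2 a);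
  [exact: dsumv_inj_linear|exact: prodv_inj_linear|
   exact: dsumv_inj_linear|exact: prodv_inj_linear].
Qed.

Lemma ten_tscl s A B c (X : elt A) (Y : elt B) : ten s (tsc c X) Y = tsc c (ten s X Y).
Proof.
case: X Y => [i x] [j y]; rewrite -/(el x) -/(el y) tsc_el !ten_el tsc_el.
by rewrite (linZ ((gtens_bilin s A B _ _).1 _)).
Qed.

Lemma ten_tscr s A B c (X : elt A) (Y : elt B) : ten s X (tsc c Y) = tsc c (ten s X Y).
Proof.
case: X Y => [i x] [j y]; rewrite -/(el x) -/(el y) tsc_el !ten_el tsc_el.
by rewrite (linZ ((gtens_bilin s A B _ _).2 _)).
Qed.

Definition component s A B n (ij : bideg n) :
    hom (gtensor s A B n) (ctensor s (A (sval ij).1) (B (sval ij).2)) :=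
  match s with
  | Star => gsum_pr (fun ij : bideg n => ctensor Star (A (sval ij).1) (B (sval ij).2)) ij
  | Shriek => gprod_pr (fun ij : bideg n => ctensor Shriek (A (sval ij).1) (B (sval ij).2)) ij
  end.

Lemma component_ext s A B n (x y : gtensor s A B n) :
  (forall ij, component s A B ij x = component s A B ij y) -> x = y.
Proof.
case: s x y => x y e; last by apply: functional_extensionality_dep => ij; exact: e.
by apply: val_inj; apply: functional_extensionality_dep => ij; exact: e.
Qed.

Lemma component_gtens s A B i j (a : A i) (b : B j) (ij : bideg (i + j)) :
  component s A B ij (gtens s a b) =
  ctens s (part (sval ij).1 (el a)) (part (sval ij).2 (el b)).
Proof.
have [<-|ne] := eqVneq (bidegP i j) ij.
  by rewrite !part_el; case: s; rewrite /= /prodv_inj dfwithin.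
have -> : component s A B ij (gtens s a b) = 0.
  by case: s; rewrite /= /prodv_inj dfwithout.
have [e1|ne1] := eqVneq i (sval ij).1; last first.
  by rewrite [part _ (el a)]part0 ?(lin0 ((ctens_bilin _ _ _).1 _)) //; exact/eqP.
have [e2|ne2] := eqVneq j (sval ij).2; last first.
  by rewrite [part _ (el b)]part0 ?(lin0 ((ctens_bilin _ _ _).2 _)) //; exact/eqP.
case/eqP: ne; by apply: val_inj => /=; move: e1 e2; case: (sval ij) => /= ? ? -> ->.
Qed.

Lemma gtensor_map s A B A' B' n n' (r : bideg n' -> bideg n)
    (h : forall ij : bideg n', hom (ctensor s (A (sval (r ij)).1) (B (sval (r ij)).2))
                                   (ctensor s (A' (sval ij).1) (B' (sval ij).2))) :
  injective r -> exists H : hom (gtensor s A B n) (gtensor s A' B' n'),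
    forall x ij, component s A' B' ij (H x) = h ij (component s A B (r ij) x).
Proof.
move=> r_inj; case: s h => h.
- have [H HE] := gsum_map (V := fun ij : bideg n => ctensor Star (A (sval ij).1) (B (sval ij).2))
    (W := fun ij : bideg n' => ctensor Star (A' (sval ij).1) (B' (sval ij).2)) h r_inj.
  by exists H.
- have [H HE] := gprod_map (V := fun ij : bideg n => ctensor Shriek (A (sval ij).1) (B (sval ij).2))
    (W := fun ij : bideg n' => ctensor Shriek (A' (sval ij).1) (B' (sval ij).2)) h.
  by exists H.
Qed.

(** Sums of pure tensors are dense in each degree, so they determine a
    continuous map. *)
Lemma gtensor_ext s A B n (X : linTopType k) (h h' : hom (gtensor s A B n) X) :
  (forall i j (e : i + j = n) (a : A i) (b : B j),
    h (ecast m (gtensor s A B m) e (gtens s a b)) =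
    h' (ecast m (gtensor s A B m) e (gtens s a b))) -> h =1 h'.
Proof.
case: s h h' => h h' e.
- apply: gsum_ext => -[[i j] /= ij]; have := eqP ij => ijn; subst n.
  rewrite (bool_irrelevance ij (eqxx (i + j))) => x.
  pose inj := gsum_inj (fun ij : bideg (i + j) => ctensor Star (A (sval ij).1) (B (sval ij).2))
    (bidegP i j).
  apply: (ctensor_ext (h := hom_comp h inj) (h' := hom_comp h' inj)) => a b.
  exact: (e i j erefl a b).
- apply: gprod_ext => -[[i j] /= ij]; have := eqP ij => ijn; subst n.
  rewrite (bool_irrelevance ij (eqxx (i + j))) => x.
  pose inj := gprod_inj (fun ij : bideg (i + j) => ctensor Shriek (A (sval ij).1) (B (sval ij).2))
    (bidegP i j).
  apply: (ctensor_ext (h := hom_comp h inj) (h' := hom_comp h' inj)) => a b.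
  exact: (e i j erefl a b).
Qed.

Lemma app_ext_deg s A B C d e (f : ghom d (gtensor s A B) C) (g : ghom e (gtensor s A B) C) n :
  d = e ->
  (forall (X : elt A) (Y : elt B), deg X + deg Y = n -> app f (ten s X Y) = app g (ten s X Y)) ->
  forall Z : elt (gtensor s A B), deg Z = n -> app f Z = app g Z.
Proof.
move=> de fg; subst e; case=> i z /= ni; subst i.
rewrite -/(el z) !(app_el _ erefl); congr el.
apply: gtensor_ext => i j ijn a b; subst n.
by apply: el_inj; rewrite -!app_el -[el (gtens s a b)]ten_el; exact: fg.
Qed.

Lemma app_ext s A B C d e (f : ghom d (gtensor s A B) C) (g : ghom e (gtensor s A B) C) :
  (forall X Y, app f (ten s X Y) = app g (ten s X Y)) -> forall Z, app f Z = app g Z.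
Proof.
move=> fg Z; apply: (app_ext_deg (n := deg Z)) => //.
have := congr1 (fun X => deg X) (fg (el (0 : A 0)) (el (0 : B 0))).
by rewrite !deg_app; exact: addrI.
Qed.

End GradedTensor.

(** * The structural maps on pure tensors *)

Section StructuralMaps.
Variable k : fieldType.
Implicit Types A B C : gspace k.
Local Notation sgn := (sgn k).

Section Functoriality.
Variables (s : tensor_kind) (d e : int) (A A' B B' : gspace k).
Variables (f : ghom d A A') (g : ghom e B B').

Fact shift_subproof (i j : int) (p : i + (d + e) = j) (ij : bideg j) :
  (sval ij).1 - d + ((sval ij).2 - e) == i.
Proof. by case: ij => -[a b] /= /eqP ab; apply/eqP; lia. Qed.

(* The bidegree of the source is computed from that of the target, which is what
   the product over bidegrees requires. *)
Let shift (i j : int) (p : i + (d + e) = j) (ij : bideg j) : bideg i :=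
  exist _ ((sval ij).1 - d, (sval ij).2 - e) (shift_subproof p ij).

Let shift1 (i j : int) (p : i + (d + e) = j) ij : (sval (shift p ij)).1 + d = (sval ij).1.
Proof. exact: subrK. Qed.

Let shift2 (i j : int) (p : i + (d + e) = j) ij : (sval (shift p ij)).2 + e = (sval ij).2.
Proof. exact: subrK. Qed.

Let shift_inj (i j : int) (p : i + (d + e) = j) : injective (shift p).
Proof.
move=> [[a b] ?] [[a' b'] ?] /(congr1 sval)/= [/addIr ea /addIr eb].
by apply: val_inj; rewrite /= ea eb.
Qed.

Lemma app_gtmap X Y : app (gtmap s f g) (ten s X Y) =
  tsc (sgn (e * deg X)) (ten s (app f X) (app g Y)).
Proof.
have deg_eq i j : i + j + (d + e) = i + d + (j + e) by rewrite addrACA.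
suff: exists h : ghom (d + e) (gtensor s A B) (gtensor s A' B'),
    forall i j (a : A i) (b : B j) (p : i + j + (d + e) = (i + d) + (j + e)),
    h _ _ p (gtens s a b) = sgn (e * i) *: gtens s (@f i _ erefl a) (@g j _ erefl b).
  move=> /the_ghomP spec.
  case: X Y => [i a] [j b]; rewrite -/(el a) -/(el b) ten_el (app_el _ (deg_eq i j)).
  rewrite (app_el f erefl) (app_el g erefl) ten_el tsc_el; congr el; exact: spec.
pose comp (i j : int) (p : i + (d + e) = j) (ij : bideg j) :
    hom (ctensor s (A (sval (shift p ij)).1) (B (sval (shift p ij)).2))
        (ctensor s (A' (sval ij).1) (B' (sval ij).2)) :=
  sgn (e * (sval (shift p ij)).1) *: ctmap s (f (shift1 p ij)) (g (shift2 p ij)).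
have compE i j p ij v w : @comp i j p ij (ctens s v w) =
    sgn (e * (sval (shift p ij)).1) *: ctens s (f (shift1 p ij) v) (g (shift2 p ij) w).
  by rewrite [LHS]homZ ctmapE.
pose h (i j : int) (p : i + (d + e) = j) :=
  sval (cid (gtensor_map (comp i j p) (@shift_inj i j p))).
have hE i j p x ij : component s A' B' ij (h i j p x) = comp i j p ij (component s A B (shift p ij) x).
  by rewrite /h; case: cid.
exists h => i j a b p; apply: component_ext => ij.
rewrite hE (linZ (hom_linear _)) !component_gtens [LHS]compE.
have -> : el (@f i (i + d) erefl a) = app f (el a) by rewrite (app_el f erefl).
have -> : el (@g j (j + e) erefl b) = app g (el b) by rewrite (app_el g erefl).
rewrite (part_app f (shift1 p ij)) (part_app g (shift2 p ij)).
have [E|ne] := eqVneq (sval (shift p ij)).1 i; first by congr (sgn (e * _) *: _).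
rewrite [part _ (el a)]part0; last by apply/eqP; rewrite eq_sym.
by rewrite (lin0 (hom_linear _)) (lin0 ((ctens_bilin _ _ _).1 _)) !scaler0.
Qed.

End Functoriality.

Section Symmetry.
Variables (s : tensor_kind) (A B : gspace k).

Fact flip_subproof (i j : int) (p : i + 0 = j) (ij : bideg j) :
  (sval ij).2 + (sval ij).1 == i.
Proof. by case: ij => -[a b] /= /eqP ab; apply/eqP; lia. Qed.

Let flip (i j : int) (p : i + 0 = j) (ij : bideg j) : bideg i :=
  exist _ ((sval ij).2, (sval ij).1) (flip_subproof p ij).

Let flip_inj (i j : int) (p : i + 0 = j) : injective (flip p).
Proof.
move=> [[a b] ?] [[a' b'] ?] /(congr1 sval)/= [ea eb].
by apply: val_inj; rewrite /= ea eb.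
Qed.

Lemma app_gswap X Y : app (gswap s A B) (ten s X Y) =
  tsc (sgn (deg X * deg Y)) (ten s Y X).
Proof.
have deg_eq i j : i + j + 0 = j + i :> int by rewrite addr0 addrC.
suff: exists h : ghom 0 (gtensor s A B) (gtensor s B A),
    forall i j (a : A i) (b : B j) (p : i + j + 0 = j + i),
    h _ _ p (gtens s a b) = sgn (i * j) *: gtens s b a.
  move=> /the_ghomP spec.
  case: X Y => [i a] [j b]; rewrite -/(el a) -/(el b) !ten_el tsc_el (app_el _ (deg_eq i j)).
  by congr el; exact: spec.
pose comp (j : int) (ij : bideg j) :
    hom (ctensor s (A (sval ij).2) (B (sval ij).1))
        (ctensor s (B (sval ij).1) (A (sval ij).2)) :=
  sgn ((sval ij).2 * (sval ij).1) *: ctswap s _ _.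
have compE j ij v w : comp j ij (ctens s v w) =
    sgn ((sval ij).2 * (sval ij).1) *: ctens s w v.
  by rewrite [LHS]homZ ctswapE.
pose h (i j : int) (p : i + 0 = j) :=
  sval (cid (@gtensor_map k s A B B A i j (flip p) (comp j) (@flip_inj i j p))).
have hE i j p x ij : component s B A ij (h i j p x) = comp j ij (component s A B (flip p ij) x).
  by rewrite /h; case: cid.
exists h => i j a b p; apply: component_ext => ij.
rewrite hE (linZ (hom_linear _)) !component_gtens [LHS]compE.
have [e2|ne] := eqVneq (sval ij).2 i; last first.
  rewrite [part _ (el a)]part0; last by apply/eqP; rewrite eq_sym.
  by rewrite (lin0 ((ctens_bilin _ _ _).2 _)) !scaler0.
have [e1|ne] := eqVneq (sval ij).1 j; first by congr (sgn (_ * _) *: _).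
rewrite [part _ (el b)]part0; last by apply/eqP; rewrite eq_sym.
by rewrite (lin0 ((ctens_bilin _ _ _).1 _)) !scaler0.
Qed.

End Symmetry.

Lemma el_degree_hom A i j (x : A i) : i = j -> el (degree_hom A i j x) = el x.
Proof. by move=> <-; rewrite degree_hom_id. Qed.

Lemma gtens_bicont A B i j : bicont Star (@gtens k Star A B i j).
Proof.
pose inj := gsum_inj (fun ij : bideg (i + j) => ctensor Star (A (sval ij).1) (B (sval ij).2))
  (bidegP i j).
exact: (bicont_comp (hom_id _) (hom_id _) inj (@ctens_bicont k Star (A i) (B j))).
Qed.

(** Unlike [gtmap] applied to an element viewed as a map, these introduce no sign. *)
Definition ten_left A B (X : elt A) : ghom (deg X) B (gtensor Star A B) :=
  fun j m p => hom_comp (degree_hom (gtensor Star A B) (deg X + j) m)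
    (mk_hom ((gtens_bilin Star A B _ _).2 (projT2 X))
            (fun U oU => bicontr (projT2 X) (@gtens_bicont A B _ _) oU)).

Definition ten_right A B (Y : elt B) : ghom (deg Y) A (gtensor Star A B) :=
  fun i m p => hom_comp (degree_hom (gtensor Star A B) (i + deg Y) m)
    (mk_hom ((gtens_bilin Star A B _ _).1 (projT2 Y))
            (fun U oU => bicontl (projT2 Y) (@gtens_bicont A B _ _) oU)).

Lemma app_ten_left A B (X : elt A) (Y : elt B) : app (@ten_left A B X) Y = ten Star X Y.
Proof.
case: X Y => [i a] [j b]; rewrite -/(el a) -/(el b) (app_el _ erefl) ten_el.
exact: (@el_degree_hom (gtensor Star A B) _ _ _ (addrC _ _)).
Qed.

Lemma app_ten_right A B (X : elt A) (Y : elt B) : app (@ten_right A B Y) X = ten Star X Y.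
Proof.
case: X Y => [i a] [j b]; rewrite -/(el a) -/(el b) (app_el _ erefl) ten_el.
exact: (@el_degree_hom (gtensor Star A B) _ _ _ erefl).
Qed.

Section Ground.

Definition gcoef n (z : ground k n) : k := \sum_j (z : 'rV[k]_(n == 0)) 0 j.

Lemma gcoef_linear n : linear (@gcoef n : ground k n -> k^o).
Proof.
move=> a x y; rewrite /gcoef [RHS](_ : _ = a * gcoef x + gcoef y) // /gcoef mulr_sumr -big_split.
by apply: eq_bigr => j _; rewrite !mxE.
Qed.

Lemma scal_linear n : linear (scal n : k^o -> ground k n).
Proof. by move=> a x y; apply/rowP => j; rewrite !mxE. Qed.

Lemma gcoefK n (z : ground k n) : scal n (gcoef z) = z.
Proof.
rewrite /gcoef /scal; move: z; rewrite /ground; case: (n == 0) => /= z; apply/rowP => -[[|j] ?] //.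
by rewrite !mxE big_ord1; congr (z _ _); apply: val_inj.
Qed.

Lemma scalK n (c : k) : gcoef (scal n c) = if n == 0 then c else 0.
Proof.
rewrite /gcoef /scal; case: (n == 0) => /=; last by rewrite big_ord0.
by rewrite big_ord1 mxE.
Qed.

Definition cf (Z : elt (ground k)) : k := gcoef (projT2 Z).

Definition one : elt (ground k) := el (ground1 k).

Lemma cf_eq Z Z' : deg Z = deg Z' -> cf Z = cf Z' -> Z = Z'.
Proof.
case: Z Z' => [n z] [n' z'] /= e; case: _ / e z' => z' e.
by rewrite -(gcoefK z) -(gcoefK z') [gcoef z]e.
Qed.

Lemma cf_deg Z : deg Z != 0 -> cf Z = 0.
Proof. by case: Z => [n z] /= n0; rewrite /cf /= -(gcoefK z) scalK (negPf n0). Qed.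

Lemma cf_tsc c Z : cf (tsc c Z) = c * cf Z.
Proof. by rewrite /tsc -lock; exact: (linZ (@gcoef_linear _)). Qed.

Lemma cf_one : cf one = 1.
Proof. by rewrite /cf /one /ground1 scalK. Qed.

Lemma ground_tsc Z : deg Z = 0 -> Z = tsc (cf Z) one.
Proof. by move=> e; apply: cf_eq; rewrite ?deg_tsc // cf_tsc cf_one mulr1. Qed.

Lemma discr_open (V : lmodType k) (U : subspace (discr V)) : open U.
Proof.
rewrite openE => x Ux; exists (subspace00 (discr V)); split=> // u ->.
by rewrite addr0.
Qed.

Fact scal_cont n (U : subspace (ground k n)) : open U ->
  exists U' : subspace (groundF k), open U' /\ forall c, U' c -> U (scal n c).
Proof.
move=> _; exists (subspace00 (groundF k)); split; first exact: discr_open.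
by move=> c ->; rewrite (lin0 (@scal_linear n)); exact: subspace0.
Qed.

Definition scal_hom n : hom (groundF k) (ground k n) :=
  @mk_hom k (groundF k) (ground k n) _ (@scal_linear n) (@scal_cont n).

Fact gcoef_cont n (U : subspace (groundF k)) : open U ->
  exists U' : subspace (ground k n), open U' /\ forall z, U' z -> U (gcoef z).
Proof.
move=> _; exists (subspace00 (ground k n)); split; first exact: discr_open.
by move=> c ->; rewrite (lin0 (@gcoef_linear n)); exact: subspace0.
Qed.

Definition gcoef_hom n : hom (ground k n) (groundF k) :=
  @mk_hom k (ground k n) (groundF k) _ (@gcoef_linear n) (@gcoef_cont n).

End Ground.
End StructuralMaps.

Section Signs.
Variable k : fieldType.

Definition par (n : int) : bool := odd `|n|.

Lemma sgnE n : sgn k n = (-1) ^+ par n.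
Proof. by rewrite /sgn /par signr_odd; case: n => n //; exact: invr_sign. Qed.

Lemma parD m n : par (m + n) = par m (+) par n.
Proof. by rewrite /par; lia. Qed.

Lemma parN n : par (- n) = par n.
Proof. by rewrite /par; lia. Qed.

Lemma parM m n : par (m * n) = par m && par n.
Proof. by rewrite /par abszM oddM. Qed.

Lemma par0 : par 0 = false.
Proof. by []. Qed.

End Signs.

(** Equality of two products of signs, by cases on the parities involved. *)
Ltac sign_cases :=
  rewrite ?sgnE ?(mul0r, mulr0, parD, parN, parM, par0);
  repeat match goal with |- context [par ?n] => case: (par n) => /= end;
  rewrite ?(expr0, expr1, mulr1, mul1r, mulrN1, mulN1r, opprK).

Section Units.
Variable k : fieldType.
Implicit Types A B C : gspace k.
Local Notation one := (one k).

Lemma hom_compE (V W X : linTopType k) (g : hom W X) (f : hom V W) x :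
  hom_comp g f x = g (f x).
Proof. by []. Qed.

Lemma gcoef_one : gcoef (part 0 one) = 1.
Proof. by rewrite part_el; exact: cf_one. Qed.

Lemma scale_left_lift (X : linTopType k) : converging X ->
  exists h : hom (ctensor Shriek (ground k 0) X) X,
    forall z x, h (ctens Shriek z x) = gcoef z *: x.
Proof.
move=> Xc; apply: (ctensor_lift (b := fun z x => gcoef z *: x)) => //.
  split=> [x|z] a u v; last by rewrite scalerDr !scalerA mulrC.
  by rewrite (gcoef_linear a u v) scalerDl -scalerA.
move=> U oU; exists (subspace00 (ground k 0)), U; split=> //; first exact: discr_open.
  by move=> _ x ->; rewrite (lin0 (@gcoef_linear k 0)) scale0r; exact: subspace0.
by move=> z x Ux; exact: subspaceZ.
Qed.

Section Complete.
Variable A : gspace k.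
Hypothesis Ac : forall i, converging (A i).

Lemma app_unitl_one Y : app (unitl Shriek A) (ten Shriek one Y) = Y.
Proof.
have deg_eq i : 0 + i + 0 = i :> int by rewrite add0r addr0.
suff: exists h : ghom 0 (gtensor Shriek (ground k) A) A,
    forall i (a : A i) (p : 0 + i + 0 = i), h _ _ p (gtens Shriek (ground1 k) a) = a.
  move=> /the_ghomP spec; case: Y => i a; rewrite -/(el a) ten_el (app_el _ (deg_eq i)).
  by congr el; exact: spec.
pose ix i : bideg i := exist _ (0, i) (introT eqP (add0r i)).
pose m i := sval (cid (scale_left_lift (@Ac i))).
have mE i z x : m i (ctens Shriek z x) = gcoef z *: x by rewrite /m; case: cid.
exists (fun i j p => hom_comp (degree_hom A i j)
   (hom_comp (m i) (component Shriek (ground k) A (ix i)))) => i a p.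
have cE : component Shriek (ground k) A (ix (0 + i)) (gtens Shriek (ground1 k) a) =
    ctens Shriek (part 0 one) (part (0 + i) (el a)).
  exact: (component_gtens Shriek (ground1 k) a (ix (0 + i))).
rewrite !hom_compE cE mE [gcoef _]gcoef_one scale1r.
by apply: el_inj; rewrite el_degree_hom ?add0r // el_part /= ?add0r.
Qed.

Lemma app_unitr_one Y : app (unitr Shriek A) (ten Shriek Y one) = Y.
Proof.
have deg_eq i : i + 0 + 0 = i :> int by rewrite !addr0.
suff: exists h : ghom 0 (gtensor Shriek A (ground k)) A,
    forall i (a : A i) (p : i + 0 + 0 = i), h _ _ p (gtens Shriek a (ground1 k)) = a.
  move=> /the_ghomP spec; case: Y => i a; rewrite -/(el a) ten_el (app_el _ (deg_eq i)).
  by congr el; exact: spec.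
pose ix i : bideg i := exist _ (i, 0) (introT eqP (addr0 i)).
pose m i := sval (cid (scale_left_lift (@Ac i))).
have mE i z x : m i (ctens Shriek z x) = gcoef z *: x by rewrite /m; case: cid.
exists (fun i j p => hom_comp (degree_hom A i j)
   (hom_comp (m i) (hom_comp (ctswap Shriek _ _)
     (component Shriek A (ground k) (ix i))))) => i a p.
rewrite !hom_compE component_gtens ctswapE mE.
rewrite [gcoef _]gcoef_one scale1r.
by apply: el_inj; rewrite el_degree_hom ?addr0 // el_part /= ?addr0.
Qed.

Lemma app_unitl Z Y : deg Z = 0 -> app (unitl Shriek A) (ten Shriek Z Y) = tsc (cf Z) Y.
Proof. by move=> Z0; rewrite {1}(ground_tsc Z0) ten_tscl app_tsc app_unitl_one. Qed.

Lemma app_unitr Z Y : deg Z = 0 -> app (unitr Shriek A) (ten Shriek Y Z) = tsc (cf Z) Y.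
Proof. by move=> Z0; rewrite {1}(ground_tsc Z0) ten_tscr app_tsc app_unitr_one. Qed.

End Complete.

Lemma app_unitl_inv A Y : app (unitl_inv Star A) Y = ten Star one Y.
Proof.
have deg_eq i : i + 0 = 0 + i :> int by rewrite add0r addr0.
suff: exists h : ghom 0 A (gtensor Star (ground k) A),
    forall i (a : A i) (p : i + 0 = 0 + i), h _ _ p a = gtens Star (ground1 k) a.
  move=> /the_ghomP spec; case: Y => i a.
  by rewrite -/(el a) ten_el (app_el _ (deg_eq i)); congr el; exact: spec.
exists (@ten_left k (ground k) A one) => i a p.
by apply: el_inj; rewrite -app_el -ten_el; exact: (app_ten_left one (el a)).
Qed.

Lemma app_unitr_inv A Y : app (unitr_inv Star A) Y = ten Star Y one.
Proof.
suff: exists h : ghom 0 A (gtensor Star A (ground k)),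
    forall i (a : A i) (p : i + 0 = i + 0), h _ _ p a = gtens Star a (ground1 k).
  move=> /the_ghomP spec; case: Y => i a.
  by rewrite -/(el a) ten_el (app_el _ erefl); congr el; exact: spec.
exists (@ten_right k A (ground k) one) => i a p.
by apply: el_inj; rewrite -app_el -ten_el; exact: (app_ten_right (el a) one).
Qed.

End Units.

Section Mixed.
Variable k : fieldType.
Implicit Types A B C : gspace k.

Section Right.
Variables A B C : gspace k.

(** A map into a product and out of a sum is given by its components. From degrees
    [(n, l)] to degrees [(i, m)] the component of [mixr] projects the ! tensor product
    to degree [i] of [A], then tensors inside. *)
Lemma mixr_component (n l i m : int) :
  exists h : hom (ctensor Star (gtensor Shriek A B n) (C l))
                 (ctensor Shriek (A i) (gtensor Star B C m)),
    i + m = n + l -> forall (u v : int) (e : u + v = n) (a : A u) (b : B v) (c : C l),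
      h (ctens Star (ecast w (gtensor Shriek A B w) e (gtens Shriek a b)) c) =
      ctens Shriek (part i (el a)) (part m (ten Star (el b) (el c))).
Proof.
have ni : i + (n - i) == n by apply/eqP; lia.
pose ix : bideg n := exist _ (i, n - i) ni.
pose S := degree_hom (gtensor Star B C) (n - i + l) m.
pose sigma (b : B (n - i)) (c : C l) : gtensor Star B C m := S (gtens Star b c).
have sb : bilin sigma.
  have [tl tr] := gtens_bilin Star B C (n - i) l.
  by split=> [c|b] a x y; rewrite /sigma ?tl ?tr hom_linear.
have sc : bicont Star sigma.
  exact: (bicont_comp (hom_id _) (hom_id _) S (@gtens_bicont k B C (n - i) l)).
have [h hE] := mixed_lift (A i) sb sc.
exists (hom_comp h (ctmap Star (component Shriek A B ix) (hom_id _))) => im u v e a b c.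
subst n; rewrite hom_compE ctmapE.
have -> : component Shriek A B ix (gtens Shriek a b) =
    ctens Shriek (part i (@el k A u a)) (part (u + v - i) (@el k B v b)).
  exact: (component_gtens Shriek a b ix).
rewrite [LHS]hE /sigma.
have [eu|ne] := eqVneq u i; last first.
  rewrite [part i _]part0 ?(lin0 ((ctens_bilin _ _ _).1 _)) //; exact/eqP.
subst u; congr ctens; have ev : v = i + v - i by lia.
have em : i + v - i + l = m by lia.
have em' : v + l = m by lia.
apply: el_inj; rewrite [LHS]el_degree_hom // [RHS]el_part ?deg_ten // -ten_el.
by rewrite (@el_part k B _ (el b) ev).
Qed.

Lemma app_mixr X Y Z : app (mixr A B C) (ten Star (ten Shriek X Y) Z) =
  ten Shriek X (ten Star Y Z).
Proof.
have deg_eq i j l : i + j + l + 0 = i + (j + l) :> int by rewrite addr0 addrA.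
suff: exists h : ghom 0 (gtensor Star (gtensor Shriek A B) C) (gtensor Shriek A (gtensor Star B C)),
    forall i j l (a : A i) (b : B j) (c : C l) (p : i + j + l + 0 = i + (j + l)),
    h _ _ p (gtens Star (gtens Shriek a b) c) = gtens Shriek a (gtens Star b c).
  move=> /the_ghomP spec.
  case: X Y Z => [i a] [j b] [l c]; rewrite -/(el a) -/(el b) -/(el c) !ten_el.
  by rewrite (app_el _ (deg_eq i j l)); congr el; exact: spec.
pose q n l i m := cid (mixr_component n l i m).
pose H N' N (im : bideg N') := cid (gsum_lift (fun nl : bideg N =>
  sval (q (sval nl).1 (sval nl).2 (sval im).1 (sval im).2))).
pose G N N' := cid (gprod_tuple (fun im : bideg N' => sval (H N' N im))).
exists (fun N N' _ => sval (G N N')) => i j l a b c p.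
apply: component_ext => im; rewrite component_gtens -ten_el.
rewrite [LHS](_ : _ = sval (G (i + j + l) (i + (j + l))) (gtens Star (gtens Shriek a b) c) im) //.
case: (G _ _) => /= g ->; case: (H _ _ _) => /= h hE.
rewrite [LHS]hE; case: (q _ _ _ _) => /= r rE.
by apply: (rE _ i j erefl); exact: etrans (eqP (svalP im)) (addrA i j l).
Qed.

End Right.

Lemma mixl_unique A B C d
    (h : ghom d (gtensor Star A (gtensor Shriek B C)) (gtensor Shriek (gtensor Star A B) C)) :
  d = 0 ->
  (forall (X : elt A) (Y : elt B) (Z : elt C),
    app h (ten Star X (ten Shriek Y Z)) = ten Shriek (ten Star X Y) Z) ->
  forall (X : elt A) (Y : elt B) (Z : elt C),
    app (mixl A B C) (ten Star X (ten Shriek Y Z)) = ten Shriek (ten Star X Y) Z.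
Proof.
move=> d0 hE X Y Z; subst d.
have deg_eq i j l : i + (j + l) + 0 = i + j + l :> int by rewrite addr0 addrA.
suff: exists h : ghom 0 (gtensor Star A (gtensor Shriek B C)) (gtensor Shriek (gtensor Star A B) C),
    forall i j l (a : A i) (b : B j) (c : C l) (p : i + (j + l) + 0 = i + j + l),
    h _ _ p (gtens Star a (gtens Shriek b c)) = gtens Shriek (gtens Star a b) c.
  move=> /the_ghomP spec.
  case: X Y Z => [i a] [j b] [l c]; rewrite -/(el a) -/(el b) -/(el c) !ten_el.
  by rewrite (app_el _ (deg_eq i j l)); congr el; exact: spec.
exists h => i j l a b c p; by apply: el_inj; rewrite -app_el -!ten_el; exact: hE.
Qed.

End Mixed.

(** The value of a composite of structural maps at a pure tensor is again a pure
    tensor up to a scalar; these rules collect the scalar. *)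
Section Evaluation.
Variable k : fieldType.
Implicit Types A B C : gspace k.
Local Notation sgn := (sgn k).

Lemma eval1 A (X Y : elt A) : X = Y -> X = tsc 1 Y.
Proof. by move=> ->; rewrite tsc1. Qed.

Lemma eval_comp d e A B C (g : ghom e B C) (f : ghom d A B) X Y Z c c' :
  app f X = tsc c Y -> app g Y = tsc c' Z -> app (gcomp g f) X = tsc (c * c') Z.
Proof. by move=> eY eZ; rewrite app_gcomp eY app_tsc eZ tscA. Qed.

Lemma eval_tmap s d e A A' B B' (f : ghom d A A') (g : ghom e B B') X X' Y Y' c c' :
  app f X = tsc c X' -> app g Y = tsc c' Y' ->
  app (gtmap s f g) (ten s X Y) = tsc (sgn (e * deg X) * (c * c')) (ten s X' Y').
Proof. by move=> eX eY; rewrite app_gtmap eX eY ten_tscl ten_tscr !tscA mulrA. Qed.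

Lemma eval_id A (X : elt A) : app (gid A) X = tsc 1 X.
Proof. by rewrite app_gid tsc1. Qed.

End Evaluation.

Section MixedLeft.
Variable k : fieldType.
Implicit Types A B C : gspace k.

(** The mirror image of [mixr]: the signs of the five flips cancel. *)
Lemma app_mixl A B C (X : elt A) (Y : elt B) (Z : elt C) :
  app (mixl A B C) (ten Star X (ten Shriek Y Z)) = ten Shriek (ten Star X Y) Z.
Proof.
pose h := gcomp (gswap Shriek C (gtensor Star A B))
  (gcomp (gtmap Shriek (gid C) (gswap Star B A))
  (gcomp (mixr C B A)
  (gcomp (gtmap Star (gswap Shriek B C) (gid A)) (gswap Star A (gtensor Shriek B C))))).
apply: (@mixl_unique k A B C _ h) => // {X Y Z} X Y Z.
have e1 := app_gswap Star X (ten Shriek Y Z).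
have e2 := eval_tmap Star (app_gswap Shriek Y Z) (eval_id X).
have e3 := eval1 (app_mixr Z Y X).
have e4 := eval_tmap Shriek (eval_id Z) (app_gswap Star Y X).
have e5 := app_gswap Shriek Z (ten Star X Y).
rewrite [LHS](eval_comp (eval_comp (eval_comp (eval_comp e1 e2) e3) e4) e5) !deg_ten.
rewrite -[RHS]tsc1; congr tsc.
by sign_cases.
Qed.

End MixedLeft.

(** * Duality *)

Section Duality.
Variable k : fieldType.
Implicit Types A B : gspace k.
Local Notation sgn := (sgn k).
Local Notation one := (one k).

Lemma ginvP d A B (f : ghom d A B) : top_iso f ->
  (forall X, app (ginv f) (app f X) = X) /\ (forall Y, app f (app (ginv f) Y) = Y).
Proof.
move=> /the_ghomP[]; rewrite -/(ginv f) => /ghom_eqP gf /ghom_eqP fg.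
split=> X; first by have := gf X; rewrite app_gcomp app_gid.
by have := fg X; rewrite app_gcomp app_gid.
Qed.

(** If no map has the property [P], then [the_ghom P] is zero, and it can only be
    invertible between zero spaces. Thus [vec_p] and [vec_c], when invertible, have
    the values that describe them. *)
Lemma top_iso_the_ghom d A B (P : ghom d A B -> Prop) :
  ((forall i (x : A i), x = 0) -> (forall j (y : B j), y = 0) -> forall h, P h) ->
  top_iso (the_ghom P) -> P (the_ghom P).
Proof.
move=> P0 iso; have [exP|noP] := pselect (exists f, P f); first exact: the_ghomP.
have f0 : the_ghom P = fun i j p => 0 by rewrite /the_ghom; case: pselect.
have [gf fg] := ginvP iso.
have z X : tsc 0 (app (the_ghom P) X) = app (the_ghom P) X.
  by case: X => i x; rewrite -/(el x) (app_el _ erefl) tsc_el scale0r f0.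
apply: P0 => [i x|j y]; apply: el_inj.
  by rewrite -[LHS]gf -z app_tsc gf tsc_el scale0r.
by rewrite -[LHS]fg -z fg tsc_el scale0r.
Qed.

Lemma cf_el n (z : ground k n) : cf (el z) = gcoef z.
Proof. by []. Qed.

Lemma gcoef_scal0 c : gcoef (scal 0 c : ground k 0) = c.
Proof. exact: scalK. Qed.

Lemma cf_dual_map n A (f : gdual A n) Y : cf (app (dual_map f) Y) = hom_fun f (part (- n) Y).
Proof.
suff: exists h : ghom n A (ground k), forall (a : A (- n)) (p : - n + n = 0),
    h _ _ p a = scal 0 (hom_fun f a).
  move=> /the_ghomP spec; have [Yn|Yn] := eqVneq (deg Y) (- n); last first.
    rewrite part0; last exact/eqP.
    rewrite (lin0 (hom_linear _)) cf_deg // deg_app.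
    by apply: contra Yn; rewrite addr_eq0.
  by rewrite -{1}(el_part Yn) (app_el _ (addNr n)) spec cf_el gcoef_scal0.
exists (fun i j p => hom_comp (scal_hom k j) (hom_comp f (degree_hom A i (- n)))) => a p.
by rewrite !hom_compE degree_hom_id.
Qed.

Definition functional A (F : elt (gdual A)) : ghom (deg F) A (ground k) :=
  dual_map (projT2 F).

Arguments functional {A} F.

Lemma functional_separates A (X Y : elt A) : deg X = deg Y ->
  (forall F : elt (gdual A), cf (app (functional F) X) = cf (app (functional F) Y)) -> X = Y.
Proof.
move=> XY e; apply: (@elt_eq _ _ (- - deg X)); [by rewrite opprK|by rewrite opprK|].
apply: functionals_separate => f.
by have := e (@el k (gdual A) (- deg X) f); rewrite !cf_dual_map.
Qed.

(** Evaluation at an element is continuous on the dual because lines are linearly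
    compact. *)
Lemma cf_elt_dual d A (u : ghom d (ground k) A) (F : elt (gdual A)) :
  cf (app (elt_dual u) F) = sgn (deg F * d) * cf (app (functional F) (app u one)).
Proof.
suff: exists h : ghom d (gdual A) (ground k),
    forall n (f : gdual A n) (p : n + d = 0) (q : 0 + d = - n),
    h _ _ p f = scal 0 (sgn (n * d) * hom_fun f (u _ _ q (ground1 k))).
  move=> /the_ghomP spec; case: F => n f; rewrite -/(el f).
  have [p|ne] := eqVneq (n + d) 0; last first.
    by rewrite !cf_deg ?mulr0 ?deg_app // add0r addrC.
  have q : 0 + d = - n by apply/eqP; rewrite add0r -addr_eq0 addrC; exact/eqP.
  rewrite (app_el (elt_dual u) p) cf_el (spec _ f p q) gcoef_scal0 cf_dual_map.
  by rewrite (app_el u q) part_el.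
pose ev n (f : gdual A n) : groundF k := sgn (n * d) * hom_fun f (part (- n) (app u one)).
have evL n : linear (@ev n).
  move=> a f g; rewrite /ev.
  have -> (x : A (- n)) : hom_fun (a *: f + g) x = a * hom_fun f x + hom_fun g x :> k by [].
  by rewrite mulrDr mulrCA.
have evc n (U : subspace (groundF k)) : open U ->
    exists U' : subspace (gdual A n), open U' /\ forall f, U' f -> U (ev n f).
  move=> _; pose L (_ : 'I_1) := line (part (- n) (app u one)).
  have Lc : dual_linbase (A (- n)) (annihilators L).
    by exists 1%N, L; split=> // i; exact: line_compact.
  exists (annihilators L); split.
    rewrite openE => f Lf; exists (annihilators L); split=> // g.
    exact: subspaceD.
  move=> f /(_ ord0 (part (- n) (app u one))) f0.
  by rewrite /ev f0 ?mulr0; [exact: subspace0|exists 1; rewrite ?scale1r].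
exists (fun i j p => hom_comp (scal_hom k j) (@mk_hom k (gdual A i) (groundF k) _ (evL i) (evc i))).
move=> n f p q; rewrite hom_compE -[X in u _ _ q X]/(ground1 k).
by rewrite -(part_el (u _ _ q (ground1 k))) -(app_el u q).
Qed.

Lemma cf_form_dual d A (e : ghom d A (ground k)) Y :
  cf (app (functional (app (form_dual e) one)) Y) = cf (app e Y).
Proof.
suff: exists h : ghom d (ground k) (gdual A),
    forall n (a : A (- n)) (p : 0 + d = n) (q : - n + d = 0),
    scal 0 (hom_fun (h _ _ p (ground1 k) : dual (A (- n))) a) = e _ _ q a.
  move=> /the_ghomP spec.
  rewrite [app (form_dual e) one](app_el _ erefl) cf_dual_map.
  have q : - (0 + d) + d = 0 by rewrite add0r addNr.
  have := spec _ (part (- (0 + d)) Y) erefl q.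
  move=> /(congr1 (@gcoef k _)); rewrite gcoef_scal0 => ->.
  have [Yn|Yn] := eqVneq (deg Y) (- (0 + d)).
    by rewrite -{2}(el_part Yn) (app_el _ q).
  rewrite part0 ?(lin0 (hom_linear _)) ?(lin0 (@gcoef_linear k _)); last exact/eqP.
  by rewrite cf_deg // deg_app; apply: contra Yn; rewrite add0r addr_eq0.
pose form n : gdual A n := hom_comp (gcoef_hom k 0)
  (hom_comp (degree_hom (ground k) (- n + d) 0) (e (- n) (- n + d) erefl)).
have formL i n : linear (fun z : ground k i => gcoef z *: form n).
  by move=> a x y; rewrite (gcoef_linear a x y) scalerDl -scalerA.
have formc i n (U : subspace (gdual A n)) : open U ->
    exists U' : subspace (ground k i), open U' /\ forall z, U' z -> U (gcoef z *: form n).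
  move=> _; exists (subspace00 (ground k i)); split; first exact: discr_open.
  by move=> z ->; rewrite (lin0 (@gcoef_linear k i)) scale0r; exact: subspace0.
exists (fun i j p => @mk_hom k (ground k i) (gdual A j) _ (formL i j) (formc i j)).
move=> n a p q.
have -> : hom_fun (gcoef (ground1 k) *: form n : dual (A (- n))) a = gcoef (e _ _ q a).
  rewrite [gcoef _](cf_one k) scale1r /form !hom_compE.
  congr gcoef; apply: (@el_inj k (ground k)); rewrite el_degree_hom // -(app_el e erefl a).
  exact: app_el.
exact: gcoefK.
Qed.

Lemma cf_vec_p d A (p : ghom d (gtensor Star A A) (ground k)) X Y : top_iso (vec_p p) ->
  cf (app (functional (app (vec_p p) X)) Y) = cf (app p (ten Star X Y)).
Proof.
move=> iso; have : forall i n (a : A i) (b : A (- n)) (q : i + d = n) (r : i + - n + d = 0),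
    scal 0 (hom_fun (vec_p p q a : dual (A (- n))) b) = p _ _ r (gtens Star a b).
  apply: (top_iso_the_ghom _ iso) => A0 _ h i n a b q r.
  rewrite (A0 _ a) (lin0 ((gtens_bilin _ _ _ _ _).1 _)) !(lin0 (hom_linear _)).
  exact: (lin0 (@scal_linear k 0)).
move=> spec; case: X => i a; rewrite -/(el a).
rewrite (app_el _ erefl) cf_dual_map.
have r : i + - (i + d) + d = 0 by lia.
have := spec _ _ a (part (- (i + d)) Y) erefl r.
move=> /(congr1 (@gcoef k _)); rewrite gcoef_scal0 => ->.
have [Yn|Yn] := eqVneq (deg Y) (- (i + d)).
  by rewrite -{2}(el_part Yn) ten_el (app_el _ r).
rewrite part0 ?(lin0 ((gtens_bilin _ _ _ _ _).2 _)) ?(lin0 (hom_linear _)); last exact/eqP.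
rewrite (lin0 (@gcoef_linear k _)) cf_deg // deg_app deg_ten /=.
by apply: contra Yn => /eqP ?; apply/eqP; lia.
Qed.

Definition slice_left A B d (f : ghom d A (ground k)) :=
  gcomp (unitl Shriek B) (gtmap Shriek f (gid B)).
Definition slice_right A B d (f : ghom d B (ground k)) :=
  gcomp (unitr Shriek A) (gtmap Shriek (gid A) f).

Lemma app_vec_c d A (c : ghom d (ground k) (gtensor Shriek A A)) (F : elt (gdual A)) :
  top_iso (vec_c c) ->
  app (vec_c c) F = tsc (sgn (deg F * d)) (app (slice_left A (functional F)) (app c one)).
Proof.
move=> iso; have : forall n j (f : gdual A n) (q : n + d = j)
      (r : 0 + (d + (n + 0) + 0) = j),
    vec_c c q f = sgn (n * d) *:
      (gcomp (unitl Shriek A) (gcomp (gtmap Shriek (dual_map f) (gid A)) c)) _ _ r (ground1 k).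
  apply: (top_iso_the_ghom _ iso) => _ A0 h n j f q r.
  by rewrite [LHS]A0 [RHS]A0.
move=> spec; case: F => n f; rewrite -/(el f) (app_el _ erefl).
have r : 0 + (d + (n + 0) + 0) = n + d by lia.
rewrite (spec _ _ f erefl r) -tsc_el -(app_el _ r) /slice_left.
by congr tsc; rewrite !app_gcomp.
Qed.

End Duality.

Arguments functional {k A} F.

(** * Slices of tensors *)

Section Slices.
Variable k : fieldType.
Implicit Types A B C : gspace k.
Local Notation sgn := (sgn k).
Local Notation one := (one k).

Lemma deg_one : deg one = 0.
Proof. by []. Qed.

Lemma ground_tsc0 (Z : elt (ground k)) : deg Z != 0 -> Z = tsc 0 Z.
Proof. by move=> Z0; apply: cf_eq; rewrite ?deg_tsc // cf_tsc cf_deg ?mulr0. Qed.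

Section OneSlice.
Variables (A B : gspace k) (d : int) (f : ghom d A (ground k)).
Hypothesis Bc : forall i, converging (B i).

Lemma slice_left_ten (X : elt A) (Y : elt B) : deg X + d = 0 ->
  app (slice_left B f) (ten Shriek X Y) = tsc (cf (app f X)) Y.
Proof.
move=> Xd; have e := eval_tmap Shriek (eval1 (erefl (app f X))) (eval_id Y).
have u : app (unitl Shriek B) (ten Shriek (app f X) Y) = tsc (cf (app f X)) Y.
  by apply: app_unitl => //; rewrite deg_app.
rewrite (eval_comp e u); congr tsc; by sign_cases.
Qed.

Lemma slice_left_ten0 (X : elt A) (Y : elt B) : deg X + d != 0 ->
  app (slice_left B f) (ten Shriek X Y) = tsc 0 (app (slice_left B f) (ten Shriek X Y)).
Proof.
move=> Xd; have fX : app f X = tsc 0 (app f X) by apply: ground_tsc0; rewrite deg_app.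
have e := eval_tmap Shriek fX (eval_id Y).
by rewrite (eval_comp e (eval1 erefl)) tscA !(mul0r, mulr0).
Qed.

Lemma slice_right_ten (Y : elt B) (X : elt A) : deg X + d = 0 ->
  app (slice_right B f) (ten Shriek Y X) = tsc (sgn (d * deg Y) * cf (app f X)) Y.
Proof.
move=> Xd; have e := eval_tmap Shriek (eval_id Y) (eval1 (erefl (app f X))).
have u : app (unitr Shriek B) (ten Shriek Y (app f X)) = tsc (cf (app f X)) Y.
  by apply: app_unitr => //; rewrite deg_app.
by rewrite (eval_comp e u) !mulr1.
Qed.

Lemma slice_right_ten0 (Y : elt B) (X : elt A) : deg X + d != 0 ->
  app (slice_right B f) (ten Shriek Y X) = tsc 0 (app (slice_right B f) (ten Shriek Y X)).
Proof.
move=> Xd; have fX : app f X = tsc 0 (app f X) by apply: ground_tsc0; rewrite deg_app.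
have e := eval_tmap Shriek (eval_id Y) fX.
by rewrite (eval_comp e (eval1 erefl)) tscA !(mul0r, mulr0).
Qed.

End OneSlice.

Lemma eq_tsc A (X Y Z : elt A) c c' : X = tsc c Z -> Y = tsc c' Z -> c = c' -> X = Y.
Proof. by move=> -> -> ->. Qed.

(** For pure tensors whose degrees do not match that of a functional: both sides of
    an identity of slices vanish, and only their degrees need comparing. *)
Lemma eq_tsc0 A (X Y X' Y' : elt A) c c' : X = tsc c X' -> Y = tsc c' Y' ->
  c = 0 -> c' = 0 -> deg X = deg Y -> X = Y.
Proof.
move=> EX EY c0 c'0 dXY; rewrite EX EY c0 c'0; apply: tsc0.
by rewrite -(deg_tsc c X') -(deg_tsc c' Y') -EX -EY.
Qed.

Lemma eval_scale A (X Y : elt A) a c : X = tsc c Y -> tsc a X = tsc (a * c) Y.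
Proof. by move=> ->; rewrite tscA. Qed.

Section SliceCalculus.
Variables (A B : gspace k).
Hypotheses (Ac : forall i, converging (A i)) (Bc : forall i, converging (B i)).

Lemma slice_right_swap d (f : ghom d A (ground k)) T :
  app (slice_right B f) (app (gswap Shriek A B) T) = app (slice_left B f) T.
Proof.
rewrite -app_gcomp; apply: app_ext => X Y.
have e := app_gswap Shriek X Y.
have [Xd|Xd] := eqVneq (deg X + d) 0.
  apply: (eq_tsc (eval_comp e (slice_right_ten f Bc Y Xd)) (slice_left_ten f Bc Y Xd)).
  rewrite mulrA; have -> : deg X = - d by lia.
  by sign_cases.
apply: (eq_tsc0 (eval_comp e (slice_right_ten0 f Y Xd)) (slice_left_ten0 f Y Xd)).
- exact: mulr0.
- by [].
- by rewrite !(deg_tsc, deg_app, deg_ten); lia.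
Qed.

Lemma slice_left_swap d (f : ghom d A (ground k)) T :
  app (slice_left B f) (app (gswap Shriek B A) T) = app (slice_right B f) T.
Proof.
rewrite -app_gcomp; apply: app_ext => Y X.
have e := app_gswap Shriek Y X.
have [Xd|Xd] := eqVneq (deg X + d) 0.
  apply: (eq_tsc (eval_comp e (slice_left_ten f Bc Y Xd)) (slice_right_ten f Bc Y Xd)).
  congr (_ * _); have -> : deg X = - d by lia.
  by sign_cases.
apply: (eq_tsc0 (eval_comp e (slice_left_ten0 f Y Xd)) (slice_right_ten0 f Y Xd)).
- exact: mulr0.
- by [].
- by rewrite !(deg_tsc, deg_app, deg_ten); lia.
Qed.

(** Fubini for the two slices. *)
Lemma slice_slice d e (f : ghom d A (ground k)) (g : ghom e B (ground k)) T :
  app g (app (slice_left B f) T) = tsc (sgn (d * e)) (app f (app (slice_right A g) T)).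
Proof.
have -> : app f (app (slice_right A g) T) = app (gcomp f (slice_right A g)) T by rewrite app_gcomp.
rewrite -app_gcomp -app_gscale; apply: app_ext => X Y; rewrite app_gscale.
have [Xd|Xd] := eqVneq (deg X + d) 0; have [Ye|Ye] := eqVneq (deg Y + e) 0.
- have gY : app g Y = tsc (cf (app g Y)) one by apply: ground_tsc; rewrite deg_app.
  have fX : app f X = tsc (cf (app f X)) one by apply: ground_tsc; rewrite deg_app.
  rewrite (eval_comp (slice_left_ten f Bc Y Xd) gY) (eval_comp (slice_right_ten g Ac X Ye) fX).
  rewrite tscA; congr tsc; rewrite mulrCA [in RHS]mulrCA !mulrA.
  rewrite [cf (app f X) * _]mulrC; congr (_ * _).
  have -> : deg X = - d by lia.
  by rewrite -[LHS]mul1r; congr (_ * _); sign_cases.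
- have gY : app g Y = tsc 0 (app g Y) by apply: ground_tsc0; rewrite deg_app.
  apply: (eq_tsc0 (eval_comp (slice_left_ten f Bc Y Xd) gY)
    (eval_scale _ (eval_comp (slice_right_ten0 g X Ye) (eval1 erefl)))).
  + exact: mulr0.
  + by rewrite mul0r mulr0.
  + by rewrite !(deg_tsc, deg_app, deg_ten); lia.
- have fX : app f X = tsc 0 (app f X) by apply: ground_tsc0; rewrite deg_app.
  apply: (eq_tsc0 (eval_comp (slice_left_ten0 f Y Xd) (eval1 erefl))
    (eval_scale _ (eval_comp (slice_right_ten g Ac X Ye) fX))).
  + exact: mul0r.
  + by rewrite !mulr0.
  + by rewrite !(deg_tsc, deg_app, deg_ten); lia.
- apply: (eq_tsc0 (eval_comp (slice_left_ten0 f Y Xd) (eval1 erefl))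
    (eval_scale _ (eval_comp (slice_right_ten0 g X Ye) (eval1 erefl)))).
  + exact: mul0r.
  + by rewrite mul0r mulr0.
  + by rewrite !(deg_tsc, deg_app, deg_ten); lia.
Qed.

End SliceCalculus.

Section SlicesAndProducts.
Variables (A B C D : gspace k).
Hypotheses (Ac : forall i, converging (A i)) (Bc : forall i, converging (B i)).
Hypotheses (Cc : forall i, converging (C i)) (Dc : forall i, converging (D i)).

(** This turns the formulas for [la] in terms of the copairing into
    [L f (la a) = mu (L f c, a)] and its mirror image. *)
Lemma slice_left_product d dm (f : ghom d A (ground k)) (mu : ghom dm (gtensor Star B C) D)
    T (Z : elt C) :
  app (slice_left D f)
    (app (gtmap Shriek (gid A) mu) (app (mixr A B C) (ten Star T Z))) =
  tsc (sgn (dm * d)) (app mu (ten Star (app (slice_left B f) T) Z)).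
Proof.
pose F := gcomp (slice_left D f) (gcomp (gtmap Shriek (gid A) mu)
  (gcomp (mixr A B C) (@ten_right k (gtensor Shriek A B) C Z))).
pose G := gscale (sgn (dm * d)) (gcomp mu (gcomp (@ten_right k B C Z) (slice_left B f))).
suff: app F T = app G T.
  by rewrite /F /G app_gscale !app_gcomp !app_ten_right.
apply: app_ext => X Y; rewrite /F /G app_gscale.
have e1 := eval1 (app_ten_right (ten Shriek X Y) Z).
have e2 := eval1 (app_mixr X Y Z).
have e3 := eval_tmap Shriek (eval_id X) (eval1 (erefl (app mu (ten Star Y Z)))).
have e1' (U : elt B) := eval1 (app_ten_right U Z).
have e2' U := eval1 (erefl (app mu (ten Star U Z))).
have [Xd|Xd] := eqVneq (deg X + d) 0.
  apply: (eq_tsc (eval_comp (eval_comp (eval_comp e1 e2) e3) (slice_left_ten f Dc _ Xd))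
    (eval_scale _ (eval_comp (eval_comp (slice_left_ten f Bc Y Xd) (e1' Y)) (e2' Y)))).
  have -> : deg X = - d by lia.
  rewrite !(mul1r, mulr1); congr (_ * _).
  by sign_cases.
apply: (eq_tsc0 (eval_comp (eval_comp (eval_comp e1 e2) e3) (slice_left_ten0 f _ Xd))
    (eval_scale _ (eval_comp (eval_comp (slice_left_ten0 f Y Xd) (e1' _)) (e2' _)))).
- exact: mulr0.
- by rewrite !mul0r mulr0.
- by rewrite !(deg_tsc, deg_app, deg_ten); lia.
Qed.

Lemma slice_right_product d dm (f : ghom d C (ground k)) (mu : ghom dm (gtensor Star A B) D)
    T (Z : elt A) :
  app (slice_right D f)
    (app (gtmap Shriek mu (gid C)) (app (mixl A B C) (ten Star Z T))) =
  tsc (sgn (d * (deg Z + dm))) (app mu (ten Star Z (app (slice_right B f) T))).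
Proof.
pose F := gcomp (slice_right D f) (gcomp (gtmap Shriek mu (gid C))
  (gcomp (mixl A B C) (@ten_left k A (gtensor Shriek B C) Z))).
pose G := gscale (sgn (d * (deg Z + dm))) (gcomp mu (gcomp (@ten_left k A B Z) (slice_right B f))).
suff: app F T = app G T.
  by rewrite /F /G app_gscale !app_gcomp !app_ten_left.
apply: app_ext => X Y; rewrite /F /G app_gscale.
have e1 := eval1 (app_ten_left Z (ten Shriek X Y)).
have e2 := eval1 (app_mixl Z X Y).
have e3 := eval_tmap Shriek (eval1 (erefl (app mu (ten Star Z X)))) (eval_id Y).
have e1' (U : elt B) := eval1 (app_ten_left Z U).
have e2' U := eval1 (erefl (app mu (ten Star Z U))).
have [Yd|Yd] := eqVneq (deg Y + d) 0.
  apply: (eq_tsc (eval_comp (eval_comp (eval_comp e1 e2) e3) (slice_right_ten f Dc _ Yd))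
    (eval_scale _ (eval_comp (eval_comp (slice_right_ten f Bc X Yd) (e1' X)) (e2' X)))).
  rewrite !(mul1r, mulr1) !mulrA deg_app deg_ten; congr (_ * _).
  by sign_cases.
apply: (eq_tsc0 (eval_comp (eval_comp (eval_comp e1 e2) e3) (slice_right_ten0 f _ Yd))
    (eval_scale _ (eval_comp (eval_comp (slice_right_ten0 f X Yd) (e1' _)) (e2' _)))).
- exact: mulr0.
- by rewrite !mul0r mulr0.
- by rewrite !(deg_tsc, deg_app, deg_ten); lia.
Qed.

(** This turns the pairing relations into [mu (x, b) = L f_x (la b)] and its mirror
    image, for [f_x = p (x, -)]. *)
Lemma slice_left_pairing dp dg (p : ghom dp (gtensor Star A B) (ground k))
    (g : ghom dg B (ground k)) T (Z : elt A) a :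
  dg = deg Z + dp -> (forall Y, cf (app p (ten Star Z Y)) = a * cf (app g Y)) ->
  app (slice_left C p) (app (mixl A B C) (ten Star Z T)) = tsc a (app (slice_left C g) T).
Proof.
move=> dgE pg.
pose F := gcomp (slice_left C p) (gcomp (mixl A B C) (@ten_left k A (gtensor Shriek B C) Z)).
pose G := gscale a (slice_left C g).
suff: app F T = app G T by rewrite /F /G app_gscale !app_gcomp app_ten_left.
apply: app_ext => X Y; rewrite /F /G app_gscale.
have e1 := eval1 (app_ten_left Z (ten Shriek X Y)).
have e2 := eval1 (app_mixl Z X Y).
have [Xd|Xd] := eqVneq (deg X + dg) 0.
  have pd : deg (ten Star Z X) + dp = 0 by rewrite deg_ten; lia.
  apply: (eq_tsc (eval_comp (eval_comp e1 e2) (slice_left_ten p Cc Y pd))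
    (eval_scale _ (slice_left_ten g Cc Y Xd))).
  by rewrite !mul1r pg.
have pd : deg (ten Star Z X) + dp != 0.
  by rewrite deg_ten; apply: contra Xd => /eqP ?; apply/eqP; lia.
apply: (eq_tsc0 (eval_comp (eval_comp e1 e2) (slice_left_ten0 p Y pd))
  (eval_scale _ (slice_left_ten0 g Y Xd))).
- exact: mulr0.
- exact: mulr0.
- by rewrite !(deg_tsc, deg_app, deg_ten); lia.
Qed.

Lemma slice_right_pairing dp dg (p : ghom dp (gtensor Star B C) (ground k))
    (g : ghom dg B (ground k)) (T : elt (gtensor Shriek A B)) (Z : elt C) a :
  dg = deg Z + dp ->
  (forall Y : elt B, deg Y + dg = 0 -> cf (app p (ten Star Y Z)) = a * cf (app g Y)) ->
  app (slice_right A p) (app (mixr A B C) (ten Star T Z)) =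
  tsc (a * sgn (deg Z * (deg T + dg))) (app (slice_right A g) T).
Proof.
move=> dgE pg.
pose F := gcomp (slice_right A p) (gcomp (mixr A B C) (@ten_right k (gtensor Shriek A B) C Z)).
pose G := gscale (a * sgn (deg Z * (deg T + dg))) (slice_right A g).
suff: app F T = app G T by rewrite /F /G app_gscale !app_gcomp app_ten_right.
apply: (app_ext_deg (n := deg T)) => [|X Y XY|//]; first by lia.
rewrite /F /G app_gscale.
have e1 := eval1 (app_ten_right (ten Shriek X Y) Z).
have e2 := eval1 (app_mixr X Y Z).
have [Yd|Yd] := eqVneq (deg Y + dg) 0.
  have pd : deg (ten Star Y Z) + dp = 0 by rewrite deg_ten; lia.
  apply: (eq_tsc (eval_comp (eval_comp e1 e2) (slice_right_ten p Ac X pd))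
    (eval_scale _ (slice_right_ten g Ac X Yd))).
  rewrite !mul1r pg //; move: (cf (app g Y)) => v; have -> : deg T + dg = deg X by lia.
  rewrite dgE mulrCA -mulrA; congr (_ * _); rewrite mulrA; congr (_ * _).
  by sign_cases.
have pd : deg (ten Star Y Z) + dp != 0.
  by rewrite deg_ten; apply: contra Yd => /eqP ?; apply/eqP; lia.
apply: (eq_tsc0 (eval_comp (eval_comp e1 e2) (slice_right_ten0 p X pd))
  (eval_scale _ (slice_right_ten0 g X Yd))).
- exact: mulr0.
- exact: mulr0.
- by rewrite !(deg_tsc, deg_app, deg_ten); lia.
Qed.

End SlicesAndProducts.

Section Separation.
Variables (A B : gspace k).
Hypothesis Bc : forall i, converging (B i).

(** The components of a tensor are slices by functionals supported in one degree. *)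
Lemma component_slice n (ij : bideg n) (f : hom (A (sval ij).1) (groundF k)) :
  exists (F : elt (gdual A))
    (h : hom (ctensor Shriek (A (sval ij).1) (B (sval ij).2)) (B (sval ij).2)),
    (forall v w, h (ctens Shriek v w) = (f v : k) *: w) /\
    forall z, h (component Shriek A B ij z) =
      part (sval ij).2 (app (slice_left B (functional F)) (el z)).
Proof.
set i := (sval ij).1 in f *; set j := (sval ij).2.
have [m mE] := scale_left_lift (@Bc j).
pose h := hom_comp m (ctmap Shriek (hom_comp (scal_hom k 0) f) (hom_id (B j))).
have hE v w : h (ctens Shriek v w) = (f v : k) *: w.
  by rewrite /h hom_compE ctmapE mE hom_compE gcoef_scal0.
pose F : elt (gdual A) := @el k (gdual A) (- i) (hom_comp f (degree_hom A (- - i) i)).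
have Fcf v (a : A v) : cf (app (functional F) (el a)) = f (part i (el a)).
  by rewrite cf_dual_map hom_compE part_degree ?opprK.
have p : n + (- i + 0 + 0) = j.
  by have := eqP (svalP ij); rewrite -/i -/j => ijn; lia.
exists F, h; split=> // z; rewrite (app_el _ p) part_el; move: z.
apply: (gtensor_ext (h := hom_comp h (component Shriek A B ij))) => u v e a b; subst n.
rewrite hom_compE -[RHS]part_el -(app_el _ p) -ten_el.
have -> : component Shriek A B ij (gtens Shriek a b) =
    ctens Shriek (part i (@el k A u a)) (part j (@el k B v b)).
  exact: component_gtens.
rewrite hE; have [d0|d0] := eqVneq (deg (el a) + deg F) 0.
  by rewrite slice_left_ten // part_tsc Fcf.
rewrite slice_left_ten0 // part_tsc scale0r [part i _]part0 => [|/= ui].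
  by rewrite [X in X *: _](lin0 (hom_linear f)) scale0r.
by rewrite /= ui subrr eqxx in d0.
Qed.

Lemma slice_left_separates (T T' : elt (gtensor Shriek A B)) : deg T = deg T' ->
  (forall F : elt (gdual A),
     app (slice_left B (functional F)) T = app (slice_left B (functional F)) T') -> T = T'.
Proof.
case: T T' => [n x] [n' y] /= nn'; subst n'; rewrite -/(el x) -/(el y) => exy; congr el.
apply: component_ext => ij.
apply/eqP; rewrite -subr_eq0 -(linB (hom_linear _)); apply/eqP.
apply: ctensor_separated => f.
have [F [h [hE hS]]] := component_slice f; exists h; split=> //.
by rewrite !(linB (hom_linear _)) !hS exy subrr.
Qed.

(** The symmetry exchanges the two kinds of slices. *)
Lemma slice_right_separates (T T' : elt (gtensor Shriek B A)) : deg T = deg T' ->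
  (forall F : elt (gdual A),
     app (slice_right B (functional F)) T = app (slice_right B (functional F)) T') -> T = T'.
Proof.
move=> dT eT.
have swapK (U : elt (gtensor Shriek B A)) :
    app (gswap Shriek A B) (app (gswap Shriek B A) U) = U.
  rewrite -app_gcomp -[RHS]app_gid; apply: app_ext => X Y.
  rewrite (eval_comp (app_gswap Shriek X Y) (app_gswap Shriek Y X)) app_gid.
  by rewrite -[RHS]tsc1; congr tsc; sign_cases.
rewrite -[T]swapK -[T']swapK; congr (app _ _); apply: slice_left_separates.
  by rewrite !deg_app dT.
by move=> F; rewrite !slice_left_swap.
Qed.

End Separation.
End Slices.

(** * The relations of a bialgebra on elements *)

Section Relations.
Variable k : fieldType.
Local Notation sgn := (sgn k).
Local Notation one := (one k).
Variables (A : gspace k) (dm dl : int).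
Variables (mu : ghom dm (gtensor Star A A) A) (la : ghom dl A (gtensor Shriek A A)).
Local Notation id := (gid A).
Local Notation prod X Y := (app mu (ten Star X Y)).

Section Unit.
Variables (du : int) (eta : ghom du (ground k) A).

Lemma left_unitE :
  ghom_eq (gscale (sgn dm) (gcomp (gcomp mu (gtmap Star eta id)) (unitl_inv Star A))) id <->
  forall X, tsc (sgn dm) (prod (app eta one) X) = X.
Proof.
suff E X : app (gscale (sgn dm) (gcomp (gcomp mu (gtmap Star eta id)) (unitl_inv Star A))) X =
    tsc (sgn dm) (prod (app eta one) X).
  by rewrite ghom_eqP; split=> h X; have := h X; rewrite E app_gid.
have e1 := eval1 (app_unitl_inv X).
have e2 := eval_tmap Star (eval1 (erefl (app eta one))) (eval_id X).
rewrite app_gscale (eval_comp e1 (eval_comp e2 (eval1 erefl))) tscA; congr tsc.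
by sign_cases.
Qed.

Lemma right_unitE :
  ghom_eq (gcomp (gcomp mu (gtmap Star id eta)) (unitr_inv Star A)) id <->
  forall X, tsc (sgn (du * deg X)) (prod X (app eta one)) = X.
Proof.
suff E X : app (gcomp (gcomp mu (gtmap Star id eta)) (unitr_inv Star A)) X =
    tsc (sgn (du * deg X)) (prod X (app eta one)).
  by rewrite ghom_eqP; split=> h X; have := h X; rewrite E app_gid.
have e1 := eval1 (app_unitr_inv X).
have e2 := eval_tmap Star (eval_id X) (eval1 (erefl (app eta one))).
rewrite (eval_comp e1 (eval_comp e2 (eval1 erefl))); congr tsc.
by rewrite !(mul1r, mulr1).
Qed.

End Unit.

Section Counit.
Variables (de : int) (eps : ghom de A (ground k)).

Lemma left_counitE :
  ghom_eq (gcomp (gcomp (unitl Shriek A) (gtmap Shriek eps id)) la) id <->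
  forall X, app (slice_left A eps) (app la X) = X.
Proof.
by rewrite ghom_eqP; split=> h X; have := h X; rewrite app_gcomp app_gid.
Qed.

Lemma right_counitE :
  ghom_eq (gscale (sgn dl) (gcomp (gcomp (unitr Shriek A) (gtmap Shriek id eps)) la)) id <->
  forall X, tsc (sgn dl) (app (slice_right A eps) (app la X)) = X.
Proof.
by rewrite ghom_eqP; split=> h X; have := h X; rewrite app_gscale app_gcomp app_gid.
Qed.

End Counit.

Section Copairing.
Variables (dc : int) (c : ghom dc (ground k) (gtensor Shriek A A)).

Lemma left_copairingE :
  ghom_eq la (gcomp (gcomp (gcomp (gtmap Shriek id mu) (mixr A A A)) (gtmap Star c id))
    (unitl_inv Star A)) <->
  forall X, app la X =
    app (gtmap Shriek id mu) (app (mixr A A A) (ten Star (app c one) X)).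
Proof.
suff E X : app (gcomp (gcomp (gcomp (gtmap Shriek id mu) (mixr A A A)) (gtmap Star c id))
    (unitl_inv Star A)) X =
    app (gtmap Shriek id mu) (app (mixr A A A) (ten Star (app c one) X)).
  by rewrite ghom_eqP; split=> h X; rewrite (h X) E.
have e1 := eval1 (app_unitl_inv X).
have e2 := eval_tmap Star (eval1 (erefl (app c one))) (eval_id X).
rewrite (eval_comp e1 (eval_comp e2 (eval1 (app_gcomp _ _ _)))) -[RHS]tsc1; congr tsc.
by sign_cases.
Qed.

Lemma right_copairingE :
  ghom_eq la (gscale (sgn dm)
    (gcomp (gcomp (gcomp (gtmap Shriek mu id) (mixl A A A)) (gtmap Star id c))
      (unitr_inv Star A))) <->
  forall X, app la X = tsc (sgn (dm + dc * deg X))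
    (app (gtmap Shriek mu id) (app (mixl A A A) (ten Star X (app c one)))).
Proof.
suff E X : app (gscale (sgn dm)
    (gcomp (gcomp (gcomp (gtmap Shriek mu id) (mixl A A A)) (gtmap Star id c))
      (unitr_inv Star A))) X = tsc (sgn (dm + dc * deg X))
    (app (gtmap Shriek mu id) (app (mixl A A A) (ten Star X (app c one)))).
  by rewrite ghom_eqP; split=> h X; rewrite (h X) E.
have e1 := eval1 (app_unitr_inv X).
have e2 := eval_tmap Star (eval_id X) (eval1 (erefl (app c one))).
rewrite app_gscale (eval_comp e1 (eval_comp e2 (eval1 (app_gcomp _ _ _)))) tscA; congr tsc.
by sign_cases.
Qed.

Lemma copairing_symmetryE :
  ghom_eq (gcomp (gswap Shriek A A) c) (gscale (sgn dl) c) <->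
  app (gswap Shriek A A) (app c one) = tsc (sgn dl) (app c one).
Proof.
rewrite ghom_eqP; split=> [h|h Z]; first by have := h one; rewrite app_gcomp app_gscale.
rewrite app_gcomp app_gscale; have [Z0|Z0] := eqVneq (deg Z) 0.
  by rewrite (ground_tsc Z0) !app_tsc h !tscA mulrC.
rewrite (ground_tsc0 Z0) !app_tsc !tscA mulr0; apply: tsc0.
by rewrite deg_app addr0.
Qed.

End Copairing.

Section Pairing.
Variables (dp : int) (p : ghom dp (gtensor Star A A) (ground k)).

Lemma left_pairingE :
  ghom_eq mu (gscale (sgn (dm * dl + dl))
    (gcomp (gcomp (gcomp (unitl Shriek A) (gtmap Shriek p id)) (mixl A A A)) (gtmap Star id la))) <->
  forall X Y, prod X Y = tsc (sgn (dm * dl + dl + dl * deg X))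
    (app (slice_left A p) (app (mixl A A A) (ten Star X (app la Y)))).
Proof.
suff E X Y : app (gscale (sgn (dm * dl + dl))
    (gcomp (gcomp (gcomp (unitl Shriek A) (gtmap Shriek p id)) (mixl A A A)) (gtmap Star id la)))
    (ten Star X Y) = tsc (sgn (dm * dl + dl + dl * deg X))
    (app (slice_left A p) (app (mixl A A A) (ten Star X (app la Y)))).
  rewrite ghom_eqP; split=> h; first by move=> X Y; rewrite h E.
  by apply: app_ext => X Y; rewrite h E.
have e := eval_tmap Star (eval_id X) (eval1 (erefl (app la Y))).
rewrite app_gscale (eval_comp e (eval1 (app_gcomp _ _ _))) tscA; congr tsc.
by sign_cases.
Qed.

Lemma right_pairingE :
  ghom_eq mu (gscale (sgn (dm * dl))
    (gcomp (gcomp (gcomp (unitr Shriek A) (gtmap Shriek id p)) (mixr A A A)) (gtmap Star la id))) <->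
  forall X Y, prod X Y = tsc (sgn (dm * dl))
    (app (slice_right A p) (app (mixr A A A) (ten Star (app la X) Y))).
Proof.
suff E X Y : app (gscale (sgn (dm * dl))
    (gcomp (gcomp (gcomp (unitr Shriek A) (gtmap Shriek id p)) (mixr A A A)) (gtmap Star la id)))
    (ten Star X Y) = tsc (sgn (dm * dl))
    (app (slice_right A p) (app (mixr A A A) (ten Star (app la X) Y))).
  rewrite ghom_eqP; split=> h; first by move=> X Y; rewrite h E.
  by apply: app_ext => X Y; rewrite h E.
have e := eval_tmap Star (eval1 (erefl (app la X))) (eval_id Y).
rewrite app_gscale (eval_comp e (eval1 (app_gcomp _ _ _))) tscA; congr tsc.
by sign_cases.
Qed.

Lemma pairing_symmetryE :
  ghom_eq (gcomp p (gswap Star A A)) (gscale (sgn dm) p) <->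
  forall X Y, app p (ten Star Y X) = tsc (sgn (dm + deg X * deg Y)) (app p (ten Star X Y)).
Proof.
have E X Y := eval_comp (app_gswap Star X Y) (eval1 (erefl (app p (ten Star Y X)))).
rewrite ghom_eqP; split=> h.
  move=> X Y; have := h (ten Star X Y); rewrite E app_gscale mulr1.
  move=> /(congr1 (tsc (sgn (deg X * deg Y)))); rewrite !tscA => e.
  rewrite -[LHS]tsc1; apply: etrans (etrans e _); congr tsc.
    by sign_cases.
  by sign_cases.
apply: app_ext => X Y; rewrite E app_gscale h tscA; congr tsc.
by sign_cases.
Qed.

End Pairing.
End Relations.

(** * From one unit to two *)

Section Core.
Variable k : fieldType.
Local Notation sgn := (sgn k).
Local Notation one := (one k).
Variables (A : gspace k) (dm dl : int).
Variables (mu : ghom dm (gtensor Star A A) A) (la : ghom dl A (gtensor Shriek A A)).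
Hypothesis Ac : forall i, converging (A i).
Local Notation id := (gid A).
Local Notation prod X Y := (app mu (ten Star X Y)).

Lemma sgn_mul m n : sgn m * sgn n = sgn (m + n).
Proof. by sign_cases. Qed.

Lemma sgn_sq n : sgn n * sgn n = 1.
Proof. by sign_cases. Qed.

Lemma tsc_sgnK B n : involutive (@tsc k B (sgn n)).
Proof. by move=> X; rewrite tscA sgn_sq tsc1. Qed.

Section FromUnit.
Variables (du de : int) (eta : ghom du (ground k) A) (eps : ghom de A (ground k)).
Let c := copairing dm la eta.
Let c1 := app c one.
Let e1 := app eta one.
Let p := pairing dl mu eps.
Let s0 := sgn (dm * dl + dl + dm).

Hypothesis left_unit : forall X, tsc (sgn dm) (prod e1 X) = X.
Hypothesis right_unit : forall X, tsc (sgn (du * deg X)) (prod X e1) = X.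
Hypothesis left_copairing : forall X, app la X =
  app (gtmap Shriek id mu) (app (mixr A A A) (ten Star c1 X)).
Hypothesis right_copairing : forall X, app la X = tsc (sgn (dm + (du + dl) * deg X))
  (app (gtmap Shriek mu id) (app (mixl A A A) (ten Star X c1))).
Hypothesis c_symmetric : app (gswap Shriek A A) c1 = tsc (sgn dl) c1.
Hypothesis duE : du = - dm.
Hypothesis deE : de = - dl.
Hypothesis c_surjective : forall X, exists F : elt (gdual A),
  X = tsc (sgn (deg F * (du + dl))) (app (slice_left A (functional F)) c1).
Hypothesis epsE : forall F : elt (gdual A),
  cf (app eps (tsc (sgn (deg F * (du + dl))) (app (slice_left A (functional F)) c1))) =
  s0 * sgn (deg F * du) * cf (app (functional F) e1).

(** The symmetry of the copairing identifies its two slices. *)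
Let slice_right_c d (f : ghom d A (ground k)) :
  app (slice_right A f) c1 = tsc (sgn dl) (app (slice_left A f) c1).
Proof.
rewrite -(slice_right_swap Ac f) c_symmetric app_tsc.
by rewrite tsc_sgnK.
Qed.

Let slice_left_la d (f : ghom d A (ground k)) X :
  app (slice_left A f) (app la X) = tsc (sgn (dm * d)) (prod (app (slice_left A f) c1) X).
Proof. by rewrite left_copairing slice_left_product. Qed.

Let slice_right_la d (f : ghom d A (ground k)) X :
  app (slice_right A f) (app la X) =
  tsc (sgn (dm + (du + dl) * deg X + d * (deg X + dm))) (prod X (app (slice_right A f) c1)).
Proof.
by rewrite right_copairing app_tsc slice_right_product // tscA sgn_mul.
Qed.

(** The definition of [eps], tested against all functionals. *)
Let slice_eps_c : app (slice_right A eps) c1 = tsc s0 e1.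
Proof.
apply: functional_separates.
  by rewrite !(deg_tsc, deg_app); lia.
move=> F; set f := functional F; apply: (@mulfI _ (sgn (deg F * du))).
  by rewrite sgnE signr_eq0.
have := epsE F; rewrite app_tsc cf_tsc (slice_slice Ac Ac) cf_tsc mulrA sgn_mul.
rewrite [X in X * _](_ : _ = sgn (deg F * du)) => [->|].
  by rewrite app_tsc cf_tsc mulrA [X in X * _]mulrC.
by rewrite deE; sign_cases.
Qed.

Let unit_prod X : prod e1 X = tsc (sgn dm) X.
Proof. exact: canRL (@tsc_sgnK A _) (left_unit X). Qed.

Let prod_unit X : prod X e1 = tsc (sgn (du * deg X)) X.
Proof. exact: canRL (@tsc_sgnK A _) (right_unit X). Qed.

Lemma left_counit_of_unit X : app (slice_left A eps) (app la X) = X.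
Proof.
have epsc : app (slice_left A eps) c1 = tsc (sgn dl) (app (slice_right A eps) c1).
  by rewrite slice_right_c tsc_sgnK.
rewrite slice_left_la epsc slice_eps_c !ten_tscl !app_tsc unit_prod !tscA.
rewrite -[RHS]tsc1; congr tsc; rewrite /s0 deE.
by sign_cases.
Qed.

Lemma right_counit_of_unit X : tsc (sgn dl) (app (slice_right A eps) (app la X)) = X.
Proof.
rewrite slice_right_la slice_eps_c ten_tscr !app_tsc prod_unit !tscA.
rewrite -[RHS]tsc1; congr tsc; rewrite /s0 deE duE.
by sign_cases.
Qed.

Let pE T : app p T = tsc (sgn dl) (app eps (app mu T)).
Proof. by rewrite /p /pairing app_gscale app_gcomp. Qed.

(** So [vec_p p] is inverse to [vec_c c]: apply [eps] to the formula for [la] in terms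
    of [c], exchange the slices and use the counit relation. *)
Let p_left (F : elt (gdual A)) X :
  app p (ten Star (tsc (sgn (deg F * (du + dl))) (app (slice_left A (functional F)) c1)) X) =
  app (functional F) X.
Proof.
rewrite pE ten_tscl app_tsc; set f := functional F.
have -> : prod (app (slice_left A f) c1) X =
    tsc (sgn (dm * deg F)) (app (slice_left A f) (app la X)).
  by rewrite slice_left_la tsc_sgnK.
rewrite !app_tsc (slice_slice Ac Ac) -[app (slice_right A eps) _](tsc_sgnK dl).
rewrite right_counit_of_unit app_tsc !tscA -[RHS]tsc1; congr tsc; rewrite duE deE.
by sign_cases.
Qed.

Let p_right (F : elt (gdual A)) X :
  app p (ten Star X (tsc (sgn (deg F * (du + dl))) (app (slice_left A (functional F)) c1))) =
  tsc (sgn (dm + (dl + dm) * deg X + deg F * deg X)) (app (functional F) X).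
Proof.
rewrite pE; set f := functional F.
have -> : app (slice_left A f) c1 = tsc (sgn dl) (app (slice_right A f) c1).
  by rewrite slice_right_c tsc_sgnK.
rewrite !ten_tscr !app_tsc.
have -> : prod X (app (slice_right A f) c1) =
    tsc (sgn (dm + (du + dl) * deg X + deg F * (deg X + dm))) (app (slice_right A f) (app la X)).
  by rewrite slice_right_la tsc_sgnK.
have -> : app f X = tsc (sgn (de * deg F)) (app eps (app (slice_right A f) (app la X))).
  by rewrite -(slice_slice Ac Ac) left_counit_of_unit.
rewrite !app_tsc !tscA; congr tsc; rewrite duE deE.
by sign_cases.
Qed.

Let tsc_ground a b (Z : elt (ground k)) : (deg Z = 0 -> a = b) -> tsc a Z = tsc b Z.
Proof.
move=> ab; have [/ab -> //|Z0] := eqVneq (deg Z) 0.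
by rewrite (ground_tsc0 Z0) !tscA !mulr0.
Qed.

Lemma left_pairing_of_unit X Y : prod X Y = tsc (sgn (dm * dl + dl + dl * deg X))
  (app (slice_left A p) (app (mixl A A A) (ten Star X (app la Y)))).
Proof.
have [F XF] := c_surjective X.
have dF : deg F = deg X + (dm + de).
  by rewrite XF !(deg_tsc, deg_app) deg_one; lia.
rewrite (@slice_left_pairing _ A A A Ac _ _ p (functional F) _ X 1 dF) => [|V]; last first.
  by rewrite XF p_left mul1r.
rewrite tsc1 slice_left_la tscA {1}XF ten_tscl app_tsc; congr tsc.
have -> : deg X = deg F - dm + dl by lia.
by rewrite duE; sign_cases.
Qed.

Lemma right_pairing_of_unit X Y : prod X Y = tsc (sgn (dm * dl))
  (app (slice_right A p) (app (mixr A A A) (ten Star (app la X) Y))).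
Proof.
have [F YF] := c_surjective Y.
have dF : deg F = deg Y + (dm + de).
  by rewrite YF !(deg_tsc, deg_app) deg_one; lia.
(* The sign of [p_right] at elements of degree [- deg F]. *)
pose a := sgn (dm + (dl + dm) * deg F + deg F).
rewrite (@slice_right_pairing _ A A A Ac _ _ p (functional F) _ Y a dF) => [|V VF]; last first.
  rewrite YF p_right cf_tsc; congr (_ * _); rewrite /a.
  have -> : deg V = - deg F by lia.
  by sign_cases.
rewrite slice_right_la slice_right_c ten_tscr app_tsc !tscA {1}YF ten_tscr app_tsc; congr tsc.
rewrite /a deg_app; have -> : deg Y = deg F - dm + dl by lia.
by rewrite duE; sign_cases.
Qed.

Lemma pairing_symmetry_of_unit X Y :
  app p (ten Star Y X) = tsc (sgn (dm + deg X * deg Y)) (app p (ten Star X Y)).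
Proof.
have [F XF] := c_surjective X.
rewrite {1}XF p_right {2}XF p_left; apply: tsc_ground; rewrite deg_app => YF.
have dF : deg F = deg X + (dm + de).
  by rewrite XF !(deg_tsc, deg_app) deg_one; lia.
have -> : deg X = deg F - dm + dl by lia.
have -> : deg Y = - deg F by lia.
by sign_cases.
Qed.

End FromUnit.
Section FromCounit.
Variables (du de : int) (eta : ghom du (ground k) A) (eps : ghom de A (ground k)).
Let c := copairing dm la eta.
Let c1 := app c one.
Let e1 := app eta one.
Let p := pairing dl mu eps.

Hypothesis left_counit : forall X, app (slice_left A eps) (app la X) = X.
Hypothesis right_counit : forall X, tsc (sgn dl) (app (slice_right A eps) (app la X)) = X.
Hypothesis left_pairing : forall X Y, prod X Y = tsc (sgn (dm * dl + dl + dl * deg X))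
  (app (slice_left A p) (app (mixl A A A) (ten Star X (app la Y)))).
Hypothesis right_pairing : forall X Y, prod X Y = tsc (sgn (dm * dl))
  (app (slice_right A p) (app (mixr A A A) (ten Star (app la X) Y))).
Hypothesis p_symmetric : forall X Y,
  app p (ten Star Y X) = tsc (sgn (dm + deg X * deg Y)) (app p (ten Star X Y)).
Hypothesis duE : du = - dm.
Hypothesis deE : de = - dl.
Hypothesis p_surjective : forall F : elt (gdual A), exists2 X : elt A,
  deg F = deg X + (dm + de) &
  forall Y, cf (app p (ten Star X Y)) = cf (app (functional F) Y).
Hypothesis etaE : forall Y, cf (app p (ten Star e1 Y)) = sgn (dm + de) * cf (app eps Y).

Let deg_e1 : deg e1 = - dm.
Proof. by rewrite deg_app deg_one duE add0r. Qed.

Lemma left_unit_of_counit X : tsc (sgn dm) (prod e1 X) = X.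
Proof.
have dE : de = deg e1 + (dm + de) by rewrite deg_e1; lia.
rewrite left_pairing (slice_left_pairing Ac _ dE etaE) left_counit !tscA deg_e1.
by rewrite -[RHS]tsc1; congr tsc; rewrite deE; sign_cases.
Qed.

Lemma right_unit_of_counit X : tsc (sgn (du * deg X)) (prod X e1) = X.
Proof.
have dE : de = deg e1 + (dm + de) by rewrite deg_e1; lia.
(* The first sign exchanges [V] and [e1] in [p], for [V] of degree [- de]. *)
pose a := sgn (dm + dm * de) * sgn (dm + de).
rewrite right_pairing (@slice_right_pairing _ A A A Ac _ _ p eps _ e1 a dE) => [|V Vd]; last first.
  rewrite p_symmetric cf_tsc etaE mulrA; congr (_ * _); congr (_ * _).
  rewrite deg_e1; have -> : deg V = - de by lia.
  by sign_cases.
have -> : app (slice_right A eps) (app la X) = tsc (sgn dl) X.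
  exact: canRL (@tsc_sgnK A _) (right_counit X).
rewrite !tscA deg_app -[RHS]tsc1; congr tsc; rewrite /a deg_e1 deE duE.
by sign_cases.
Qed.

(** By the pairing relations, slicing a coproduct by [p (X, -)] is multiplication
    by [X]. *)
Let slice_la (F : elt (gdual A)) : exists X, [/\ deg F = deg X + (dm + de),
  forall Y, app (slice_left A (functional F)) (app la Y) =
    tsc (sgn (dm * dl + dl + dl * deg X)) (prod X Y) &
  forall Y, app (slice_right A (functional F)) (app la Y) =
    tsc (sgn (dm * dl + dm + deg X * deg Y + deg X * dl)) (prod Y X)].
Proof.
have [X dF pX] := p_surjective F; exists X; split=> // Y.
  have pX1 V : cf (app p (ten Star X V)) = 1 * cf (app (functional F) V) by rewrite pX mul1r.
  by rewrite left_pairing (slice_left_pairing Ac _ dF pX1) tsc1 tsc_sgnK.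
(* The sign of exchanging [X] and an element of degree [- deg F] in [p]. *)
pose a := sgn (dm + deg F * deg X).
rewrite right_pairing (@slice_right_pairing _ A A A Ac _ _ p (functional F) _ X a dF) => [|V Vd]; last first.
  rewrite p_symmetric cf_tsc pX; congr (_ * _).
  have -> : deg V = - deg F by lia.
  by rewrite /a; sign_cases.
rewrite !tscA -[LHS]tsc1; congr tsc; rewrite /a deg_app dF deE.
by sign_cases.
Qed.

Let c1E : c1 = tsc (sgn (dl * dm + dm)) (app la e1).
Proof. by rewrite /c1 /c /copairing app_gscale app_gcomp. Qed.

Let unit_prod X : prod e1 X = tsc (sgn dm) X.
Proof. exact: canRL (@tsc_sgnK A _) (left_unit_of_counit X). Qed.

Let prod_unit X : prod X e1 = tsc (sgn (du * deg X)) X.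
Proof. exact: canRL (@tsc_sgnK A _) (right_unit_of_counit X). Qed.

Let slice_copairing (F : elt (gdual A)) : exists X, [/\ deg F = deg X + (dm + de),
  app (slice_left A (functional F)) c1 = tsc (sgn (dm + dl + dl * deg X + dm * deg X)) X,
  app (slice_right A (functional F)) c1 = tsc (sgn (dm + dl * deg X + dm * deg X)) X,
  forall Y, app (slice_left A (functional F)) (app la Y) =
    tsc (sgn (dm * dl + dl + dl * deg X)) (prod X Y) &
  forall Y, app (slice_right A (functional F)) (app la Y) =
    tsc (sgn (dm * dl + dm + deg X * deg Y + deg X * dl)) (prod Y X)].
Proof.
have [X [dF Lla Rla]] := slice_la F; exists X; split=> //.
  rewrite c1E app_tsc Lla prod_unit !tscA; congr tsc; rewrite duE.
  by sign_cases.
rewrite c1E app_tsc Rla unit_prod !tscA; congr tsc; rewrite deg_e1.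
by sign_cases.
Qed.

Lemma left_copairing_of_counit X : app la X =
  app (gtmap Shriek id mu) (app (mixr A A A) (ten Star c1 X)).
Proof.
apply: (slice_left_separates Ac) => [|F].
  by rewrite !(deg_app, deg_ten) deg_one; lia.
have [X0 [dF Lc _ Lla _]] := slice_copairing F.
rewrite slice_left_product // Lc Lla ten_tscl app_tsc !tscA; congr tsc; rewrite dF deE.
by sign_cases.
Qed.

Lemma right_copairing_of_counit X : app la X = tsc (sgn (dm + (du + dl) * deg X))
  (app (gtmap Shriek mu id) (app (mixl A A A) (ten Star X c1))).
Proof.
apply: (slice_right_separates Ac) => [|F].
  by rewrite !(deg_tsc, deg_app, deg_ten) deg_one; lia.
have [X0 [dF _ Rc _ Rla]] := slice_copairing F.
rewrite app_tsc slice_right_product // Rc Rla ten_tscr app_tsc !tscA; congr tsc.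
rewrite dF deE duE.
by sign_cases.
Qed.

Lemma copairing_symmetry_of_counit :
  app (gswap Shriek A A) c1 = tsc (sgn dl) c1.
Proof.
apply: (slice_left_separates Ac) => [|F]; first by rewrite !(deg_tsc, deg_app) addr0.
have [X [_ Lc Rc _ _]] := slice_copairing F.
rewrite slice_left_swap // Rc app_tsc Lc tscA; congr tsc.
by sign_cases.
Qed.

End FromCounit.
End Core.

Theorem corollary5p10 (k : fieldType) :
  (forall (A : gspace k) (dm dl du : int)
     (mu : ghom dm (gtensor Star A A) A) (la : ghom dl A (gtensor Shriek A A))
     (eta : ghom du (ground k) A),
     unital_coFrobenius mu la eta ->
     let c := copairing dm la eta in
     top_iso (vec_c c) ->
     biunital_coFrobenius mu la eta
       (gscale (sgn k (dm * dl + dl + dm)) (gcomp (elt_dual eta) (ginv (vec_c c)))))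
  /\
  (forall (A : gspace k) (dm dl de : int)
     (mu : ghom dm (gtensor Star A A) A) (la : ghom dl A (gtensor Shriek A A))
     (eps : ghom de A (ground k)),
     counital_coFrobenius mu la eps ->
     let p := pairing dl mu eps in
     top_iso (vec_p p) ->
     biunital_coFrobenius mu la
       (gscale (sgn k (dm + de)) (gcomp (ginv (vec_p p)) (form_dual eps))) eps).
Proof.
split=> [A dm dl du mu la eta|A dm dl de mu la eps].
- move=> [At As [Ul Ur] Co [C1 C2 C3]] c iso; set eps := gscale _ _.
  have Ac i : converging (A i) := complete_converging (At i).1.
  have duE : du = - dm by have [? _] := Ul; lia.
  have deE : - (du + dl) + du = - dl by lia.
  have LU := (left_unitE mu eta).1 Ul; have RU := (right_unitE mu eta).1 Ur.
  have LC := (left_copairingE mu la c).1 C1; have RC := (right_copairingE mu la c).1 C2.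
  have SC := (copairing_symmetryE dl c).1 C3.
  have [gK Kg] := ginvP iso.
  have cF X : exists F : elt (gdual A),
      X = tsc (sgn k (deg F * (du + dl))) (app (slice_left A (functional F)) (app c (one k))).
    by exists (app (ginv (vec_c c)) X); rewrite -app_vec_c ?Kg.
  have epsE (F : elt (gdual A)) : cf (app eps (tsc (sgn k (deg F * (du + dl)))
        (app (slice_left A (functional F)) (app c (one k))))) =
      sgn k (dm * dl + dl + dm) * sgn k (deg F * du) * cf (app (functional F) (app eta (one k))).
    by rewrite -app_vec_c // app_gscale app_gcomp gK cf_tsc cf_elt_dual mulrA.
  split=> //; split.
  + by apply/left_counitE; apply: (left_counit_of_unit Ac).
  + by apply/right_counitE; apply: (right_counit_of_unit Ac).
  + by apply/left_pairingE; apply: (left_pairing_of_unit Ac).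
  + by apply/right_pairingE; apply: (right_pairing_of_unit Ac).
  + by apply/pairing_symmetryE; apply: (pairing_symmetry_of_unit (la := la) Ac).
- move=> [At As Co [Cl Cr] [P1 P2 P3]] p iso; set eta := gscale _ _.
  have Ac i : converging (A i) := complete_converging (At i).1.
  have deE : de = - dl by have [? _] := Cl; lia.
  have duE : de + - (dm + de) = - dm by lia.
  have LU := (left_counitE la eps).1 Cl; have RU := (right_counitE la eps).1 Cr.
  have LP := (left_pairingE mu la p).1 P1; have RP := (right_pairingE mu la p).1 P2.
  have SP := (pairing_symmetryE dm p).1 P3.
  have [gK Kg] := ginvP iso.
  have pF (F : elt (gdual A)) : exists2 X : elt A, deg F = deg X + (dm + de) &
      forall Y, cf (app p (ten Star X Y)) = cf (app (functional F) Y).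
    exists (app (ginv (vec_p p)) F); first by rewrite deg_app; lia.
    by move=> Y; rewrite -cf_vec_p // Kg.
  have etaE Y : cf (app p (ten Star (app eta (one k)) Y)) =
      sgn k (dm + de) * cf (app eps Y).
    by rewrite [app eta _]app_gscale app_gcomp ten_tscl app_tsc cf_tsc -cf_vec_p // Kg cf_form_dual.
  split=> //; split.
  + by apply/left_unitE; apply: (left_unit_of_counit Ac).
  + by apply/right_unitE; apply: (right_unit_of_counit Ac).
  + by apply/left_copairingE; apply: (left_copairing_of_counit Ac).
  + by apply/right_copairingE; apply: (right_copairing_of_counit Ac).
  + by apply/copairing_symmetryE; apply: (copairing_symmetry_of_counit (mu := mu) Ac).
Qed.
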